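(* Let $E$ be a Banach space which satisfies one of the following six conditions: (i) $E$ has a Schauder basis and is complemented in its bidual; (ii) $E$ is isomorphic to the dual space of a Banach space with a Schauder basis; (iii) $E$ is an injective Banach space; (iv) $E=c_0(\mathbb{I})$, $E=H$, or $E=c_0(\mathbb{I})\oplus H$, where $\mathbb{I}$ is a non-empty index set and $H$ is a Hilbert space; (v) $E$ is a Banach space which has few operators; (vi) $E=C(K)$, where $K$ is a compact Hausdorff space without isolated points, and each operator on $C(K)$ is a weak multiplication. Then each finitely-generated, maximal left ideal of $\mathscr{B}(E)$ is fixed.
   Context: All Banach spaces are complex; ''operator'' means bounded linear operator, and $\mathscr{B}(E)$ is the Banach algebra of operators on $E$. A left ideal of $\mathscr{B}(E)$ is finitely generated if it equals $\{\sum_{T\in\Gamma}S_TT: S_T\in\mathscr{B}(E)\}$ for some non-empty finite $\Gamma\subseteq\mathscr{B}(E)$. A maximal left ideal is a left ideal that is maximal among proper left ideals; it is fixed if it has the form $\{T\in\mathscr{B}(E): Tx=0\}$ for some $x\in E\setminus\{0\}$. Schauder bases are sequences $(e_j)_{j\in\mathbb{N}}$. $E$ is complemented in its bidual if $\kappa_E(E)$ is complemented in $E^{**}$, where $\kappa_E\colon E\to E^{**}$ is the canonical embedding. $E$ is injective if, whenever a Banach space $F$ contains a closed subspace $G$ isomorphic to $E$, then $G$ is complemented in $F$. $c_0(\mathbb{I})$ is the closed subspace of $\ell_\infty(\mathbb{I})$ (bounded functions $\mathbb{I}\to\mathbb{C}$ with the supremum norm) of those $f$ such that $\{i\in\mathbb{I}:|f(i)|\ge\epsilon\}$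 is finite for each $\epsilon>0$. An operator $T$ is strictly singular if no restriction of $T$ to an infinite-dimensional subspace is bounded below ($\|Tx\|\ge\epsilon\|x\|$ for some $\epsilon>0$ and all $x$ in the subspace). $E$ has few operators if $E$ is infinite-dimensional and each operator on $E$ is the sum of a scalar multiple of the identity and a strictly singular operator. $C(K)$ is the space of continuous complex-valued functions on $K$ with the supremum norm. An operator $T$ on $C(K)$ is a weak multiplication if $T=M_g+S$ for some $g\in C(K)$ and some weakly compact operator $S$ on $C(K)$, where $M_gf=gf$. *)

(* Defs.v *)
From HB Require Import structures.
From mathcomp Require Import all_boot all_order all_algebra.
From mathcomp Require Import all_classical all_reals all_analysis.
From mathcomp Require Import sesquilinear complex.

Set Implicit Arguments.
Unset Strict Implicit.
Unset Printing Implicit Defensive.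

Import Order.TTheory GRing.Theory Num.Theory.
Import numFieldNormedType.Exports.

Local Open Scope classical_set_scope.
Local Open Scope ring_scope.

(* Complex scalars are R[i] for an arbitrary R : realType, and a Banach space
   is a completeNormedModType R[i]; norms take their values in R[i], whose
   order is x <= y iff y - x is a nonnegative real. *)

HB.instance Definition _ (R : realType) := NormedModule.copy R[i] R[i]^o.

Section complex_line.
Variable R : realType.
Implicit Types z : R[i].

Lemma ge0_ReK z : 0 <= z -> (complex.Re z)%:C%C = z.
Proof. by case: z => a b; rewrite lecE /= => /andP[/eqP-> _]. Qed.

Lemma normc_ReK (V : normedModType R[i]) (x : V) :
  (complex.Re `|x|)%:C%C = `|x|.
Proof. exact: ge0_ReK. Qed.

Lemma normc_i : `|'i%C : R[i]| = 1.
Proof. by rewrite normc_def /= expr0n /= add0r expr1n sqrtr1. Qed.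

Lemma normc_real (x : R) : `|x%:C%C| = (`|x|)%:C%C :> R[i].
Proof. by rewrite normc_def /= expr0n /= addr0 sqrtr_sqr. Qed.

Lemma normc_Im_le z : (`|complex.Im z|)%:C%C <= `|z|.
Proof.
have := normc_ge_Re (z * 'i%C).
by rewrite ReiNIm normrN normrM normc_i mulr1.
Qed.

Lemma normc_le_ReIm z :
  `|z| <= (`|complex.Re z| + `|complex.Im z|)%:C%C.
Proof.
rewrite {1}[z]complexE (le_trans (ler_normD _ _)) // normrM normc_i mul1r.
by rewrite !normc_real -raddfD.
Qed.

Lemma ReB y z : complex.Re (y - z) = complex.Re y - complex.Re z.
Proof. by case: y z => [a b] [c d]. Qed.

Lemma ImB y z : complex.Im (y - z) = complex.Im y - complex.Im z.
Proof. by case: y z => [a b] [c d]. Qed.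

Lemma complex_complete (F : set_system R[i]) :
  ProperFilter F -> cauchy F -> cvg F.
Proof.
move=> FF cF.
have cvgR (p : R[i] -> R) :
    (forall y z, (`|p y - p z|)%:C%C <= `|y - z|) -> cvg (p @ F).
  move=> pL; apply: cauchy_cvg; apply: cauchy_exP => e e0.
  have e0' : 0 < e%:C%C :> R[i] by rewrite ltcR.
  have [z Fz] := (cauchyP F).1 cF _ e0'.
  exists (p z); rewrite /fmap/=; apply: filterS Fz => y.
  rewrite -!ball_normE /= => zy.
  by have := le_lt_trans (pL z y) zy; rewrite ltcR.
have cRe : cvg (@complex.Re R @ F).
  by apply: cvgR => y z; rewrite -ReB (le_trans _ (normc_ge_Re _)).
have cIm : cvg (@complex.Im R @ F).
  by apply: cvgR => y z; rewrite -ImB normc_Im_le.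
apply/cvg_ex; exists (lim (@complex.Re R @ F) +i* lim (@complex.Im R @ F))%C.
apply/cvgrPdist_lt => e e0.
have He : (complex.Re e)%:C%C = e by exact/ge0_ReK/ltW.
have e2 : 0 < complex.Re e / 2.
  by rewrite divr_gt0 // -ltcR He.
move/cvgrPdist_lt : cRe => /(_ _ e2) cRe.
move/cvgrPdist_lt : cIm => /(_ _ e2) cIm.
near=> z; apply: (le_lt_trans (normc_le_ReIm _)).
rewrite -He ltcR ReB ImB /= [ltRHS]splitr ltrD //.
  by near: z.
by near: z.
Unshelve. all: by end_near. Qed.

End complex_line.

HB.instance Definition _ (R : realType) :=
  Uniform_isComplete.Build R[i] (@complex_complete R).

Section sup_norm.
Variables (R : realType) (T : Type) (F : normedModType R[i]).
Implicit Types (A : set T) (f g : T -> F).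

Definition bounded_on A f := exists M : R[i], forall x, A x -> `|f x| <= M.

(* sup set0 = 0, which covers A = set0. *)
Definition sup_norm A f : R[i] :=
  (sup [set complex.Re `|f x| | x in A])%:C%C.

Lemma sup_norm_ub A f x : bounded_on A f -> A x -> `|f x| <= sup_norm A f.
Proof.
move=> [M fM] Ax; rewrite -normc_ReK lecR; apply: ub_le_sup; last by exists x.
exists (complex.Re M) => _ [y Ay <-].
by have := fM _ Ay; rewrite lecE => /andP[].
Qed.

Lemma sup_norm_le A f (M : R[i]) : 0 <= M ->
  (forall x, A x -> `|f x| <= M) -> sup_norm A f <= M.
Proof.
move=> M0 fM; have [->|/set0P[x Ax]] := eqVneq A set0.
  by rewrite /sup_norm image_set0 sup0.
rewrite /sup_norm -(ge0_ReK M0) lecR; apply: ge_sup.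
  by exists (complex.Re `|f x|), x.
by move=> _ [y Ay <-]; have := fM _ Ay; rewrite lecE => /andP[].
Qed.

Lemma sup_norm_ge0 A f : bounded_on A f -> 0 <= sup_norm A f.
Proof.
move=> fb; have [->|] := eqVneq A set0.
  by rewrite /sup_norm image_set0 sup0.
by move=> /set0P[x Ax]; exact: le_trans (sup_norm_ub fb Ax).
Qed.

Lemma sup_normD A f g : bounded_on A f -> bounded_on A g ->
  sup_norm A (f + g) <= sup_norm A f + sup_norm A g.
Proof.
move=> fb gb; apply: sup_norm_le; first by rewrite addr_ge0 ?sup_norm_ge0.
move=> x Ax; rewrite (le_trans (ler_normD _ _)) // lerD //;
  exact: sup_norm_ub.
Qed.

Lemma sup_normZ A (a : R[i]) f : bounded_on A f ->
  sup_norm A (a *: f) = `|a| * sup_norm A f.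
Proof.
have sub (b : R[i]) g : bounded_on A g ->
    sup_norm A (b *: g) <= `|b| * sup_norm A g.
  move=> gb; apply: sup_norm_le; first by rewrite mulr_ge0 ?sup_norm_ge0.
  by move=> x Ax; rewrite [leLHS]normrZ ler_wpM2l // sup_norm_ub.
move=> fb; apply/le_anti; rewrite sub //=.
have [->|a0] := eqVneq a 0.
  rewrite normr0 mul0r sup_norm_ge0 //; exists 0 => x _.
  by rewrite scale0r normr0.
rewrite -ler_pdivlMl ?normr_gt0 // -normfV.
rewrite -[X in sup_norm _ X <= _](scalerK a0); apply: sub.
have [M fM] := fb; exists (`|a| * M) => x Ax.
by rewrite [leLHS]normrZ ler_wpM2l // fM.
Qed.

End sup_norm.

Lemma sup_complete (R : realType) (V : normedModType R[i]) (T : Type)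
    (F : completeNormedModType R[i]) (A : set T) (ev : V -> T -> F)
    (k : T -> R[i]) :
  (forall u v x, ev (u - v) x = ev u x - ev v x) ->
  (forall x, 0 < k x) ->
  (forall v x, `|ev v x| <= k x * `|v|) ->
  (forall x, A x -> k x <= 1) ->
  (forall v (M : R[i]), 0 <= M -> (forall x, A x -> `|ev v x| <= M) ->
     `|v| <= M) ->
  (forall (l : T -> F) (P : set_system V), ProperFilter P ->
     (forall x, ev v x @[v --> P] --> l x) ->
     (exists v, forall x, A x -> `|l x - ev v x| <= 1) ->
     exists w, ev w = l) ->
  forall P : set_system V, ProperFilter P -> cauchy P -> cvg P.
Proof.
move=> evB k0 ev_le kA le_ev evc P PF cP.
have cvx x : cvg (ev v x @[v --> P]).
  apply: cauchy_cvg; apply: cauchy_exP => e e0.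
  have ek0 : 0 < (k x)^-1 * e by rewrite mulr_gt0 ?invr_gt0.
  have [v Pv] := (cauchyP P).1 cP _ ek0.
  exists (ev v x); rewrite /fmap/=; apply: filterS Pv => u.
  rewrite -!ball_normE /= => vu; rewrite -evB (le_lt_trans (ev_le _ _)) //.
  by rewrite -ltr_pdivlMl.
pose l x := lim (ev v x @[v --> P]).
have lP x : ev v x @[v --> P] --> l x by exact: cvx.
have unif (e : R[i]) v : 0 < e -> P (ball v e) ->
    forall x, A x -> `|l x - ev v x| <= e.
  move=> e0 Pv x Ax; apply/ler_addgt0Pr => d d0.
  have /cvgrPdist_lt/(_ _ d0) ld := lP x.
  have [u [/= lu uv]] := filter_ex (filterI ld Pv).
  rewrite -(subrK (ev u x) (l x)) -addrA (le_trans (ler_normD _ _)) //.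
  rewrite [leRHS]addrC lerD //; first exact: ltW.
  rewrite -evB (le_trans (ev_le _ _)) //.
  move: uv; rewrite -ball_normE /= distrC => /ltW uv.
  by rewrite (le_trans _ uv) // ler_piMl // kA.
have [w wl] : exists w, ev w = l.
  apply: (evc l P) => //.
  have [v Pv] := (cauchyP P).1 cP _ (ltr01 : 0 < 1 :> R[i]).
  by exists v => x Ax; exact: unif ltr01 Pv _ Ax.
apply/cvg_ex; exists w; apply/cvgrPdist_lt => e e0.
have e2 : 0 < e / 2 by rewrite divr_gt0.
have [v Pv] := (cauchyP P).1 cP _ e2.
apply: filterS (Pv) => u; rewrite -ball_normE /= => vu.
rewrite -(subrK v w) -addrA (le_lt_trans (ler_normD _ _)) //.
rewrite [ltRHS]splitr ler_ltD //; apply: le_ev => [|x Ax]; first exact: ltW.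
by rewrite evB wl; exact: unif e2 Pv _ Ax.
Qed.

Section operators.
Variables (R : realType) (E F : completeNormedModType R[i]).

Definition is_operator : {pred E -> F} := fun T =>
  `[< linear T /\ exists M : R[i], forall x, `|T x| <= M * `|x| >].

Lemma is_operator_submod : submod_closed is_operator.
Proof.
split=> [|a f g /asboolP[fl [M fM]] /asboolP[gl [N gN]]]; apply/asboolP; split.
- by move=> a x y /=; rewrite scaler0 addr0.
- by exists 0 => x; rewrite normr0 mul0r.
- move=> b x y; rewrite /= !fctE fl gl !scalerDr !scalerA [a * b]mulrC.
  by rewrite addrACA.
- exists (`|a| * M + N) => x.
  rewrite mulrDl -mulrA (le_trans (ler_normD _ _)) // lerD //.
  by rewrite [leLHS]normrZ ler_wpM2l.
Qed.

HB.instance Definition _ := GRing.isSubmodClosed.Build R[i] (E -> F)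
  is_operator (GRing.submod_closed_semi is_operator_submod).

Record operator := Operator {
  op_fun :> E -> F;
  op_funP : op_fun \in is_operator }.

HB.instance Definition _ := [isSub for op_fun].
HB.instance Definition _ := [Choice of operator by <:].
HB.instance Definition _ :=
  [SubChoice_isSubLmodule of operator by <:].

HB.instance Definition _ (T : operator) :=
  GRing.isLinear.Build R[i] E F *:%R T (asboolP _ (op_funP T)).1.

End operators.

Lemma cvg_lin (K : numFieldType) (V : normedModType K) (U : Type)
    (Q : set_system U) (f g h : U -> V) (a : K) (l m : V) :
  Filter Q -> (forall u, h u = a *: f u + g u) ->
  f @ Q --> l -> g @ Q --> m -> h @ Q --> a *: l + m.
Proof.
move=> FQ hE fl gm; rewrite (_ : h = (a \*: f) \+ g); last exact/funext.
by apply: cvgD => //; exact: cvgZl_tmp.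
Qed.

Section operator_norm.
Variables (R : realType) (E F : completeNormedModType R[i]).
Implicit Types S T : operator E F.

Local Notation unit_ball := [set x : E | `|x| <= 1].

Lemma operator_ub T : exists2 M : R[i], 0 <= M & forall x, `|T x| <= M * `|x|.
Proof.
have /asboolP[_ [M TM]] := op_funP T.
have [x0|] := pselect (exists x : E, x != 0); last first.
  move=> x0; exists 0 => // x; rewrite mul0r.
  have [->|xn0] := eqVneq x 0; first by rewrite linear0 normr0.
  by exfalso; apply: x0; exists x.
exists M => //; have [x xn0] := x0.
by rewrite -(pmulr_lge0 _ (_ : 0 < `|x|)) ?normr_gt0 // (le_trans _ (TM x)).
Qed.

Lemma operator_bounded T : bounded_on unit_ball T.
Proof.
have [M M0 TM] := operator_ub T; exists M => x /= x1.
by rewrite (le_trans (TM x)) // ler_piMr.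
Qed.

Definition op_norm T : R[i] := sup_norm unit_ball T.

Lemma op_norm_bound T x : `|T x| <= op_norm T * `|x|.
Proof.
have [->|x0] := eqVneq x 0; first by rewrite linear0 !normr0 mulr0.
have nx : 0 < `|x| by rewrite normr_gt0.
have x1 : `| `|x|^-1 *: x | <= 1 by rewrite normfZV.
have := sup_norm_ub (operator_bounded T) x1.
by rewrite linearZ (@normrZ _ F) ger0_norm ?invr_ge0 // mulrC ler_pdivrMr.
Qed.

Lemma op_normD S T : op_norm (S + T) <= op_norm S + op_norm T.
Proof. exact: (sup_normD (operator_bounded S) (operator_bounded T)). Qed.

Lemma op_normZ (a : R[i]) T : op_norm (a *: T) = `|a| * op_norm T.
Proof. exact: (sup_normZ a (operator_bounded T)). Qed.

Lemma op_norm_eq0 T : op_norm T = 0 -> T = 0.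
Proof.
move=> T0; apply: val_inj; apply/funext => x; apply/eqP.
by rewrite -normr_le0 (le_trans (op_norm_bound T x)) // T0 mul0r.
Qed.

HB.instance Definition _ := Lmodule_isNormed.Build R[i] (operator E F)
  op_normD op_normZ op_norm_eq0.

End operator_norm.

Section operator_complete.
Variables (R : realType) (E F : completeNormedModType R[i]).

Lemma operator_complete (P : set_system (operator E F)) :
  ProperFilter P -> cauchy P -> cvg P.
Proof.
apply: (@sup_complete R (operator E F) E F [set x : E | `|x| <= 1]
  (fun T => T) (fun x => if `|x| <= 1 then 1 else `|x|)).
- by move=> S T x.
- by move=> x; case: ifPn => // x1; rewrite lt_def normr_ge0 andbT;
  apply: contraNN x1 => /eqP->.
- move=> T x; rewrite (le_trans (op_norm_bound T x)) //.
  rewrite [leRHS]mulrC; apply: (@ler_wpM2l _ `|T|); first exact: normr_ge0.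
  by case: ifP.
- by move=> x /= ->.
- by move=> T M M0 TM; exact: sup_norm_le.
move=> l Q QF lQ [T lT].
have ll : linear l.
  move=> a x y.
  have lin : (fun T' => op_fun T' (a *: x + y)) @ Q --> a *: l x + l y.
    by apply: cvg_lin (lQ x) (lQ y) => T'; rewrite linearP.
  exact: (cvg_unique (@norm_hausdorff _ F) (lQ _) lin).
have l0 : l 0 = 0 by have := ll (-1) 0 0; rewrite scaler0 addr0 scaleN1r addNr.
have lZ a x : l (a *: x) = a *: l x by rewrite -[a *: x]addr0 ll l0 addr0.
have lb : exists M : R[i], forall x, `|l x| <= M * `|x|.
  exists (1 + op_norm T) => x; have [->|x0] := eqVneq x 0.
    by rewrite l0 !normr0 mulr0.
  have nx : 0 < `|x| by rewrite normr_gt0.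
  have x1 : `| `|x|^-1 *: x | <= 1 by rewrite normfZV.
  rewrite -ler_pdivrMr // mulrC.
  have -> : `|x|^-1 * `|l x| = `|l (`|x|^-1 *: x)|.
    by rewrite lZ normrZ ger0_norm ?invr_ge0.
  rewrite -(subrK (T (`|x|^-1 *: x)) (l _)) (le_trans (ler_normD _ _)) //.
  rewrite lerD //; first exact: lT.
  exact: sup_norm_ub (operator_bounded T) x1.
have lop : l \in @is_operator R E F by apply/asboolP.
by exists (Operator lop).
Qed.

HB.instance Definition _ :=
  Uniform_isComplete.Build (operator E F) operator_complete.

End operator_complete.

Definition dual (R : realType) (E : completeNormedModType R[i]) :=
  operator E R[i].

(* Makes the join structures that cvg needs available on product types. *)
HB.saturate prod.

Section product_complete.
Variables (R : realType) (E F : completeNormedModType R[i]).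

Lemma prod_complete (P : set_system (E * F)%type) :
  ProperFilter P -> cauchy P -> cvg P.
Proof.
move=> PF cP.
have cvgp (G : completeNormedModType R[i]) (p : E * F -> G) :
    (forall u v, `|p u - p v| <= `|u - v|) -> cvg (p @ P).
  move=> pL; apply: cauchy_cvg; apply: cauchy_exP => e e0.
  have [z Pz] := (cauchyP P).1 cP _ e0.
  exists (p z); rewrite /fmap/=; apply: filterS Pz => y.
  rewrite -!ball_normE /= => zy; exact: le_lt_trans (pL _ _) zy.
have c1 : cvg (fst @ P).
  apply: cvgp => u v.
  by rewrite prod_normE comparable_le_max ?real_comparable ?normr_real //
    lexx.
have c2 : cvg (snd @ P).
  apply: cvgp => u v.
  by rewrite prod_normE comparable_le_max ?real_comparable ?normr_real //
    lexx orbT.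
apply/cvg_ex; exists (lim (fst @ P), lim (snd @ P)).
apply/cvgrPdist_lt => e e0.
move/cvgrPdist_lt : c1 => /(_ _ e0) c1.
move/cvgrPdist_lt : c2 => /(_ _ e0) c2.
near=> z.
rewrite prod_normE comparable_gt_max ?real_comparable ?normr_real //=.
by apply/andP; split; near: z.
Unshelve. all: by end_near. Qed.

HB.instance Definition _ := Uniform_isComplete.Build (E * F)%type prod_complete.

End product_complete.

Section ell_infty.
Variables (R : realType) (I : Type).

Definition is_bounded : {pred I -> R[i]} := fun f => `[< bounded_on setT f >].

Lemma is_bounded_submod : submod_closed is_bounded.
Proof.
split=> [|a f g /asboolP[M fM] /asboolP[N gN]]; apply/asboolP.
  by exists 0 => x _; rewrite normr0.
exists (`|a| * M + N) => x _; rewrite (le_trans (ler_normD _ _)) // lerD //.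
  by rewrite [leLHS]normrZ ler_wpM2l // fM.
exact: gN.
Qed.

HB.instance Definition _ := GRing.isSubmodClosed.Build R[i] (I -> R[i])
  is_bounded (GRing.submod_closed_semi is_bounded_submod).

Record ell_infty := EllInfty {
  ell_infty_fun :> I -> R[i];
  ell_infty_funP : ell_infty_fun \in is_bounded }.

HB.instance Definition _ := [isSub for ell_infty_fun].
HB.instance Definition _ := [Choice of ell_infty by <:].
HB.instance Definition _ := [SubChoice_isSubLmodule of ell_infty by <:].

Implicit Types f g : ell_infty.

Lemma ell_infty_bounded f : bounded_on setT f.
Proof. exact/asboolP/ell_infty_funP. Qed.

Definition ell_infty_norm f : R[i] := sup_norm setT f.

Lemma ell_infty_norm_ub f i : `|f i| <= ell_infty_norm f.
Proof. exact: sup_norm_ub (ell_infty_bounded f) _. Qed.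

Lemma ell_infty_normD f g :
  ell_infty_norm (f + g) <= ell_infty_norm f + ell_infty_norm g.
Proof. exact: (sup_normD (ell_infty_bounded f) (ell_infty_bounded g)). Qed.

Lemma ell_infty_normZ (a : R[i]) f :
  ell_infty_norm (a *: f) = `|a| * ell_infty_norm f.
Proof. exact: (sup_normZ a (ell_infty_bounded f)). Qed.

Lemma ell_infty_norm_eq0 f : ell_infty_norm f = 0 -> f = 0.
Proof.
move=> f0; apply: val_inj; apply/funext => i; apply/eqP.
by rewrite -normr_le0 (le_trans (ell_infty_norm_ub f i)) // f0.
Qed.

HB.instance Definition _ := Lmodule_isNormed.Build R[i] ell_infty
  ell_infty_normD ell_infty_normZ ell_infty_norm_eq0.

Lemma ell_infty_complete (P : set_system ell_infty) :
  ProperFilter P -> cauchy P -> cvg P.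
Proof.
apply: (@sup_complete R ell_infty I R[i] setT (fun f => f) (fun=> 1)) => //.
- by move=> f i; rewrite mul1r; exact: ell_infty_norm_ub.
- by move=> f M M0 fM; exact: sup_norm_le.
move=> l Q QF _ [f lf].
have lb : l \in is_bounded.
  have [M fM] := ell_infty_bounded f.
  apply/asboolP; exists (1 + M) => i _; rewrite -(subrK (f i) (l i)).
  by rewrite (le_trans (ler_normD _ _)) // lerD ?lf ?fM.
by exists (EllInfty lb).
Qed.

HB.instance Definition _ :=
  Uniform_isComplete.Build ell_infty ell_infty_complete.

End ell_infty.

Section closed_subspaces.
Variables (R : realType) (F : completeNormedModType R[i]).

Definition linear_subspace (W : set F) :=
  W 0 /\ forall (a : R[i]) x y, W x -> W y -> W (a *: x + y).

Record closed_subspace := ClosedSubspace {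
  csub_set : set F;
  csub_linear : linear_subspace csub_set;
  csub_closed : closed csub_set }.
Arguments csub_closed : clear implicits.

Variable G : closed_subspace.

Definition csub_pred : {pred F} := fun x => `[< csub_set G x >].

Lemma csub_submod : submod_closed csub_pred.
Proof.
have [G0 GD] := csub_linear G.
by split=> [|a x y /asboolP Gx /asboolP Gy]; apply/asboolP; auto.
Qed.

HB.instance Definition _ := GRing.isSubmodClosed.Build R[i] F
  csub_pred (GRing.submod_closed_semi csub_submod).

Record csub_type := CSub {
  csub_val :> F;
  csub_valP : csub_val \in csub_pred }.

HB.instance Definition _ := [isSub for csub_val].
HB.instance Definition _ := [Choice of csub_type by <:].
HB.instance Definition _ := [SubChoice_isSubLmodule of csub_type by <:].

Definition csub_norm (x : csub_type) : R[i] := `|csub_val x|.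

Lemma csub_normD x y : csub_norm (x + y) <= csub_norm x + csub_norm y.
Proof. exact: ler_normD. Qed.

Lemma csub_normZ (a : R[i]) x : csub_norm (a *: x) = `|a| * csub_norm x.
Proof. exact: (@normrZ _ F). Qed.

Lemma csub_norm_eq0 x : csub_norm x = 0 -> x = 0.
Proof. by move=> /eqP; rewrite normr_eq0 => /eqP x0; apply: val_inj. Qed.

HB.instance Definition _ := Lmodule_isNormed.Build R[i] csub_type
  csub_normD csub_normZ csub_norm_eq0.

Lemma csub_complete (P : set_system csub_type) :
  ProperFilter P -> cauchy P -> cvg P.
Proof.
move=> PF cP.
have cv : cvg (csub_val @ P).
  apply: cauchy_cvg; apply: cauchy_exP => e e0.
  have [z Pz] := (cauchyP P).1 cP _ e0.
  exists (csub_val z); rewrite /fmap/=; apply: filterS Pz => y.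
  by rewrite -!ball_normE.
have Gl : lim (csub_val @ P) \in csub_pred.
  apply/asboolP.
  have nG : \forall x \near P, csub_set G (csub_val x).
    by apply: filterE => x; exact/asboolP/csub_valP.
  exact: (closed_cvg (csub_set G) (csub_closed G) nG _ cv).
apply/cvg_ex; exists (CSub Gl); apply/cvgrPdist_lt => e e0.
by move/cvgrPdist_lt : cv => /(_ _ e0).
Qed.

HB.instance Definition _ :=
  Uniform_isComplete.Build csub_type csub_complete.

End closed_subspaces.
Coercion csub_type : closed_subspace >-> Sortclass.

Section c0.
Variables (R : realType) (I : Type).

Definition c0_set : set (ell_infty R I) :=
  [set f | forall e : R, 0 < e -> finite_set [set i | e%:C%C <= `|f i|]].

Lemma c0_linear : linear_subspace c0_set.
Proof.
split=> [e e0|a f g cf cg e e0].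
  rewrite (_ : [set _ | _] = set0) //; apply/seteqP; split=> // i /=.
  by rewrite normr0 lecR leNgt e0.
have a1 : 0 < `|a| + 1 :> R[i] by rewrite ltr_wpDl.
have e20 : 0 < e / 2 by rewrite divr_gt0.
have eC0 : 0 < (e / 2)%:C%C :> R[i] by rewrite ltcR.
have d0 : 0 < (e / 2)%:C%C / (`|a| + 1) :> R[i] by rewrite divr_gt0.
pose d := complex.Re ((e / 2)%:C%C / (`|a| + 1)).
have dE : d%:C%C = (e / 2)%:C%C / (`|a| + 1) by exact/ge0_ReK/ltW.
have {}d0 : 0 < d by rewrite -ltcR dE.
apply: (@sub_finite_set _ _ ([set i | d%:C%C <= `|f i|] `|`
  [set i | (e / 2)%:C%C <= `|g i|])); last first.
  by rewrite finite_setU; split; [exact: cf|exact: cg].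
move=> i /= ei; apply/orP; apply: contraTT ei; rewrite negb_or.
have posr (r : R) : 0 < r -> r%:C%C \is @Num.real R[i].
  by move=> r0; rewrite gtr0_real // ltcR.
rewrite -!real_ltNge ?normr_real ?posr // => /andP[fd ge].
apply: (@le_lt_trans _ _ (`|a| * `|f i| + `|g i|)).
  by rewrite -normrM; exact: ler_normD.
rewrite [e]splitr raddfD /= ler_ltD // (le_trans (ler_wpM2l _ (ltW fd))) // dE.
by rewrite mulrA ler_pdivrMr // mulrC ler_wpM2l ?ltW // ltrDl.
Qed.

Lemma c0_closed : closed c0_set.
Proof.
move=> f cf e e0; have e20 : 0 < e / 2 by rewrite divr_gt0.
have eC0 : 0 < (e / 2)%:C%C :> R[i] by rewrite ltcR.
have [g [cg]] := cf _ (nbhsx_ballx f _ eC0).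
rewrite -ball_normE /= => fg.
apply: sub_finite_set (cg _ e20) => i /= ei.
rewrite -(lerD2r (e / 2)%:C%C) -raddfD /= -splitr (le_trans ei) //.
rewrite -(subrK (g i) (f i)) addrC (le_trans (ler_normD _ _)) // lerD2l.
exact/ltW/(le_lt_trans _ fg)/(ell_infty_norm_ub (f - g)).
Qed.

Definition c0 : closed_subspace (ell_infty R I) :=
  ClosedSubspace c0_linear c0_closed.

End c0.

Section continuous_functions.
Variables (R : realType) (K : topologicalType).

Definition cts_set : set (ell_infty R K) :=
  [set f | continuous (f : K -> R[i])].

Lemma cts_linear : linear_subspace cts_set.
Proof.
split=> [x|a f g cf cg x]; first exact: cvg_cst.
by apply: cvg_lin (cf x) (cg x).
Qed.

Lemma cts_closed : closed cts_set.
Proof.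
move=> f cf x; apply/cvgrPdist_lt => e e0.
have e40 : 0 < e / 2 / 2 by rewrite !divr_gt0.
have [g [cg]] := cf _ (nbhsx_ballx f _ e40).
rewrite -ball_normE /= => fg.
have fgi y : `|f y - g y| < e / 2 / 2.
  exact: le_lt_trans (ell_infty_norm_ub (f - g) y) fg.
have e20 : 0 < e / 2 by rewrite divr_gt0.
have /cvgrPdist_lt/(_ _ e20) := cg x; apply: filterS => y gxy.
have eE : e / 2 / 2 + (e / 2 + e / 2 / 2) = e.
  by rewrite addrCA -splitr -splitr.
rewrite -(subrK (g x) (f x)) -addrA (le_lt_trans (ler_normD _ _)) // -eE.
rewrite ltrD // -(subrK (g y) (g x)) -addrA (le_lt_trans (ler_normD _ _)) //.
by rewrite ltrD // distrC.
Qed.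

(* The bounded continuous functions on K, that is C(K) when K is compact. *)
Definition cts : closed_subspace (ell_infty R K) :=
  ClosedSubspace cts_linear cts_closed.

Definition cts_eval (f : cts) (k : K) : R[i] := ell_infty_fun (csub_val f) k.

End continuous_functions.

Section operator_constructions.
Variable R : realType.
Implicit Types E F G : completeNormedModType R[i].

Lemma op_comp_subproof E F G (S : operator F G) (T : operator E F) :
  (S \o T : E -> G) \in @is_operator R E G.
Proof.
apply/asboolP; split; first by move=> a x y /=; rewrite !linearP.
have [M M0 SM] := operator_ub S; have [N N0 TN] := operator_ub T.
exists (M * N) => x; rewrite (le_trans (SM _)) // -mulrA.
exact: ler_wpM2l.
Qed.

Definition op_comp E F G (S : operator F G) (T : operator E F) : operator E G :=
  Operator (op_comp_subproof S T).

Lemma canonical_embedding_subproof E (x : E) :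
  ((fun f : dual E => f x) : dual E -> R[i]) \in @is_operator R (dual E) R[i].
Proof.
apply/asboolP; split=> //; exists `|x| => f.
by rewrite mulrC; exact: op_norm_bound.
Qed.

Definition canonical_embedding E (x : E) : dual (dual E) :=
  Operator (canonical_embedding_subproof x).

End operator_constructions.

Section banach_notions.
Variable R : realType.
Implicit Types E F H : completeNormedModType R[i].

Definition isomorphic E F :=
  exists (U : operator E F) (V : operator F E), cancel U V /\ cancel V U.

Definition isometrically_isomorphic E F :=
  exists U : operator E F, (forall x, `|U x| = `|x|) /\ range U = setT.

Definition complemented F (G : set F) :=
  exists P : operator F F, (forall x, P (P x) = P x) /\ range P = G.

Definition complemented_in_bidual E :=
  complemented (range (@canonical_embedding R E)).

Definition schauder_basis E (e : nat -> E) :=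
  forall x : E, exists! a : nat -> R[i],
    (\sum_(0 <= j < n) a j *: e j) @[n --> \oo] --> x.

Definition has_schauder_basis E := exists e : nat -> E, schauder_basis e.

Definition injective_space E :=
  forall F (G : closed_subspace F), isomorphic E G -> complemented (csub_set G).

Definition hilbert_space H :=
  exists ip : {dot H for Num.conj}, forall x : H, ip x x = `|x| ^+ 2.

Definition infinite_dimensional E (W : set E) :=
  ~ exists s : seq E, forall x, W x ->
      exists c : nat -> R[i], x = \sum_(j < size s) c j *: s`_j.

Definition strictly_singular E F (T : operator E F) :=
  ~ exists W : set E, [/\ linear_subspace W, infinite_dimensional W &
      exists2 eps : R[i], 0 < eps & forall x, W x -> eps * `|x| <= `|T x|].

Definition few_operators E :=
  infinite_dimensional [set: E] /\
  forall T : operator E E, exists (a : R[i]) (S : operator E E),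
    strictly_singular S /\ forall x, T x = a *: x + S x.

(* F with its weak topology, the coarsest one making every f : dual F
   continuous. *)
Definition weak_space F :=
  initial_topology (fun x : F => (fun f => f x) : {ptws dual F -> R[i]}).

Definition weakly_compact E F (T : operator E F) :=
  compact (closure (T @` [set x | `|x| <= 1] : set (weak_space F))).

Definition weak_multiplication (K : topologicalType)
    (T : operator (cts R K) (cts R K)) :=
  exists (g : cts R K) (S : operator (cts R K) (cts R K)),
    weakly_compact S /\
    forall (f : cts R K) (k : K),
      cts_eval (T f) k = cts_eval g k * cts_eval f k + cts_eval (S f) k.

End banach_notions.

Section left_ideals.
Variables (R : realType) (E : completeNormedModType R[i]).
Implicit Types (L J : set (operator E E)) (S T : operator E E).

Definition left_ideal L :=
  [/\ L 0, forall S T, L S -> L T -> L (S + T) &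
      forall S T, L T -> L (op_comp S T)].

Definition maximal_left_ideal L :=
  [/\ left_ideal L, L != setT &
      forall J, left_ideal J -> J != setT -> L `<=` J -> J = L].

Definition finitely_generated L :=
  exists Gamma : set (operator E E),
    [/\ finite_set Gamma, Gamma !=set0 &
        L = [set \sum_(T \in Gamma) op_comp (S T) T |
               S in [set: operator E E -> operator E E]]].

Definition fixed_left_ideal L :=
  exists2 x : E, x != 0 & L = [set T | T x = 0].

End left_ideals.

(* Main.v *)
Require Import Defs.
From HB Require Import structures.
From mathcomp Require Import all_boot all_order all_algebra.
From mathcomp Require Import all_classical all_reals all_analysis.
From mathcomp Require Import sesquilinear complex.
From mathcomp Require Import ring lra.

Set Implicit Arguments.
Unset Strict Implicit.
Unset Printing Implicit Defensive.

Import Order.TTheory GRing.Theory Num.Theory.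
Import numFieldNormedType.Exports.

Local Open Scope classical_set_scope.
Local Open Scope ring_scope.

(** A finitely generated maximal left ideal [L] of the operators on [E] that is
    not fixed contains every operator of rank one
    ([maximal_fixed_or_rank_one]): if [x (x) f] were missing, then [L] together
    with the operators [y (x) f] would generate everything, which forces [L] to
    consist of the operators killing a vector. Moreover [L] is closed, and
    writing its generators as one operator [Psi] from [E] to a finite power [F]
    of [E] gives [L] the form [{S o Psi}] ([finitely_generated_factor]). The open
    mapping theorem for [S |-> S o Psi], applied to operators of rank one, shows
    that [Psi] is bounded below ([nonfixed_bounded_below]). It remains to derive
    the contradiction that the identity belongs to [L], that is, that [Psi] has a
    left inverse, from each of the six conditions.

    If [E] is injective, the range of [Psi] is complemented. If [E] has a basis
    and is complemented in its bidual, or is the dual of a space with a basis,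
    there are operators of finite rank tending to the identity pointwise in a
    weak-star sense; they are [S_n o Psi] with bounded [S_n], and a weak-star
    limit point of the [S_n] gives the left inverse
    ([identity_by_weak_star_limit]).

    If [E] is a sum of [c0(I)] and a Hilbert space [H], operators between the two
    summands are small up to finitely many coordinates
    ([c0_to_hilbert_small], [hilbert_to_c0_coordinates]). So the embedding of
    [H] into [F] is decided by finitely many operators on [H], which have a left
    inverse by an adjoint with respect to an equivalent inner product
    ([hilbert_left_inverse]), and that of [c0(I)] by an embedding of [c0(I)] into
    some [c0(J)], which has a left inverse by a version of Sobczyk's theorem for
    arbitrary index sets ([c0_left_inverse]).

    If [E] has few operators, one of the generators has a nonzero scalar part,
    since strictly singular operators are not jointly bounded below. A strictly
    singular perturbation of the identity differs from an invertible operator by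
    one of finite rank ([fredholm_identity]), so that the identity is in [L].

    For [E = C(K)], weakly compact operators are strictly singular
    ([weakly_compact_strictly_singular]); this rests on the Dunford-Pettis
    property ([weakly_compact_null]), which is obtained from the behaviour of
    weakly compact operators on unconditional series. The generators are then
    multiplications by functions [g j] up to strictly singular operators. The
    [g j] have no common zero, because no point of [K] is isolated, so that a
    combination of the generators with coefficients in [C(K)] is a strictly
    singular perturbation of the identity, and [fredholm_identity] applies
    again. *)

(** * Real-valued norms and convergence *)

Section real_norm.
Variable R : realType.

Definition nrm (V : normedModType R[i]) (x : V) : R := complex.Re `|x|.

Variable V : normedModType R[i].
Implicit Types (x y : V) (a : R[i]).

Lemma nrmE x : (nrm x)%:C%C = `|x|. Proof. exact: normc_ReK. Qed.

Lemma nrm_ge0 x : 0 <= nrm x.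
Proof. by rewrite -lecR nrmE normr_ge0. Qed.

Lemma le_nrm x (r : R) : (nrm x <= r) = (`|x| <= r%:C%C).
Proof. by rewrite -nrmE lecR. Qed.

Lemma nrmD x y : nrm (x + y) <= nrm x + nrm y.
Proof. by rewrite -lecR raddfD /= !nrmE ler_normD. Qed.

Lemma nrmN x : nrm (- x) = nrm x.
Proof. by rewrite /nrm normrN. Qed.

Lemma nrmB x y : nrm (x - y) <= nrm x + nrm y.
Proof. by rewrite -(nrmN y) nrmD. Qed.

Lemma nrm_distC x y : nrm (x - y) = nrm (y - x).
Proof. by rewrite -nrmN opprB. Qed.

Lemma nrm_dist z x y : nrm (x - y) <= nrm (x - z) + nrm (z - y).
Proof. by rewrite -[in leLHS](subrK z x) -addrA nrmD. Qed.

Lemma nrm_ler_dist x y : nrm x - nrm y <= nrm (x - y).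
Proof. by rewrite lerBlDr -[in leLHS](subrK y x) nrmD. Qed.

Lemma nrm0 : nrm (0 : V) = 0.
Proof. by rewrite /nrm normr0. Qed.

Lemma nrm_eq0 x : (nrm x == 0) = (x == 0).
Proof. by rewrite -(inj_eq (@complexI R)) nrmE normr_eq0. Qed.

Lemma nrm_gt0 x : (0 < nrm x) = (x != 0).
Proof. by rewrite lt_def nrm_ge0 andbT nrm_eq0. Qed.

Lemma nrmZ a x : nrm (a *: x) = nrm a * nrm x.
Proof. by apply: (@complexI R); rewrite rmorphM /= !nrmE normrZ. Qed.

Lemma nrm_sum (I : Type) (s : seq I) (P : pred I) (F : I -> V) :
  nrm (\sum_(i <- s | P i) F i) <= \sum_(i <- s | P i) nrm (F i).
Proof.
elim/big_rec2 : _ => [|i x y _ h]; first by rewrite nrm0.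
exact: le_trans (nrmD _ _) (lerD (lexx _) h).
Qed.

End real_norm.

Section scalars.
Variable R : realType.
Implicit Types a b : R[i].

Lemma nrmM a b : nrm (a * b) = nrm a * nrm b.
Proof. exact: nrmZ. Qed.

Lemma nrmR (r : R) : nrm (r%:C%C : R[i]) = `|r|.
Proof. by rewrite /nrm normc_real. Qed.

Lemma nrm1 : nrm (1 : R[i]) = 1.
Proof. by rewrite /nrm normr1. Qed.

Lemma nrmV a : nrm a^-1 = (nrm a)^-1.
Proof. by apply: (@complexI R); rewrite fmorphV /= !nrmE normfV. Qed.

Lemma nrmZR (V : normedModType R[i]) (r : R) (x : V) :
  nrm (r%:C%C *: x) = `|r| * nrm x.
Proof. by rewrite nrmZ nrmR. Qed.

Lemma nrm_Re_le a : `|complex.Re a| <= nrm a.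
Proof. by rewrite -lecR nrmE normc_ge_Re. Qed.

Lemma nrm_Im_le a : `|complex.Im a| <= nrm a.
Proof. by rewrite -lecR nrmE normc_Im_le. Qed.

Lemma nrm_le_ReIm a : nrm a <= `|complex.Re a| + `|complex.Im a|.
Proof. by rewrite -lecR nrmE normc_le_ReIm. Qed.

Lemma phase a : exists u : R[i], nrm u = 1 /\ u * a = (nrm a)%:C%C.
Proof.
have [->|a0] := eqVneq a 0; first by exists 1; rewrite nrm1 mulr0 nrm0.
have na : nrm a != 0 by rewrite nrm_eq0.
exists ((nrm a)%:C%C * a^-1); rewrite divfK //; split => //.
by rewrite nrmM nrmR nrmV ger0_norm ?nrm_ge0 // divff.
Qed.

End scalars.

Section convergence.
Variables (R : realType) (V : normedModType R[i]).

Lemma nrm_cvgP (T : Type) (F : set_system T) {FF : Filter F} (u : T -> V) (l : V) :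
  u @ F --> l <-> forall e : R, 0 < e -> \forall t \near F, nrm (u t - l) < e.
Proof.
split=> [/cvgrPdist_lt h e e0|h].
  have e0' : 0 < e%:C%C :> R[i] by rewrite ltcR.
  by apply: filterS (h _ e0') => t; rewrite -nrmE ltcR nrm_distC.
apply/cvgrPdist_lt => e e0.
have eE : (complex.Re e)%:C%C = e by exact/ge0_ReK/ltW.
have e0' : 0 < complex.Re e by rewrite -ltcR eE.
by apply: filterS (h _ e0') => t; rewrite -eE -nrmE ltcR nrm_distC.
Qed.

Lemma nrm_cvg_seqP (u : nat -> V) (l : V) : u @ \oo --> l <->
  forall e : R, 0 < e -> exists N, forall n, (N <= n)%N -> nrm (u n - l) < e.
Proof.
split=> [/nrm_cvgP h e e0|h].
  by have [N _ hN] := h _ e0; exists N => n Nn; exact: hN.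
by apply/nrm_cvgP => e e0; have [N hN] := h _ e0; exists N.
Qed.

Lemma nrm_cvg_unique (T : Type) (F : set_system T) {FF : ProperFilter F}
  (u : T -> V) (l m : V) : u @ F --> l -> u @ F --> m -> l = m.
Proof. move=> ul um; exact: (cvg_unique (@norm_hausdorff _ V) ul um). Qed.

Lemma nrm_lim_le (T : Type) (F : set_system T) {FF : ProperFilter F}
    (u : T -> V) (l : V) (c : R) :
  u @ F --> l -> (\forall t \near F, nrm (u t) <= c) -> nrm l <= c.
Proof.
move=> /nrm_cvgP ul uc; apply/ler_addgt0Pr => e e0.
have [t [/= h1 h2]] := filter_ex (filterI (ul _ e0) uc).
have := nrm_dist (u t) l 0; rewrite !subr0 nrm_distC; lra.
Qed.

Lemma half_pow_small (c e : R) : 0 < e -> exists N, c * (1/2) ^+ N < e.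
Proof.
move=> e0; have [c0|c0] := leP c 0.
  by exists 0%N; rewrite expr0 mulr1 (le_lt_trans c0).
have [N hN] : exists N : nat, c / e < N%:R.
  by exists (Num.bound (c / e)); rewrite archi_boundP // divr_ge0 // ltW.
exists N; have h : N%:R <= (2 : R) ^+ N by rewrite -natrX ler_nat ltnW // ltn_expl.
have p0 : (0 : R) < 2 ^+ N by rewrite exprn_gt0.
rewrite div1r exprVn ltr_pdivrMr // mulrC -ltr_pdivrMr //.
exact: lt_le_trans hN h.
Qed.

End convergence.
Arguments nrm_cvg_unique {R V T} F {FF u l m}.

Section geometric_limits.
Variables (R : realType) (V : completeNormedModType R[i]).

Lemma geometric_dist (u : nat -> V) (c : R) :
  (forall n, nrm (u n.+1 - u n) <= c * (1/2) ^+ n) ->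
  forall n m, (n <= m)%N -> nrm (u m - u n) <= 2 * c * (1/2) ^+ n.
Proof.
move=> h n m nm.
have c0 : 0 <= c.
  by have := le_trans (nrm_ge0 _) (h 0%N); rewrite expr0 mulr1.
suff H : nrm (u m - u n) <= 2 * c * ((1/2) ^+ n - (1/2) ^+ m).
  rewrite (le_trans H) // ler_wpM2l ?mulr_ge0 // gerBl exprn_ge0 //; lra.
rewrite -(subnKC nm); elim: (m - n)%N => [|k IH].
  by rewrite addn0 !subrr nrm0 mulr0.
rewrite addnS (le_trans (nrm_dist (u (n + k)%N) _ _)) //.
have := h (n + k)%N; rewrite exprS; lra.
Qed.

Lemma geometric_cvg (u : nat -> V) (c : R) :
  (forall n, nrm (u n.+1 - u n) <= c * (1/2) ^+ n) ->
  exists2 l, u @ \oo --> l & forall n, nrm (u n - l) <= 2 * c * (1/2) ^+ n.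
Proof.
move=> h; have D := geometric_dist h.
have cu : cvg (u @ \oo).
  have PF : ProperFilter (u @ \oo) by exact: fmap_proper_filter.
  apply: cauchy_cvg; apply: (@cauchy_exP _ V) => e e0.
  have eE : (complex.Re e)%:C%C = e by exact/ge0_ReK/ltW.
  have e0' : 0 < complex.Re e by rewrite -ltcR eE.
  have [N hN] := half_pow_small (2 * c) e0'.
  exists (u N); exists N => // n /= Nn.
  rewrite -ball_normE /= -eE -nrmE ltcR nrm_distC.
  exact: le_lt_trans (D _ _ Nn) hN.
exists (lim (u @ \oo)) => // n.
rewrite nrm_distC; apply: (@nrm_lim_le _ _ _ \oo _ (fun m => u m - u n)).
  apply: (cvgB cu); exact: cvg_cst.
by exists n => // m /=; exact: D.
Qed.

End geometric_limits.

(** * The Hahn-Banach theorem *)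

Section real_extension.
Variables (R : realType) (V : lmodType R[i]) (p : V -> R).
Hypothesis pD : forall x y, p (x + y) <= p x + p y.
Hypothesis pZ : forall (t : R) x, 0 <= t -> p (t%:C%C *: x) = t * p x.

(** A real-linear functional dominated by [p] and defined on a real subspace,
    encoded by its graph, so that extension is inclusion. *)
Definition dominated_graph (G : set (V * R)) :=
  [/\ G (0, 0),
      forall (c : R) x a y b, G (x, a) -> G (y, b) ->
        G (c%:C%C *: x + y, c * a + b) &
      forall x a, G (x, a) -> a <= p x].

(** The value at [v] may be any number between the bounds [a - p (x - v)] and
    [p (y + v) - b]; subadditivity of [p] leaves room for one. *)
Lemma dominated_graph_step (G : set (V * R)) v : dominated_graph G ->
  exists G', [/\ dominated_graph G', G `<=` G' & exists a, G' (v, a)].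
Proof.
move=> [G0 GL Gp].
pose A := [set s | exists x a, G (x, a) /\ s = a - p (x - v)].
have A_ub y b : G (y, b) -> ubound A (p (y + v) - b).
  move=> Gyb _ [x [a [Gxa ->]]].
  have Gxy : G (x + y, a + b).
    by have := GL 1 _ _ _ _ Gxa Gyb; rewrite scale1r mul1r.
  have := Gp _ _ Gxy; have := pD (x - v) (y + v).
  by rewrite addrACA addNr addr0; lra.
have A0 : A !=set0 by exists (0 - p (0 - v)); exists 0, 0.
pose c := sup A.
have c1 x a : G (x, a) -> a - p (x - v) <= c.
  move=> Gxa; apply: ub_le_sup; last by exists x, a.
  by exists (p (0 + v) - 0); exact: A_ub.
have c2 y b : G (y, b) -> c <= p (y + v) - b.
  by move=> /A_ub; exact: ge_sup.
pose G' := [set z : V * R | exists x a (t : R),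
  [/\ G (x, a), z.1 = x + t%:C%C *: v & z.2 = a + t * c]].
exists G'; split; last 2 first.
- by move=> [x a] Gxa; exists x, a, 0; rewrite scale0r mul0r !addr0.
- by exists c, 0, 0, 1; rewrite scale1r mul1r !add0r.
split.
- by exists 0, 0, 0; rewrite scale0r mul0r !addr0.
- move=> d _ _ _ _ [x [a [t [/= Gxa -> ->]]]] [y [b [s [/= Gyb -> ->]]]].
  exists (d%:C%C *: x + y), (d * a + b), (d * t + s); split => /=.
  + exact: GL.
  + by rewrite scalerDr addrACA scalerA rmorphD rmorphM /= scalerDl.
  + ring.
move=> _ _ [x [a [t [/= Gxa -> ->]]]].
have GZ (s : R) : G (s%:C%C *: x, s * a).
  by have := GL s _ _ _ _ Gxa G0; rewrite !addr0.
have [t0|t0|->] := ltgtP t 0; last first.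
- by rewrite scale0r mul0r !addr0; exact: Gp.
- have := c2 _ _ (GZ t^-1).
  rewrite -(ler_pM2l t0) mulrBr mulrA divff ?gt_eqF // mul1r.
  rewrite -(pZ _ (ltW t0)) scalerDr scalerA -rmorphM divff ?gt_eqF //= scale1r; lra.
have s0 : 0 < - t by rewrite oppr_gt0.
have := c1 _ _ (GZ (- t)^-1).
rewrite -(ler_pM2l s0) mulrBr mulrA divff ?gt_eqF // mul1r.
rewrite -(pZ _ (ltW s0)) scalerBr scalerA -rmorphM divff ?gt_eqF //= scale1r.
by rewrite rmorphN scaleNr opprK; lra.
Qed.

Lemma real_hahn_banach (G0 : set (V * R)) : dominated_graph G0 ->
  exists f : V -> R,
    [/\ forall (c : R) x y, f (c%:C%C *: x + y) = c * f x + f y,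
        forall x, f x <= p x & forall x a, G0 (x, a) -> f x = a].
Proof.
(* Zorn's lemma is applied to the sets whose union with [G0] is a dominated
   graph, so that the empty chain is no exception. *)
move=> dG0; have [F Ftot|G [dG maxG]] :=
    @Zorn_bigcup _ [set G | dominated_graph (G `|` G0)].
  move=> totF; have [[X0 FX0]|F0] := pselect (exists X, F X); last first.
    rewrite /= (_ : \bigcup_(_ in _) _ = set0) ?set0U //.
    by apply/seteqP; split => // z [X FX _]; case: F0; exists X.
  have [/= z0 zL zp] := Ftot _ FX0; split.
  - by case: z0; [left; exists X0|right].
  - move=> c x a y b h1 h2.
    have pick z : (\bigcup_(X in F) X `|` G0) z ->
        exists2 X, F X & (X `|` G0) z.
      by move=> [[X FX Xz]|G0z]; [exists X => //; left|exists X0 => //; right].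
    have [X FX Xx] := pick _ h1; have [Y FY Yy] := pick _ h2.
    have [XY|YX] := totF _ _ FX FY.
      have [_ /(_ c x a y b) + _] := Ftot _ FY; case=> //.
        by case: Xx => [/XY|]; [left|right].
      by left; exists Y. by right.
    have [_ /(_ c x a y b) + _] := Ftot _ FX; case=> //.
      by case: Yy => [/YX|]; [left|right].
    by left; exists X. by right.
  - move=> x a [[X FX Xx]|G0x].
      by have [_ _] := Ftot _ FX; apply; left.
    by apply: zp; right.
set H := G `|` G0 in dG.
have Htot v : exists a, H (v, a).
  have [G' [dG' HG' [a G'va]]] := dominated_graph_step v dG.
  apply: contrapT => nH; apply: (maxG G').
    split; first by move=> z Gz; apply: HG'; left.
    by move=> G'G; apply: nH; exists a; left; exact: G'G.
  rewrite /= (_ : G' `|` G0 = G') //; apply/seteqP; split; last by left.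
  by move=> z [//|G0z]; apply: HG'; right.
have [f fH] := choice Htot.
have [H0 HL Hp] := dG.
have uniq x a b : H (x, a) -> H (x, b) -> a = b.
  have le a' b' : H (x, a') -> H (x, b') -> a' <= b'.
    move=> ha hb; have h := HL (-1) _ _ _ _ hb ha.
    have e : (-1 : R)%:C%C *: x + x = 0 by rewrite rmorphN scaleN1r addNr.
    have := Hp _ _ h; rewrite e.
    have -> : p 0 = 0 by rewrite -(scale0r 0) (pZ 0 (lexx _)) mul0r.
    lra.
  by move=> ha hb; apply/le_anti; rewrite !le.
exists f; split => [c x y|x|x a G0x].
- by apply: uniq (HL _ _ _ _ _ (fH x) (fH y)); exact: fH.
- exact: Hp (fH x).
- by apply: uniq (fH x) _; right.
Qed.

End real_extension.

(** The complex extension is recovered from its real part [f] as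
    [f x - i f (i x)]. *)
Theorem hahn_banach (R : realType) (V : lmodType R[i]) (p : V -> R)
    (pD : forall x y, p (x + y) <= p x + p y)
    (pZ : forall (a : R[i]) x, p (a *: x) = nrm a * p x)
    (G : set (V * R[i])) :
  G (0, 0) ->
  (forall (c : R[i]) x a y b, G (x, a) -> G (y, b) ->
     G (c *: x + y, c * a + b)) ->
  (forall x a, G (x, a) -> nrm a <= p x) ->
  exists f : V -> R[i],
    [/\ forall (c : R[i]) x y, f (c *: x + y) = c * f x + f y,
        forall x, nrm (f x) <= p x & forall x a, G (x, a) -> f x = a].
Proof.
move=> G0 GL Gp.
have pZ' (t : R) x : 0 <= t -> p (t%:C%C *: x) = t * p x.
  by move=> t0; rewrite pZ nrmR ger0_norm.
have [|g [gL gp gG]] := @real_hahn_banach R V p pD pZ'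
    [set z | exists2 a, G (z.1, a) & z.2 = complex.Re a].
  split; first by exists 0.
    move=> c x a' y b' [a Gxa /= ->] [b Gyb /= ->].
    exists (c%:C%C * a + b); first exact: GL.
    by case: a Gxa => a1 a2 _; case: b Gyb => b1 b2 _ /=; ring.
  move=> x a' [a Gxa /= ->]; apply: le_trans (Gp _ _ Gxa).
  exact: le_trans (ler_norm _) (nrm_Re_le _).
have gD x y : g (x + y) = g x + g y.
  by have := gL 1 x y; rewrite scale1r mul1r.
have g0 : g 0 = 0.
  have := gD 0 0; rewrite addr0; lra.
have gZ (c : R) x : g (c%:C%C *: x) = c * g x.
  by have := gL c x 0; rewrite g0 !addr0.
pose f x : R[i] := (g x +i* - g ('i%C *: x))%C.
have fL (c : R[i]) x y : f (c *: x + y) = c * f x + f y.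
  case: c => c d; rewrite /f.
  have e z : ((c +i* d)%C *: z : V) = c%:C%C *: z + d%:C%C *: ('i%C *: z).
    rewrite scalerA -scalerDl; congr (_ *: _); simpc; congr (_ +i* _)%C; ring.
  have e2 z : 'i%C *: ('i%C *: z) = - z :> V.
    by rewrite scalerA -scaleN1r; congr (_ *: _); simpc.
  have e3 : 'i%C *: ((c +i* d)%C *: x + y) =
      c%:C%C *: ('i%C *: x) + ((- d)%:C%C *: x + 'i%C *: y).
    rewrite e !scalerDr !scalerA addrA; congr (_ + _ *: _ + _).
      by rewrite mulrC.
    by simpc.
  rewrite e3 e !gD !gZ.
  by simpc; congr (_ +i* _)%C; ring.
have f0 : f 0 = 0 by have := fL (-1) 0 0; rewrite scaler0 addr0 mulN1r addNr.
have fZ c x : f (c *: x) = c * f x.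
  by have := fL c x 0; rewrite f0 !addr0.
exists f; split => // [x|x a Gxa].
  have [u [u1 uf]] := phase (f x).
  have h : complex.Re (f (u *: x)) = nrm (f x) by rewrite fZ uf.
  by rewrite -h /= (le_trans (gp _)) // pZ u1 mul1r.
have Gi : G ('i%C *: x, 'i%C * a).
  by have := GL 'i%C _ _ _ _ Gxa G0; rewrite !addr0.
rewrite /f (gG _ (complex.Re a)); last by exists a.
rewrite (gG _ (complex.Re ('i%C * a))); last by exists ('i%C * a).
by case: a Gxa Gi => a b _ _ /=; congr (_ +i* _)%C; ring.
Qed.

(** * Bounded operators *)

Section operator_toolkit.
Variable R : realType.
Implicit Types E F G : completeNormedModType R[i].

Lemma mk_operator E F (f : E -> F) (M : R) :
  (forall (a : R[i]) x y, f (a *: x + y) = a *: f x + f y) ->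
  (forall x, nrm (f x) <= M * nrm x) ->
  exists T : operator E F, forall x, T x = f x.
Proof.
move=> fL fM; have fop : f \in @is_operator R E F.
  apply/asboolP; split; first exact: fL.
  by exists M%:C%C => x; rewrite -!nrmE -rmorphM /= lecR.
by exists (Operator fop).
Qed.

Lemma op_ext E F (S T : operator E F) : (forall x, S x = T x) -> S = T.
Proof. by move=> ST; apply: val_inj; apply/funext. Qed.

Lemma nrm_op E F (T : operator E F) x : nrm (T x) <= nrm T * nrm x.
Proof. by rewrite -lecR rmorphM /= !nrmE; exact: op_norm_bound. Qed.

Lemma op_nrm_le E F (T : operator E F) (M : R) : 0 <= M ->
  (forall x, nrm (T x) <= M * nrm x) -> nrm T <= M.
Proof.
move=> M0 TM; rewrite le_nrm; apply: sup_norm_le; first by rewrite lecR.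
move=> x /= x1; rewrite -le_nrm (le_trans (TM x)) //.
by rewrite ler_piMr // -lecR nrmE.
Qed.

Lemma op_add E F (S T : operator E F) x : (S + T) x = S x + T x.
Proof. by []. Qed.

Lemma op_sub E F (S T : operator E F) x : (S - T) x = S x - T x.
Proof. by []. Qed.

Lemma op_scale E F a (T : operator E F) x : (a *: T) x = a *: T x.
Proof. by []. Qed.

Lemma op_zero E F x : (0 : operator E F) x = 0.
Proof. by []. Qed.

Lemma op_sum E F (I : Type) (s : seq I) (P : pred I)
  (T : I -> operator E F) x :
  (\sum_(i <- s | P i) T i) x = \sum_(i <- s | P i) T i x.
Proof. by elim/big_rec2 : _ => // i S y _ <-. Qed.


Lemma id_operator_subproof E : (id : E -> E) \in @is_operator R E E.
Proof.
by apply/asboolP; split => //; exists 1 => x; rewrite mul1r.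
Qed.

Definition id_op E : operator E E := Operator (id_operator_subproof E).

Lemma id_opE E x : id_op E x = x. Proof. by []. Qed.

Lemma rank_one_subproof E F (y : F) (f : dual E) :
  ((fun x => f x *: y) : E -> F) \in @is_operator R E F.
Proof.
apply/asboolP; split; first by move=> a u v; rewrite linearP scalerDl scalerA.
exists (`|f| * `|y|) => x; rewrite normrZ mulrAC ler_wpM2r //.
exact: op_norm_bound.
Qed.

Definition rank_one E F (y : F) (f : dual E) : operator E F :=
  Operator (rank_one_subproof y f).

Lemma rank_oneE E F (y : F) (f : dual E) x : rank_one y f x = f x *: y.
Proof. by []. Qed.

Lemma op_compE E F G (S : operator F G) (T : operator E F) x :
  op_comp S T x = S (T x).
Proof. by []. Qed.

Lemma nrm_op_comp E F G (S : operator F G) (T : operator E F) :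
  nrm (op_comp S T) <= nrm S * nrm T.
Proof.
apply: op_nrm_le => [|x]; first by rewrite mulr_ge0 ?nrm_ge0.
rewrite op_compE (le_trans (nrm_op _ _)) // -mulrA ler_wpM2l ?nrm_ge0 //.
exact: nrm_op.
Qed.

Lemma op_cvg E F (T : operator E F) (I : Type) (Q : set_system I)
    {FQ : Filter Q} (u : I -> E) (l : E) :
  u @ Q --> l -> (fun i => T (u i)) @ Q --> T l.
Proof.
move=> /nrm_cvgP ul; apply/nrm_cvgP => e e0.
have M0 : 0 < nrm T + 1 by rewrite ltr_wpDl ?nrm_ge0.
have e1 : 0 < e / (nrm T + 1) by rewrite divr_gt0.
apply: filterS (ul _ e1) => i; rewrite ltr_pdivlMr // => h.
rewrite -linearB; apply: le_lt_trans (nrm_op _ _) _.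
apply: le_lt_trans h; rewrite mulrC ler_wpM2l ?nrm_ge0 //; lra.
Qed.

Lemma inverse_operator E F (T : operator E F) (C : R) :
  (forall x, nrm x <= C * nrm (T x)) -> (forall y, exists x, T x = y) ->
  exists2 B : operator F E, cancel T B & cancel B T.
Proof.
move=> TC Tsurj.
have Tinj x y : T x = T y -> x = y.
  move=> Txy; apply/eqP; rewrite -subr_eq0 -nrm_eq0 eq_le nrm_ge0 andbT.
  by rewrite (le_trans (TC _)) // linearB /= Txy subrr nrm0 mulr0.
have [b bT] := choice Tsurj.
have [||B hB] := @mk_operator F E b C.
- by move=> a x y; apply: Tinj; rewrite linearP /= !bT.
- by move=> x; rewrite (le_trans (TC _)) // bT.
by exists B => x; [apply: Tinj|]; rewrite hB bT.
Qed.

End operator_toolkit.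
Arguments op_cvg {R E F} T {I Q FQ u l}.

Section hahn_banach_corollaries.
Variable R : realType.

(** The functional is prescribed on the range of a map instead of a subspace, so
    that the theorem also factors a functional through an operator. *)
Lemma hahn_banach_factor (X V : lmodType R[i]) (p : V -> R) (W : set X)
    (T : X -> V) (l : X -> R[i]) :
  (forall x y, p (x + y) <= p x + p y) ->
  (forall (a : R[i]) x, p (a *: x) = nrm a * p x) ->
  W 0 -> (forall (c : R[i]) x y, W x -> W y -> W (c *: x + y)) ->
  (forall (c : R[i]) x y, T (c *: x + y) = c *: T x + T y) ->
  (forall (c : R[i]) x y, l (c *: x + y) = c * l x + l y) ->
  (forall x, W x -> nrm (l x) <= p (T x)) ->
  exists f : V -> R[i],
    [/\ forall (c : R[i]) x y, f (c *: x + y) = c * f x + f y,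
        forall x, nrm (f x) <= p x & forall x, W x -> f (T x) = l x].
Proof.
move=> pD pZ W0 WL TL lL lp.
have T0 : T 0 = 0.
  by have := TL (-1) 0 0; rewrite scaler0 addr0 scaleN1r addNr.
have l0 : l 0 = 0.
  by have := lL (-1) 0 0; rewrite scaler0 addr0 mulN1r addNr.
have [|||f [fL fp fG]] := @hahn_banach R V p pD pZ
  [set z | exists x, [/\ W x, T x = z.1 & l x = z.2]].
- by exists 0.
- move=> c x a y b [x' [Wx /= <- <-]] [y' [Wy /= <- <-]].
  by exists (c *: x' + y'); split; rewrite ?TL ?lL //; exact: WL.
- by move=> x a [x' [Wx /= <- <-]]; exact: lp.
by exists f; split => // x Wx; apply: fG; exists x.
Qed.

Lemma hahn_banach_dual (X : lmodType R[i]) (E : completeNormedModType R[i])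
    (W : set X) (T : X -> E) (l : X -> R[i]) (C : R) :
  0 <= C ->
  W 0 -> (forall (c : R[i]) x y, W x -> W y -> W (c *: x + y)) ->
  (forall (c : R[i]) x y, T (c *: x + y) = c *: T x + T y) ->
  (forall (c : R[i]) x y, l (c *: x + y) = c * l x + l y) ->
  (forall x, W x -> nrm (l x) <= C * nrm (T x)) ->
  exists f : dual E,
    (forall x, nrm (f x) <= C * nrm x) /\ (forall x, W x -> f (T x) = l x).
Proof.
move=> C0 W0 WL TL lL lC.
have [||f [fL fC fW]] := @hahn_banach_factor X E (fun x => C * nrm x) W T l
    _ _ W0 WL TL lL lC.
- by move=> x y; rewrite -mulrDr ler_wpM2l // nrmD.
- by move=> a x; rewrite nrmZ mulrCA.
have [f' ff'] := mk_operator fL fC.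
by exists f'; split => x; rewrite ff' //; exact: fW.
Qed.

Lemma norming_functional (E : completeNormedModType R[i]) (x : E) :
  exists f : dual E,
    f x = (nrm x)%:C%C /\ (forall y, nrm (f y) <= nrm y).
Proof.
have [|||f [f1 fx]] := @hahn_banach_dual R[i] E setT (fun a => a *: x)
    (fun a => a * (nrm x)%:C%C) 1 ler01 I (fun _ _ _ _ _ => I).
- by move=> c a b; rewrite scalerDl scalerA.
- by move=> c a b; rewrite mulrDl mulrA.
- by move=> a _; rewrite mul1r !nrmZ nrmR ger0_norm ?nrm_ge0.
exists f; split=> [|y]; last by rewrite -[leRHS]mul1r.
by have := fx 1 I; rewrite scale1r mul1r.
Qed.

(** The functional [y + a z |-> a] on the span of [Y] and [z] is bounded by
    [d^-1]. *)
Lemma separating_functional (E : completeNormedModType R[i]) (Y : set E)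
    (z : E) (d : R) :
  linear_subspace Y -> 0 < d -> (forall y, Y y -> d <= nrm (z - y)) ->
  exists f : dual E, f z = 1 /\ (forall y, Y y -> f y = 0).
Proof.
move=> [Y0 YL] d0 dY.
have [|||||f [_ fW]] := @hahn_banach_dual (E * R[i])%type E
    [set w | Y w.1] (fun w => w.1 + (w.2 : R[i]) *: z) snd d^-1 _ Y0.
- by rewrite invr_ge0 ltW.
- by move=> c [x a] [y b] /= Yx Yy; exact: YL.
- by move=> c [x a] [y b] /=; rewrite scalerDr scalerDl scalerA addrACA.
- by move=> c [x a] [y b].
- move=> [y a] /= Yy; rewrite mulrC ler_pdivlMr //.
  have [->|a0] := eqVneq a 0; first by rewrite nrm0 mul0r nrm_ge0.
  have -> : y + a *: z = a *: (z - (- a^-1 *: y + 0)).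
    by rewrite addr0 scaleNr opprK scalerDr scalerA divff // scale1r addrC.
  by rewrite nrmZ ler_wpM2l ?nrm_ge0 // dY //; exact: YL.
exists f; split=> [|y Yy].
  by have := fW (0, 1) Y0; rewrite /= add0r scale1r.
by have := fW (y, 0) Yy; rewrite /= scale0r addr0.
Qed.

End hahn_banach_corollaries.

(** * Zabreiko's lemma, invertibility and ultrafilter limits *)

Section zabreiko.
Variables (R : realType) (V : completeNormedModType R[i]) (p : V -> R).

(** Baire's argument: otherwise there are nested balls on the [n]-th of which
    [p] exceeds [n], and [p] has no value at their common point. *)
Lemma sublevel_dense_in_ball : exists (m : nat) (x0 : V) (r : R), 0 < r /\
  forall y, nrm (y - x0) < r ->
  forall e, 0 < e -> exists2 a, p a <= m%:R & nrm (y - a) < e.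
Proof.
apply: contrapT => H.
have step n (z : V * R) : exists w : V * R, 0 < z.2 ->
    [/\ 0 < w.2, w.2 <= z.2 / 2, nrm (w.1 - z.1) <= z.2 / 2 &
        forall v, nrm (v - w.1) <= w.2 -> n%:R < p v].
  have [z0|] := pselect (0 < z.2); last by exists z.
  have z20 : 0 < z.2 / 2 by rewrite divr_gt0.
  apply: contrapT => nw; apply: H; exists n, z.1, (z.2 / 2); split => // y yz e e0.
  apply: contrapT => na; apply: nw.
  exists (y, Num.min (e / 2) (z.2 / 2)) => _ /=; split.
  - by rewrite lt_min z20 divr_gt0.
  - by rewrite ge_min lexx orbT.
  - exact: ltW.
  move=> v; rewrite le_min => /andP[ve _]; rewrite ltNge; apply/negP => pv.
  by apply: na; exists v => //; rewrite nrm_distC; lra.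
have [f fP] : exists f : nat -> V * R -> V * R, forall n z, 0 < z.2 ->
    [/\ 0 < (f n z).2, (f n z).2 <= z.2 / 2, nrm ((f n z).1 - z.1) <= z.2 / 2 &
        forall v, nrm (v - (f n z).1) <= (f n z).2 -> n%:R < p v].
  have [f fP] := choice (fun nz : nat * (V * R) => step nz.1 nz.2).
  by exists (fun n z => f (n, z)) => n z; exact: (fP (n, z)).
pose w := fix w n := if n is n'.+1 then f n' (w n') else (0 : V, 1 : R).
have w0 n : 0 < (w n).2.
  by elim: n => [|n IH] /=; rewrite ?ltr01 //; have [] := fP n _ IH.
have wr n : (w n.+1).2 <= (w n).2 / 2 by have [] := fP n _ (w0 n).
have wd n : nrm ((w n.+1).1 - (w n).1) <= (w n).2 / 2.
  by have [] := fP n _ (w0 n).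
have wg n : (w n).2 <= (1/2) ^+ n.
  elim: n => [|n IH]; first by rewrite expr0.
  rewrite exprS; have := wr n; lra.
have [l wl _] : exists2 l, (fun n => (w n).1) @ \oo --> l &
    forall n, nrm ((w n).1 - l) <= 2 * 1 * (1/2) ^+ n.
  apply: geometric_cvg => n; have := wd n; have := wg n; have := w0 n; lra.
have lw n : nrm (l - (w n).1) <= (w n).2.
  have D m : (n <= m)%N -> nrm ((w m).1 - (w n).1) <= (w n).2 - (w m).2.
    move=> nm; rewrite -(subnKC nm); elim: (m - n)%N => [|k IH].
      by rewrite addn0 !subrr nrm0.
    rewrite addnS; have := nrm_dist (w (n + k)%N).1 (w (n + k).+1).1 (w n).1.
    have := wd (n + k)%N; have := wr (n + k)%N; lra.
  apply: (@nrm_lim_le _ _ _ \oo _ (fun m => (w m).1 - (w n).1)).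
    by apply: (cvgB wl); exact: cvg_cst.
  by exists n => // m /= /D; have := w0 m; lra.
have [N hN] : exists N : nat, p l < N%:R.
  exists (Num.bound `|p l|); apply: le_lt_trans (ler_norm _) _.
  by rewrite archi_boundP.
have [_ _ _ /(_ l (lw N.+1))] := fP N _ (w0 N).
by rewrite ltNge => /negP; apply; exact: ltW.
Qed.

Hypothesis pD : forall x y, p (x + y) <= p x + p y.
Hypothesis pZ : forall (a : R[i]) x, p (a *: x) = nrm a * p x.
Hypothesis psum : forall (x : nat -> V) s M, 0 <= M ->
  (\sum_(0 <= k < n) x k) @[n --> \oo] --> s ->
  (forall k, p (x k) <= M * (1/2) ^+ k) -> p s <= 2 * M.

(** Zabreiko's lemma on countably subadditive seminorms, from which the open
    mapping theorem and the continuity of basis expansions follow. By Baire a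
    multiple of the unit ball of [p] is dense in the unit ball, and successive
    approximation sums to the whole ball. *)
Lemma zabreiko : exists2 C, 0 <= C & forall x, p x <= C * nrm x.
Proof.
have [m [x0 [r [r0 H]]]] := sublevel_dense_in_ball.
have pN x : p (- x) = p x by rewrite -scaleN1r pZ nrmN nrm1 mul1r.
have H2 y e : nrm y < r -> 0 < e -> exists2 a, p a <= 2 * m%:R & nrm (y - a) < e.
  move=> yr e0; have e2 : 0 < e / 2 by rewrite divr_gt0.
  have [|a pa ya] := H (x0 + y) _ _ e2; first by rewrite addrC addKr.
  have [|b pb xb] := H x0 _ _ e2; first by rewrite subrr nrm0.
  exists (a - b).
    by have := pD a (- b); rewrite pN; lra.
  have := nrmB (x0 + y - a) (x0 - b).
  have -> : x0 + y - a - (x0 - b) = y - (a - b).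
    by rewrite !opprB addrC -(addrA x0) addrA subrK addrCA.
  lra.
pose D := 4 * m%:R / r.
have D0 : 0 <= D by rewrite divr_ge0 ?mulr_ge0 // ltW.
have approx y : exists a, p a <= D * nrm y /\ nrm (y - a) <= nrm y / 2.
  have [->|y0] := eqVneq y 0.
    exists 0; rewrite subrr !nrm0 mul0r mulr0 -(scale0r 0) pZ nrm0 mul0r; lra.
  have ny : 0 < nrm y by rewrite nrm_gt0.
  pose t := r / (2 * nrm y).
  have t0 : 0 < t by rewrite divr_gt0 // mulr_gt0.
  have ty : t * nrm y = r / 2 by rewrite /t; field; rewrite gt_eqF.
  have [||a pa ya] := H2 (t%:C%C *: y) (r / 4); [|lra|].
    by rewrite nrmZR gtr0_norm // ty; lra.
  have tV : 0 <= t^-1 by rewrite invr_ge0 ltW.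
  exists (t^-1%:C%C *: a); split.
    rewrite pZ nrmR ger0_norm // (le_trans (ler_wpM2l tV pa)) //.
    by rewrite /t /D invf_div le_eqVlt; apply/orP; left; apply/eqP; field; rewrite gt_eqF.
  have -> : y - t^-1%:C%C *: a = t^-1%:C%C *: (t%:C%C *: y - a).
    by rewrite scalerBr scalerA -rmorphM mulVf ?gt_eqF // scale1r.
  rewrite nrmZR ger0_norm // (le_trans (ler_wpM2l tV (ltW ya))) //.
  by rewrite /t invf_div le_eqVlt; apply/orP; left; apply/eqP; field; rewrite gt_eqF.
have [g gP] := choice approx.
exists (2 * D) => [|y]; first by rewrite mulr_ge0.
pose w := fix w n := if n is n'.+1 then w n' - g (w n') else y.
have wn n : nrm (w n) <= nrm y * (1/2) ^+ n.
  elim: n => [|n IH]; first by rewrite expr0 mulr1.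
  by rewrite exprS /=; have [_] := gP (w n); lra.
rewrite -mulrA; apply: (psum (x := fun k => g (w k))).
- by rewrite mulr_ge0 ?nrm_ge0.
- have E n : \sum_(0 <= k < n) g (w k) = y - w n.
    elim: n => [|n IH]; first by rewrite big_geq // subrr.
    by rewrite big_nat_recr //= IH opprB addrA addrAC.
  apply/nrm_cvg_seqP => e e0; have [N hN] := half_pow_small (nrm y) e0.
  exists N => n Nn; rewrite E addrAC subrr add0r nrmN.
  apply: le_lt_trans (wn n) _; apply: le_lt_trans hN.
  rewrite ler_wpM2l ?nrm_ge0 // ler_wiXn2l //; lra.
- move=> k; have [h _] := gP (w k); rewrite (le_trans h) // -mulrA.
  exact: ler_wpM2l.
Qed.

End zabreiko.

Section invertibility.
Variable R : realType.
Implicit Types E F : completeNormedModType R[i].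

Lemma fixpoint_half E (A : operator E E) (y : E) :
  (forall x, nrm (A x) <= 1/2 * nrm x) -> exists x, x - A x = y.
Proof.
move=> Ah; pose u n := iter n (fun x => y + A x) 0.
have ud n : nrm (u n.+1 - u n) <= nrm y * (1/2) ^+ n.
  elim: n => [|n IH]; first by rewrite /u /= linear0 addr0 subr0 expr0 mulr1.
  have -> : u n.+2 - u n.+1 = A (u n.+1 - u n).
    by rewrite linearB /= [in LHS]/u /= -/(u n) opprD addrACA subrr add0r.
  rewrite (le_trans (Ah _)) // exprS; lra.
have [l ul _] := geometric_cvg ud.
exists l; apply/eqP; rewrite subr_eq; apply/eqP.
apply: (nrm_cvg_unique \oo (u := fun n => u n.+1)).
  by move/nrm_cvg_seqP : ul => ul; apply/nrm_cvg_seqP => e /ul[N hN];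
    exists N => n Nn; apply: hN; rewrite leqW.
by apply: cvgD; [exact: cvg_cst|exact: op_cvg].
Qed.

Definition invertible E F (T : operator E F) :=
  exists2 B : operator F E, cancel T B & cancel B T.

(** Openness of the invertible operators (Neumann), in terms of a lower bound
    instead of the norm of the inverse. *)
Lemma invertible_perturb E F (T V : operator E F) (C d : R) :
  invertible V -> (forall x, nrm x <= C * nrm (V x)) ->
  (forall x, nrm (T x - V x) <= d * nrm x) -> 0 <= C -> C * d <= 1/2 ->
  invertible T.
Proof.
move=> [B VB BV] VC TV C0 Cd.
have BC y : nrm (B y) <= C * nrm y by rewrite -[in leRHS](BV y) VC.
pose A := op_comp B (V - T).
have Ah x : nrm (A x) <= 1/2 * nrm x.
  rewrite op_compE (le_trans (BC _)) // op_sub nrm_distC.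
  rewrite (le_trans (ler_wpM2l C0 (TV x))) // mulrA ler_wpM2r ?nrm_ge0 //.
have AE x : x - A x = B (T x).
  by rewrite op_compE op_sub linearB /= VB opprB addrCA subrr addr0.
apply: (@inverse_operator _ _ _ T (2 * C)) => [x|y].
  have := BC (T x); rewrite -AE; have := nrm_ler_dist x (A x); have := Ah x; lra.
have [x xy] := fixpoint_half (B y) Ah.
by exists x; apply: (can_inj BV); rewrite -AE xy.
Qed.

Lemma neumann E (T : operator E E) :
  (forall x, nrm (T x - x) <= 1/2 * nrm x) -> invertible T.
Proof.
move=> h; apply: (@invertible_perturb _ _ T (id_op E) 1 (1/2)) => //.
- by exists (id_op E).
- by move=> x; rewrite mul1r.
- lra.
Qed.

End invertibility.

Section ultrafilter_limits.
Variable R : realType.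

Lemma ultra_cvg_compact (T : Type) (V : topologicalType) (U : set_system T)
    (f : T -> V) (A : set V) :
  UltraFilter U -> compact A -> (forall t, A (f t)) ->
  exists p, A p /\ f @ U --> p.
Proof.
move=> UU + fA; rewrite compact_ultra.
have UI : UltraFilter (f @ U).
  split; first exact: fmap_proper_filter.
  move=> G PG sG; apply/seteqP; split; last exact: sG.
  move=> B GB; have [//|Un] := in_ultra_setVsetC (f @^-1` B) UU.
  have GnB : G (~` B) by apply: sG; rewrite /fmap /= preimage_setC.
  have G0 : G set0 by rewrite -(setICr B); exact: filterI.
  by have := @filter_not_empty _ G PG G0.
move=> /(_ (f @ U) UI)[|p [Ap fp]]; last by exists p.
exact: (@filterE _ U _ (f @^-1` A)).
Qed.

Lemma ultra_lim_real (T : Type) (U : set_system T) (a : T -> R) (M : R) :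
  UltraFilter U -> (forall t, `|a t| <= M) -> exists l : R, a @ U --> l.
Proof.
move=> UU aM; have [|l [_ al]] :=
    ultra_cvg_compact (f := a) UU (@segment_compact R (- M) M).
  by move=> t; rewrite /= in_itv /= -ler_norml; exact: aM.
by exists l.
Qed.

Lemma ultra_lim (T : Type) (U : set_system T) (a : T -> R[i]) (M : R) :
  UltraFilter U -> (forall t, nrm (a t) <= M) -> exists l : R[i], a @ U --> l.
Proof.
move=> UU aM.
have [x ax] := ultra_lim_real UU (fun t => le_trans (nrm_Re_le (a t)) (aM t)).
have [y ay] := ultra_lim_real UU (fun t => le_trans (nrm_Im_le (a t)) (aM t)).
exists (x +i* y)%C; apply/nrm_cvgP => e e0.
have e2 : 0 < e / 2 by rewrite divr_gt0.
move/cvgrPdist_lt : ax => /(_ _ e2) ax; move/cvgrPdist_lt : ay => /(_ _ e2) ay.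
near=> t; apply: le_lt_trans (nrm_le_ReIm _) _.
rewrite ReB ImB /= distrC [X in _ + X]distrC [ltRHS]splitr ltrD //.
  by near: t.
by near: t.
Unshelve. all: by end_near. Qed.

Lemma nat_ultra : exists2 U : set_system nat, UltraFilter U & \oo `<=` U.
Proof.
by have [U [UU sU]] := @ultraFilterLemma _ (nbhs \oo) _; exists U.
Qed.

End ultrafilter_limits.

(** * Finitely generated maximal left ideals *)

Section open_mapping.
Variables (R : realType) (X V : completeNormedModType R[i]).

(** The quotient seminorm of the target is countably subadditive because the
    source is complete, so that Zabreiko's lemma bounds it. *)
Lemma open_mapping (A : operator X V) : (forall v, exists x, A x = v) ->
  exists2 C : R, 0 <= C & forall v, exists2 x, A x = v & nrm x <= C * nrm v.
Proof.
move=> Asurj; pose Q v := [set nrm x | x in [set x | A x = v]].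
pose p v := inf (Q v).
have Q0 v : Q v !=set0 by have [x xv] := Asurj v; exists (nrm x), x.
have Qlb v : lbound (Q v) 0 by move=> _ [x _ <-]; exact: nrm_ge0.
have p_le x v : A x = v -> p v <= nrm x.
  by move=> xv; apply: ge_inf; [exists 0|exists x].
have p0 v : 0 <= p v by exact: lb_le_inf.
have p_lt v e : 0 < e -> exists2 x, A x = v & nrm x < p v + e.
  move=> e0; have hQ : has_inf (Q v) by split; [exact: Q0|exists 0].
  by have [_ [x xv <-] h] := inf_adherent e0 hQ; exists x.
have pD u v : p (u + v) <= p u + p v.
  apply/ler_addgt0Pr => e e0; have e2 : 0 < e / 2 by rewrite divr_gt0.
  have [x xu hx] := p_lt u _ e2; have [y yv hy] := p_lt v _ e2.
  have : p (u + v) <= nrm (x + y) by apply: p_le; rewrite linearD /= xu yv.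
  have := nrmD x y; lra.
have pZ1 a v : p (a *: v) <= nrm a * p v.
  apply/ler_addgt0Pr => e e0.
  have a0 : 0 < nrm a + 1 by rewrite ltr_wpDl ?nrm_ge0.
  have [x xv hx] := p_lt v _ (divr_gt0 e0 a0).
  have : p (a *: v) <= nrm (a *: x) by apply: p_le; rewrite linearZ /= xv.
  rewrite nrmZ => /le_trans; apply.
  rewrite (le_trans (ler_wpM2l (nrm_ge0 a) (ltW hx))) // mulrDr lerD2l.
  rewrite mulrA ler_pdivrMr // mulrC ler_wpM2l ?ltW //; lra.
have pZ a v : p (a *: v) = nrm a * p v.
  apply/le_anti; rewrite pZ1 /=; have [->|a0] := eqVneq a 0.
    by rewrite nrm0 mul0r.
  have na : 0 < nrm a by rewrite nrm_gt0.
  have := pZ1 a^-1 (a *: v).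
  by rewrite scalerA mulVf // scale1r nrmV mulrC ler_pdivlMr // mulrC.
have [|C C0 pC] := zabreiko pD pZ.
  move=> v s M M0 vs pv; apply/ler_addgt0Pr => e e0.
  have e2 : 0 < e / 2 by rewrite divr_gt0.
  have ch k : exists x, A x = v k /\ nrm x <= (M + e / 2) * (1/2) ^+ k.
    have ek : 0 < e / 2 * (1/2) ^+ k by rewrite mulr_gt0 // exprn_gt0 //; lra.
    have [x xv hx] := p_lt (v k) _ ek; exists x; split => //.
    rewrite mulrDl (le_trans (ltW hx)) // lerD2r; exact: pv.
  have [x xP] := choice ch.
  pose u n := \sum_(0 <= k < n) x k.
  have [l ul hl] : exists2 l, u @ \oo --> l &
      forall n, nrm (u n - l) <= 2 * (M + e / 2) * (1/2) ^+ n.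
    apply: geometric_cvg => n; rewrite /u big_nat_recr //= addrAC subrr add0r.
    by have [] := xP n.
  have Al : A l = s.
    have h2 : (fun n => A (u n)) @ \oo --> s.
      rewrite (_ : (fun _ => _) = fun n => \sum_(0 <= k < n) v k) //.
      apply/funext => n; rewrite /u linear_sum /=.
      by apply: eq_bigr => k _; have [] := xP k.
    exact: (nrm_cvg_unique \oo (op_cvg A ul) h2).
  have := p_le _ _ Al; have := hl 0%N.
  rewrite /u big_geq // sub0r nrmN expr0; lra.
exists (C + 1); first lra.
move=> v; have [->|v0] := eqVneq v 0.
  by exists 0; rewrite ?linear0 // !nrm0 mulr0.
have nv : 0 < nrm v by rewrite nrm_gt0.
have [x xv hx] := p_lt v _ nv; exists x => //.
have := pC v; lra.
Qed.

End open_mapping.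

Section products.
Variables (R : realType) (E F : completeNormedModType R[i]).

Lemma nrm_pair_ge (z : E * F) : nrm z.1 <= nrm z /\ nrm z.2 <= nrm z.
Proof.
by split; rewrite -lecR !nrmE prod_normE comparable_le_max
  ?real_comparable ?normr_real // lexx ?orbT.
Qed.

Lemma nrm_pair_le (z : E * F) : nrm z <= nrm z.1 + nrm z.2.
Proof.
rewrite -lecR rmorphD /= !nrmE prod_normE comparable_ge_max
  ?real_comparable ?normr_real //=.
by rewrite lerDl lerDr !normr_ge0.
Qed.

Lemma fst_op : exists T : operator (E * F)%type E, forall z, T z = z.1.
Proof.
apply: (@mk_operator _ _ _ _ 1) => // z; rewrite mul1r.
by have [] := nrm_pair_ge z.
Qed.

Lemma snd_op : exists T : operator (E * F)%type F, forall z, T z = z.2.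
Proof.
apply: (@mk_operator _ _ _ _ 1) => // z; rewrite mul1r.
by have [] := nrm_pair_ge z.
Qed.

Lemma pair_op (G : completeNormedModType R[i]) (S : operator G E)
    (T : operator G F) :
  exists P : operator G (E * F)%type, forall z, P z = (S z, T z).
Proof.
apply: (@mk_operator _ _ _ _ (nrm S + nrm T)).
  by move=> a x y; rewrite !linearP.
move=> z; rewrite (le_trans (nrm_pair_le _)) // mulrDl lerD //; exact: nrm_op.
Qed.

End products.

Section left_ideal_theory.
Variables (R : realType) (E : completeNormedModType R[i]).
Implicit Types (L : set (operator E E)) (T S : operator E E).

(** For generators [T_1, ..., T_n], the space [F] is the power [E^n], built as
    an iterated product, and [Psi x = (T_1 x, ..., T_n x)]; the maps [pi] and
    [iota] are the coordinate projections and injections, which recover the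
    generators as [pi l o Psi]. *)
Lemma finitely_generated_factor L : finitely_generated L ->
  exists (F : completeNormedModType R[i]) (Psi : operator E F) (n : nat)
    (pi : nat -> operator F E) (iota : nat -> operator E F),
    (forall y, y = \sum_(l < n) iota l (pi l y)) /\
    (forall T, L T <-> exists S : operator F E, T = op_comp S Psi).
Proof.
move=> [Gamma [/finite_seqP[s0 Gs] _ LG]].
pose s := undup s0; have us : uniq s by exact: undup_uniq.
have {}Gs : Gamma = [set` s].
  by rewrite Gs; apply/seteqP; split=> x /=; rewrite mem_undup.
suff [F [Psi [n [pi [iota [H1 H2]]]]]] : exists (F : completeNormedModType R[i])
    (Psi : operator E F) (n : nat)
    (pi : nat -> operator F E) (iota : nat -> operator E F),
    (forall y, y = \sum_(l < n) iota l (pi l y)) /\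
    (forall T, (exists U : operator E E -> operator E E,
       T = \sum_(X <- s) op_comp (U X) X) <->
       exists S : operator F E, T = op_comp S Psi).
  exists F, Psi, n, pi, iota; split => // T; rewrite -H2 LG Gs; split.
    by move=> [U _ <-]; exists U; rewrite (@fsbig_seq _ _ _ _ s _ us).
  by move=> [U ->]; exists U => //; rewrite (@fsbig_seq _ _ _ _ s _ us).
elim: s us {Gs} => [_|t s IH /= /andP[ts us]].
  exists E, 0, 1%N, (fun _ => id_op E), (fun _ => id_op E).
  split=> [y|T]; first by rewrite big_ord1.
  split=> [[U ->]|[S ->]].
    by exists 0; rewrite big_nil; apply: op_ext.
  by exists (fun _ => 0); rewrite big_nil; apply: op_ext => x;
    rewrite op_compE !op_zero linear0.
have [F [Psi [n [pi [iota [H1 H2]]]]]] := IH us.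
have [p1 p1E] := fst_op E F; have [p2 p2E] := snd_op E F.
have [i1 i1E] := pair_op (id_op E) (0 : operator E F).
have [i2 i2E] := pair_op (0 : operator F E) (id_op F).
have [Psi' Psi'E] := pair_op t Psi.
exists (E * F)%type, Psi', n.+1,
  (fun l => if l is l'.+1 then op_comp (pi l') p2 else p1),
  (fun l => if l is l'.+1 then op_comp i2 (iota l') else i1).
split=> [y|T].
  rewrite big_ord_recl (eq_bigr (fun l : 'I_n => i2 (iota l (pi l y.2)))).
    rewrite /= i1E p1E.
  rewrite -linear_sum /= -H1 i2E.
    by case: y => a b; congr (_, _); rewrite ?addr0 ?add0r.
  by move=> l _; rewrite lift0 /= ?op_compE p2E.
split=> [[U ->]|[S ->]].
  have /H2[S Sh] : exists U' : operator E E -> operator E E,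
      \sum_(X <- s) op_comp (U X) X = \sum_(X <- s) op_comp (U' X) X.
    by exists U.
  exists (op_comp (U t) p1 + op_comp S p2).
  apply: op_ext => x; rewrite big_cons Sh op_add !op_compE op_add !op_compE.
  by rewrite p1E p2E Psi'E.
have /H2[U Uh] : exists S' : operator F E,
    op_comp (op_comp S i2) Psi = op_comp S' Psi.
  by exists (op_comp S i2).
exists (fun X => if X == t then op_comp S i1 else U X).
rewrite big_cons eqxx; apply: op_ext => x.
rewrite op_add (_ : \sum_(j <- s) _ = op_comp (op_comp S i2) Psi).
  rewrite !op_compE i1E i2E Psi'E -linearD /=; congr (S _).
  by congr (_, _); rewrite ?addr0 ?add0r.
rewrite Uh; apply: eq_big_seq => X Xs; case: eqVneq => // Xt.
by move: ts; rewrite -Xt Xs.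
Qed.

Lemma closure_nrmP (V : normedModType R[i]) (A : set V) x :
  closure A x <-> forall e : R, 0 < e -> exists2 y, A y & nrm (x - y) < e.
Proof.
split=> [cA e e0|h B].
  have e0' : 0 < e%:C%C :> R[i] by rewrite ltcR.
  have [y [Ay]] := cA _ (nbhsx_ballx x _ e0').
  by rewrite -ball_normE /= -nrmE ltcR; exists y.
move=> /nbhs_ballP[e /= e0]; have eE : (complex.Re e)%:C%C = e.
  exact/ge0_ReK/ltW.
have e0' : 0 < complex.Re e by rewrite -ltcR eE.
have [y Ay xy] := h _ e0'; move=> /(_ y) By; exists y; split => //; apply: By.
by rewrite -ball_normE /= -eE -nrmE ltcR.
Qed.

Section maximal.
Variable L : set (operator E E).
Hypothesis Lmax : maximal_left_ideal L.

Let L0 : L 0. Proof. by have [[]] := Lmax. Qed.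
Let LD S T : L S -> L T -> L (S + T).
Proof. by have [[_ h _] _ _] := Lmax; exact: h. Qed.
Let LM S T : L T -> L (op_comp S T).
Proof. by have [[_ _ h] _ _] := Lmax; exact: h. Qed.

Lemma left_idealZ a T : L T -> L (a *: T).
Proof.
move=> LT; rewrite (_ : _ *: _ = op_comp (a *: id_op E) T); first exact: LM.
exact: op_ext.
Qed.

Lemma maximal_no_id : ~ L (id_op E).
Proof.
move=> L1; have [_ /eqP LT _] := Lmax; apply: LT.
apply/seteqP; split => // T _.
by rewrite (_ : T = op_comp T (id_op E)); [exact: LM|exact: op_ext].
Qed.

(** The closure of a proper left ideal is proper, since it cannot reach the
    identity, near which all operators are invertible. *)
Lemma maximal_closed : closed L.
Proof.
have [_ _ mL] := Lmax.
suff <- : closure L = L by exact: closed_closure.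
apply: mL; last exact: subset_closure; first split.
- exact: subset_closure.
- move=> S T /closure_nrmP hS /closure_nrmP hT; apply/closure_nrmP => e e0.
  have e2 : 0 < e / 2 by rewrite divr_gt0.
  have [S' LS' dS] := hS _ e2; have [T' LT' dT] := hT _ e2.
  exists (S' + T'); first exact: LD.
  have := nrmD (S - S') (T - T'); rewrite addrACA -opprD; lra.
- move=> S T /closure_nrmP hT; apply/closure_nrmP => e e0.
  have S1 : 0 < nrm S + 1 by rewrite ltr_wpDl ?nrm_ge0.
  have [T' LT' dT] := hT _ (divr_gt0 e0 S1).
  exists (op_comp S T'); first exact: LM.
  have -> : op_comp S T - op_comp S T' = op_comp S (T - T').
    by apply: op_ext => x; rewrite op_sub !op_compE op_sub linearB.
  apply: le_lt_trans (nrm_op_comp _ _) _.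
  move: dT; rewrite ltr_pdivlMr // => dT; apply: le_lt_trans dT.
  rewrite mulrC ler_wpM2l ?nrm_ge0 //; lra.
- apply/negP => /eqP cT.
  have /closure_nrmP/(_ (1/2)) : closure L (id_op E) by rewrite cT.
  case=> [|T LT hT]; first lra.
  have [x|B TB _] := @neumann R E T.
    rewrite nrm_distC -(op_sub (id_op E)) (le_trans (nrm_op _ _)) //.
    by rewrite ler_wpM2r ?nrm_ge0 // ltW.
  apply: maximal_no_id.
  rewrite (_ : id_op E = op_comp B T); first exact: LM.
  by apply: op_ext => x; rewrite op_compE TB.
Qed.

(** If some [x (x) f] is missing from [L], then [L + E (x) f] is everything,
    so that [I - y (x) f] belongs to [L] for some [y], and every operator
    killing [y] is a left multiple of that one. *)
Lemma maximal_fixed_or_rank_one :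
  fixed_left_ideal L \/ (forall x (f : dual E), L (rank_one x f)).
Proof.
have [|] := pselect (forall x (f : dual E), L (rank_one x f)); first by right.
move=> /existsNP[x /existsNP[f nLxf]]; left.
have [_ _ mL] := Lmax.
pose J := [set S | exists T y, L T /\ S = T + rank_one y f].
have JL : left_ideal J.
  split.
  - by exists 0, 0; split => //; apply: op_ext => z;
      rewrite op_add rank_oneE scaler0 addr0.
  - move=> _ _ [S [y [LS ->]]] [T [z [LT ->]]].
    exists (S + T), (y + z); split; first exact: LD.
    by apply: op_ext => w; rewrite !op_add !rank_oneE scalerDr addrACA.
  - move=> S _ [T [y [LT ->]]]; exists (op_comp S T), (S y); split.
      exact: LM.
    by apply: op_ext => w;
      rewrite op_compE !op_add op_compE linearD !rank_oneE linearZ.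
have LJ : L `<=` J.
  move=> T LT; exists T, 0; split => //.
  by apply: op_ext => z; rewrite op_add rank_oneE scaler0 addr0.
have JT : J = setT.
  apply: contrapT => /eqP nJ; apply: nLxf; rewrite -(mL _ JL nJ LJ).
  by exists 0, x; split => //; rewrite add0r.
have [T [y [LT idT]]] : J (id_op E) by rewrite JT.
have kill S : S y = 0 -> L S.
  move=> Sy; rewrite (_ : S = op_comp S T); first exact: LM.
  apply: op_ext => z; rewrite op_compE.
  have : id_op E z = T z + f z *: y by rewrite {1}idT.
  rewrite id_opE => {1}->; rewrite linearD linearZ /= Sy scaler0 addr0 //.
exists y.
  apply/eqP => y0; apply: maximal_no_id; apply: kill; by rewrite y0 linear0.
apply/seteqP; split => // S LS; rewrite /mkset; apply: contrapT => Sy.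
have [g [gy _]] := norming_functional (S y).
have nSy : nrm (S y) != 0 by rewrite nrm_eq0; apply/eqP.
pose g' := (nrm (S y))^-1%:C%C *: g.
have g'y : g' (S y) = 1.
  rewrite op_scale gy; change (((nrm (S y))^-1)%:C%C * (nrm (S y))%:C%C = 1 :> R[i]).
  by rewrite -rmorphM mulVf.
apply: maximal_no_id.
rewrite (_ : id_op E = (id_op E - op_comp (rank_one y g') S) +
                       op_comp (rank_one y g') S); last by rewrite subrK.
apply: LD; last exact: LM.
by apply: kill; rewrite op_sub op_compE rank_oneE g'y scale1r subrr.
Qed.

End maximal.
End left_ideal_theory.

Section reduction.
Variables (R : realType) (E : completeNormedModType R[i]).
Variables (L : set (operator E E)) (F : completeNormedModType R[i])
  (Psi : operator E F).
Hypothesis Lmax : maximal_left_ideal L.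
Hypothesis LE : forall T, L T <-> exists S : operator F E, T = op_comp S Psi.

(** The map [S |-> S o Psi] is onto the Banach space [L], so that the open
    mapping theorem bounds a preimage. *)
Lemma controlled_factor : exists2 C : R, 0 <= C & forall Q, L Q ->
  exists2 S : operator F E, Q = op_comp S Psi & nrm S <= C * nrm Q.
Proof.
have [[L0 LD LM] _ _] := Lmax.
have Llin : linear_subspace L.
  by split=> // a S T LS LT; apply: LD => //; exact: left_idealZ.
pose G := ClosedSubspace Llin (maximal_closed Lmax).
have GP S : op_comp S Psi \in csub_pred G.
  by apply/asboolP; apply/LE; exists S.
have [||A AE] := @mk_operator R (operator F E) G (fun S => CSub (GP S)) (nrm Psi).
- by move=> a S T; apply: val_inj; apply: op_ext.
- by move=> S; rewrite mulrC; exact: nrm_op_comp.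
have [v|C C0 AC] := @open_mapping _ _ _ A.
  have /asboolP/LE[S vS] := csub_valP v.
  by exists S; apply: val_inj; rewrite AE /= vS.
exists C => // Q LQ.
have QP : Q \in csub_pred G by apply/asboolP.
have [S SQ hS] := AC (CSub QP); exists S => //.
by have := congr1 (fun v : G => csub_val v) SQ; rewrite AE.
Qed.

Hypothesis Lrank1 : forall x (f : dual E), L (rank_one x f).

(** The rank-one operator [x (x) f], with [f] norming [x], factors through
    [Psi] with control, so that [Psi x] cannot be small. *)
Lemma nonfixed_bounded_below :
  exists2 C : R, 0 <= C & forall x, nrm x <= C * nrm (Psi x).
Proof.
have [C C0 LC] := controlled_factor.
exists C => // x; have [->|x0] := eqVneq x 0.
  by rewrite nrm0 mulr_ge0 // nrm_ge0.
have nx : 0 < nrm x by rewrite nrm_gt0.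
have [f [fx f1]] := norming_functional x.
have [S Sf hS] := LC _ (Lrank1 x f).
have fn : nrm (rank_one x f) <= nrm x.
  apply: op_nrm_le => [|y]; first exact: nrm_ge0.
  by rewrite rank_oneE nrmZ mulrC ler_wpM2l ?nrm_ge0.
have := nrm_op S (Psi x).
have -> : S (Psi x) = rank_one x f x by rewrite Sf.
rewrite rank_oneE fx nrmZR ger0_norm ?nrm_ge0 // => h.
rewrite -(ler_pM2l nx) (le_trans h) // mulrA ler_wpM2r ?nrm_ge0 //.
by rewrite (le_trans hS) // mulrC ler_wpM2r.
Qed.

End reduction.

(** * Injective spaces, and spaces with bases *)

Section injective_spaces.
Variables (R : realType) (E F : completeNormedModType R[i]).
Variables (Psi : operator E F) (C : R).
Hypothesis PsiC : forall x, nrm x <= C * nrm (Psi x).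

Lemma bounded_below_ge0 : 0 <= C \/ forall x : E, x = 0.
Proof.
have [C0|C0] := leP 0 C; first by left.
right=> x; apply/eqP; rewrite -nrm_eq0 eq_le nrm_ge0 andbT.
rewrite (le_trans (PsiC x)) // -[leLHS]opprK oppr_le0 -mulNr.
by rewrite mulr_ge0 ?nrm_ge0 // oppr_ge0 ltW.
Qed.

Lemma bounded_below_range_closed : closed (range Psi).
Proof.
move=> y /closure_nrmP cy.
have [C0|E0] := bounded_below_ge0; last first.
  exists 0 => //; apply/eqP; rewrite -subr_eq0 -nrm_eq0 eq_le nrm_ge0 andbT.
  rewrite nrm_distC leNgt; apply/negP => /cy[_ [x _ <-]].
  by rewrite (E0 x) ltxx.
have ch n : exists x, nrm (y - Psi x) < (1/2) ^+ n.
  have h : 0 < (1/2 : R) ^+ n by rewrite exprn_gt0 //; lra.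
  by have [_ [x _ <-] hx] := cy _ h; exists x.
have [u uP] := choice ch.
have [|l ul _] := @geometric_cvg _ _ u (2 * C).
  move=> n; rewrite (le_trans (PsiC _)) // [2 * C]mulrC -mulrA ler_wpM2l //.
  rewrite linearB /=; have := nrm_dist y (Psi (u n.+1)) (Psi (u n)).
  rewrite (nrm_distC _ y); have := uP n; have := uP n.+1.
  have h : 0 < (1/2 : R) ^+ n by rewrite exprn_gt0 //; lra.
  rewrite exprS; lra.
exists l => //.
have h2 : (fun n => Psi (u n)) @ \oo --> y.
  apply/nrm_cvg_seqP => e e0; have [N hN] := half_pow_small 1 e0.
  exists N => n Nn; rewrite nrm_distC; apply: lt_trans (uP n) _.
  rewrite mul1r in hN; apply: le_lt_trans hN; rewrite ler_wiXn2l //; lra.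
exact: (nrm_cvg_unique \oo (op_cvg Psi ul) h2).
Qed.

(** The range of [Psi] is a closed copy of [E], hence complemented; the left
    inverse is the projection followed by the inverse of [Psi] on its range. *)
Lemma injective_left_inverse : injective_space E ->
  exists S : operator F E, forall x, S (Psi x) = x.
Proof.
move=> injE.
have lin : linear_subspace (range Psi).
  split; first by exists 0; rewrite ?linear0.
  by move=> a _ _ [x _ <-] [y _ <-]; exists (a *: x + y) => //; rewrite linearP.
pose G := ClosedSubspace lin bounded_below_range_closed.
have PG x : Psi x \in csub_pred G by apply/asboolP; exists x.
have [||U UE] := @mk_operator _ E G (fun x => CSub (PG x)) (nrm Psi).
- by move=> a x y; apply: val_inj; rewrite /= linearP.
- by move=> x; exact: nrm_op.
have [||V UV VU] := @inverse_operator _ E G U C.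
- by move=> x; rewrite UE; exact: PsiC.
- move=> v; have /asboolP[x _ xv] := csub_valP v.
  by exists x; apply: val_inj; rewrite UE /=.
have [P [PP Pr]] := injE F G (ex_intro _ U (ex_intro _ V (conj UV VU))).
have PGy y : P y \in csub_pred G by apply/asboolP; rewrite -Pr; exists y.
have [||P' P'E] := @mk_operator _ F G (fun y => CSub (PGy y)) (nrm P).
- by move=> a x y; apply: val_inj; rewrite /= linearP.
- by move=> x; exact: nrm_op.
exists (op_comp V P') => x; rewrite op_compE -[RHS]UV; congr (V _).
apply: val_inj; rewrite P'E UE /=.
have [y _ <-] : range P (Psi x) by rewrite Pr; exists x.
exact: PP.
Qed.

End injective_spaces.

Section schauder_bases.
Variables (R : realType) (E : completeNormedModType R[i]) (e : nat -> E).
Hypothesis eB : schauder_basis e.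

Lemma basis_unique (a b : nat -> R[i]) (x : E) :
  (\sum_(0 <= j < n) a j *: e j) @[n --> \oo] --> x ->
  (\sum_(0 <= j < n) b j *: e j) @[n --> \oo] --> x -> a = b.
Proof. by have [c [_ cu]] := eB x => /cu <- /cu <-. Qed.

Lemma basis_neq0 j : e j != 0.
Proof.
apply/eqP => ej; have h : (fun k => (k == j)%:R : R[i]) = (fun=> 0).
  apply: (basis_unique (x := 0)).
    rewrite (_ : (fun n => _) = fun=> 0); first exact: cvg_cst.
    apply/funext => n; apply: big1 => k _.
    by case: eqVneq => [->|_]; rewrite ?ej ?scaler0 ?scale0r.
  rewrite (_ : (fun n => _) = fun=> 0); first exact: cvg_cst.
  by apply/funext => n; apply: big1 => k _; rewrite scale0r.
have /eqP := congr1 (fun f => f j) h.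
by rewrite eqxx oner_eq0.
Qed.

(** The norm [sup_n |s_n x|] of the partial sums is countably subadditive by
    uniqueness of expansions, so that it is equivalent to the original norm;
    this also bounds the coordinate functionals. *)
Lemma basis_projections : exists (f : nat -> dual E) (K : R),
  [/\ 0 <= K,
      forall n x, nrm (\sum_(0 <= j < n) f j x *: e j) <= K * nrm x &
      forall x, (\sum_(0 <= j < n) f j x *: e j) @[n --> \oo] --> x].
Proof.
have [a aP] := choice (fun x => let: ex_intro a (conj h _) := eB x in
  ex_intro (fun a : nat -> R[i] =>
    (\sum_(0 <= j < n) a j *: e j) @[n --> \oo] --> x) a h).
pose s n x := \sum_(0 <= j < n) a x j *: e j.
have aL c x y j : a (c *: x + y) j = c * a x j + a y j.
  suff -> : a (c *: x + y) = fun j => c * a x j + a y j by [].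
  apply: basis_unique (aP _) _.
  rewrite (_ : (fun n => _) = fun n => c *: s n x + s n y).
    by apply: cvgD; [apply: cvgZl_tmp|]; exact: aP.
  apply/funext => n; rewrite /s scaler_sumr -big_split /=.
  by apply: eq_bigr => i _; rewrite scalerDl scalerA.
have sL n c x y : s n (c *: x + y) = c *: s n x + s n y.
  rewrite /s scaler_sumr -big_split /=.
  by apply: eq_bigr => i _; rewrite aL scalerDl scalerA.
have s0 n : s n 0 = 0.
  by have := sL n (-1) 0 0; rewrite scaler0 addr0 scaleN1r addNr.
have sD n x y : s n (x + y) = s n x + s n y.
  by have := sL n 1 x y; rewrite !scale1r.
have sZ n c x : s n (c *: x) = c *: s n x.
  by have := sL n c x 0; rewrite s0 !addr0.
have sS n x : s n.+1 x = s n x + a x n *: e n by rewrite /s big_nat_recr.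
have sb x : exists M, forall n, nrm (s n x) <= M.
  have /nrm_cvg_seqP/(_ 1 ltr01)[N hN] := aP x.
  exists (1 + nrm x + \sum_(0 <= j < N) nrm (s j x)) => n.
  have [Nn|nN] := leqP N n.
    have := hN _ Nn; rewrite -/(s n x) => h.
    have := nrm_dist x (s n x) 0; rewrite !subr0.
    have : 0 <= \sum_(0 <= j < N) nrm (s j x).
      by apply: sumr_ge0 => j _; exact: nrm_ge0.
    lra.
  rewrite (bigD1_seq n) ?mem_index_iota ?iota_uniq //=.
  have : 0 <= \sum_(0 <= j < N | j != n) nrm (s j x).
    by apply: sumr_ge0 => j _; exact: nrm_ge0.
  have := nrm_ge0 x; lra.
pose Q x := [set nrm (s n x) | n in setT].
pose p x := sup (Q x).
have sp n x : nrm (s n x) <= p x.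
  apply: ub_le_sup; last by exists n.
  by have [M sM] := sb x; exists M => _ [m _ <-].
have p_le x M : (forall n, nrm (s n x) <= M) -> p x <= M.
  by move=> h; apply: ge_sup; [exists (nrm (s 0 x)), 0%N|move=> _ [n _ <-]].
have pD x y : p (x + y) <= p x + p y.
  apply: p_le => n; rewrite sD (le_trans (nrmD _ _)) // lerD //; exact: sp.
have pZ1 c x : p (c *: x) <= nrm c * p x.
  by apply: p_le => n; rewrite sZ nrmZ ler_wpM2l ?nrm_ge0.
have pZ c x : p (c *: x) = nrm c * p x.
  apply/le_anti; rewrite pZ1 /=; have [->|c0] := eqVneq c 0.
    by rewrite nrm0 mul0r scale0r (le_trans _ (sp 0%N 0)) // nrm_ge0.
  have nc : 0 < nrm c by rewrite nrm_gt0.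
  have := pZ1 c^-1 (c *: x).
  by rewrite scalerA mulVf // scale1r nrmV mulrC ler_pdivlMr // mulrC.
have ae j x : nrm (a x j) * nrm (e j) <= 2 * p x.
  have := nrmB (s j.+1 x) (s j x); rewrite sS [s j x + _]addrC addrK nrmZ.
  rewrite [_ *: _ + _]addrC -sS; have := sp j.+1 x; have := sp j x; lra.
have ne j : 0 < nrm (e j) by rewrite nrm_gt0 basis_neq0.
have [|K K0 pK] := zabreiko pD pZ.
  move=> x z M M0 xz px; pose y N := \sum_(0 <= k < N) x k.
  have yS N : y N.+1 = y N + x N by rewrite /y big_nat_recr.
  have tP n : exists t, (fun N => s n (y N)) @ \oo --> t /\
      forall N, nrm (s n (y N) - t) <= 2 * M * (1/2) ^+ N.
    have [|t h1 h2] := @geometric_cvg _ _ (fun N => s n (y N)) M.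
      by move=> N; rewrite yS sD addrAC subrr add0r (le_trans (sp _ _)).
    by exists t.
  have [t {}tP] := choice tP.
  have bP j : exists b : R[i], (fun N => a (y N) j) @ \oo --> b.
    have [|b h1 _] := @geometric_cvg _ R[i] (fun N => a (y N) j) (2 * M / nrm (e j)).
      move=> N; have -> : a (y N.+1) j - a (y N) j = a (x N) j.
        have := aL 1 (y N) (x N) j; rewrite scale1r mul1r -yS => ->.
        by rewrite addrAC subrr add0r.
      rewrite mulrAC ler_pdivlMr // (le_trans (ae _ _)) // -mulrA.
      by rewrite ler_wpM2l.
    by exists b.
  have [b {}bP] := choice bP.
  have tE n : t n = \sum_(0 <= j < n) b j *: e j.
    apply: (nrm_cvg_unique \oo (tP n).1).
    elim: n => [|n IH].
      rewrite big_geq // (_ : (fun _ => _) = fun=> 0); first exact: cvg_cst.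
      by apply/funext => N; rewrite /s big_geq.
    rewrite big_nat_recr //= (_ : (fun _ => _) =
      fun N => s n (y N) + a (y N) n *: e n); last first.
      by apply/funext => N; rewrite sS.
    apply: cvgD => //; apply: cvgZr_tmp; exact: bP.
  have tz : (\sum_(0 <= j < n) b j *: e j) @[n --> \oo] --> z.
    apply/nrm_cvg_seqP => d d0; have d3 : 0 < d / 3 by rewrite divr_gt0.
    have [N1 hN1] := half_pow_small (2 * M) d3.
    have /nrm_cvg_seqP/(_ _ d3)[N2 hN2] := xz.
    pose N := maxn N1 N2.
    have /nrm_cvg_seqP/(_ _ d3)[n0 hn0] := aP (y N).
    exists n0 => n nn; rewrite -tE.
    have h1 := (tP n).2 N; have h2 := hn0 _ nn.
    have h3 := hN2 N (leq_maxr _ _).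
    have h4 : 2 * M * (1/2) ^+ N <= 2 * M * (1/2) ^+ N1.
      rewrite ler_wpM2l ?mulr_ge0 // ler_wiXn2l ?leq_maxl //; lra.
    have := nrm_dist (s n (y N)) (t n) z; have := nrm_dist (y N) (s n (y N)) z.
    rewrite (nrm_distC (t n) (s n (y N))); rewrite -/(s n (y N)) in h2.
    rewrite -/(y N) in h3; lra.
  have ab : a z = b by exact: basis_unique (aP z) tz.
  apply: p_le => n; have -> : s n z = t n by rewrite tE /s ab.
  have := (tP n).2 0%N.
  by rewrite /y big_geq // s0 sub0r nrmN expr0 mulr1.
have fP j : exists f : dual E, forall x, f x = a x j.
  apply: (@mk_operator _ _ R[i] (fun x => a x j) (2 * K / nrm (e j))).
    by move=> c x y; rewrite aL.
  move=> x; rewrite mulrAC ler_pdivlMr // (le_trans (ae _ _)) // -mulrA.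
  by rewrite ler_wpM2l.
have [f {}fP] := choice fP.
have sE n x : \sum_(0 <= j < n) f j x *: e j = s n x.
  by apply: eq_bigr => j _; rewrite fP.
exists f, K; split => // [n x|x].
  by rewrite sE (le_trans (sp _ _)).
have -> : (fun n => \sum_(0 <= j < n) f j x *: e j) = fun n => s n x.
  by apply/funext => n; exact: sE.
exact: aP.
Qed.

End schauder_bases.

Section dual_embedded_spaces.
Variables (R : realType) (E : completeNormedModType R[i]).
Variables (L : set (operator E E)) (F : completeNormedModType R[i])
  (Psi : operator E F).
Hypothesis Lmax : maximal_left_ideal L.
Hypothesis LE : forall T, L T <-> exists S : operator F E, T = op_comp S Psi.

(** Factorisations [Q n = S n o Psi] with bounded [S n] have a weak-star limit
    point in the dual space in which [E] is complemented. *)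
Lemma identity_by_weak_star_limit (X : completeNormedModType R[i])
    (U : operator E (dual X)) (V : operator (dual X) E)
    (Q : nat -> operator E E) (K : R) :
  cancel U V -> (forall n, L (Q n)) -> (forall n, nrm (Q n) <= K) ->
  (forall z x, (fun n => U (Q n z) x) @ \oo --> U z x) -> L (id_op E).
Proof.
move=> UV LQ QK Qcvg.
have [C C0 LC] := controlled_factor Lmax LE.
have K0 : 0 <= K by exact: le_trans (nrm_ge0 _) (QK 0%N).
have step n : exists S : operator F E,
    Q n = op_comp S Psi /\ nrm S <= C * K.
  have [S SQ hS] := LC _ (LQ n); exists S; split => //.
  by rewrite (le_trans hS) // ler_wpM2l.
have [S SP] := choice step.
have [W UW sW] := nat_ultra.
pose D := nrm U * (C * K).
have aD y x n : nrm (U (S n y) x) <= D * nrm y * nrm x.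
  rewrite (le_trans (nrm_op (U (S n y)) x)) // ler_wpM2r ?nrm_ge0 //.
  rewrite (le_trans (nrm_op U _)) // /D -mulrA ler_wpM2l ?nrm_ge0 //.
  by rewrite (le_trans (nrm_op (S n) _)) // ler_wpM2r ?nrm_ge0 // (SP n).2.
have lims (yx : F * X) : exists l : R[i],
    (fun n => U (S n yx.1) yx.2) @ W --> l.
  by case: yx => y x; exact: ultra_lim UW (aD y x).
have [r rP] := choice lims.
have rD y x : nrm (r (y, x)) <= D * nrm y * nrm x.
  apply: nrm_lim_le (rP (y, x)) _; apply: filterE => n; exact: aD.
have rL y (c : R[i]) x x' : r (y, c *: x + x') = c * r (y, x) + r (y, x').
  apply: (nrm_cvg_unique W (rP (y, _))).
  by apply: cvg_lin (rP (y, x)) (rP (y, x')) => n; rewrite linearP.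
have rL' x (c : R[i]) y y' : r (c *: y + y', x) = c * r (y, x) + r (y', x).
  apply: (nrm_cvg_unique W (rP (_, x))).
  by apply: cvg_lin (rP (y, x)) (rP (y', x)) => n; rewrite !linearP.
have ops y : exists g : dual X, forall x, g x = r (y, x).
  apply: (@mk_operator _ _ R[i] (fun x => r (y, x)) (D * nrm y)).
    exact: rL.
  exact: rD.
have [g gP] := choice ops.
have [||G GE] := @mk_operator _ F (dual X) g D.
- by move=> c y y'; apply: op_ext => x; rewrite op_add op_scale !gP rL'.
- move=> y; apply: op_nrm_le => [|x]; last by rewrite gP.
  by rewrite !mulr_ge0 ?nrm_ge0.
apply/LE; exists (op_comp V G); apply: op_ext => z.
rewrite !op_compE GE id_opE -[LHS]UV; congr (V _).
apply: op_ext => x; rewrite gP.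
apply: (nrm_cvg_unique W _ (rP (Psi z, x))) => /=.
rewrite (_ : (fun n => _) = fun n => U (Q n z) x).
  exact: cvg_trans (cvg_app _ sW) (Qcvg z x).
by apply/funext => n; have [-> _] := SP n.
Qed.

Hypothesis Lrank1 : forall x (f : dual E), L (rank_one x f).

Lemma ideal_sum (n : nat) (T : nat -> operator E E) :
  (forall j, L (T j)) -> L (\sum_(0 <= j < n) T j).
Proof.
have [[L0 LD _] _ _] := Lmax => LT.
by elim/big_rec : _ => // j S _ LS; exact: LD.
Qed.

(** The projections onto the partial sums have finite rank, so that they lie in
    [L], and they converge to the identity pointwise; [E] is complemented in the
    dual of its dual space. *)
Lemma basis_bidual_identity :
  has_schauder_basis E -> complemented_in_bidual E -> L (id_op E).
Proof.
move=> [e /basis_projections[f [K [K0 fK fc]]]] [P [PP Pr]].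
have kE (x : E) : nrm (canonical_embedding x) <= nrm x.
  apply: op_nrm_le => [|phi]; first exact: nrm_ge0.
  by rewrite mulrC; exact: (nrm_op phi x).
have [||k kap] := @mk_operator _ E (dual (dual E)) (@canonical_embedding R E) 1.
- by move=> c x y; apply: op_ext => phi; rewrite /= linearP.
- by move=> x; rewrite mul1r.
have kge x : nrm x <= nrm (k x).
  have [x0|] := eqVneq x 0; first by rewrite x0 nrm0 nrm_ge0.
  rewrite -nrm_gt0 => nx.
  have [phi [phix phi1]] := norming_functional x.
  have := nrm_op (k x) phi; rewrite kap /= phix nrmR ger0_norm ?nrm_ge0 //.
  move=> /le_trans; apply; rewrite ler_piMr ?nrm_ge0 //.
  by apply: op_nrm_le => // y; rewrite mul1r.
have ch y : exists x, k x = P y.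
  have : range P y -> True by []. have : range P (P y) by exists y.
  by rewrite Pr => -[x _ xy] _; exists x; rewrite kap.
have [v vP] := choice ch.
have kinj x y : k x = k y -> x = y.
  move=> kxy; apply/eqP; rewrite -subr_eq0 -nrm_eq0 eq_le nrm_ge0 andbT.
  by rewrite (le_trans (kge _)) // linearB /= kxy subrr nrm0.
have [||V VE] := @mk_operator _ (dual (dual E)) E v (nrm P).
- by move=> c x y; apply: kinj; rewrite linearP /= !vP linearP.
- by move=> x; rewrite (le_trans (kge _)) // vP; exact: nrm_op.
apply: (@identity_by_weak_star_limit (dual E) k V
  (fun n => \sum_(0 <= j < n) rank_one (e j) (f j)) K).
- move=> x; rewrite VE; apply: kinj; rewrite vP.
  have [y _ <-] : range P (k x) by rewrite Pr; exists x; rewrite ?kap.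
  exact: PP.
- by move=> n; apply: (@ideal_sum n (fun j => rank_one (e j) (f j))).
- move=> n; apply: op_nrm_le => // x; rewrite op_sum; exact: fK.
- move=> z phi; rewrite kap /=.
  have -> : (fun n => k ((\sum_(0 <= j < n) rank_one (e j) (f j)) z) phi) =
      fun n => phi (\sum_(0 <= j < n) f j z *: e j).
    by apply/funext => n; rewrite kap /= op_sum.
  exact: (op_cvg phi (fc z)).
Qed.

(** The adjoints of the partial sum projections of [X] have finite rank and
    converge to the identity pointwise in the weak-star topology. *)
Lemma dual_of_basis_identity (X : completeNormedModType R[i]) :
  has_schauder_basis X -> isomorphic E (dual X) -> L (id_op E).
Proof.
move=> [e /basis_projections[f [K [K0 fK fc]]]] [U [V [UV VU]]].
have ops j : exists g : dual E, forall z, g z = U z (e j).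
  by exists (op_comp (canonical_embedding (e j)) U).
have [g gE] := choice ops.
pose Q n := \sum_(0 <= j < n) rank_one (V (f j)) (g j).
have UQ n z x : U (Q n z) x = U z (\sum_(0 <= j < n) f j x *: e j).
  rewrite op_sum linear_sum /= op_sum linear_sum /=.
  apply: eq_bigr => j _.
  by rewrite ?rank_oneE linearZ /= VU gE linearZ; exact: mulrC.
apply: (@identity_by_weak_star_limit X U V Q (nrm V * (nrm U * K))) => //.
- by move=> n; apply: (@ideal_sum n (fun j => rank_one (V (f j)) (g j))).
- move=> n; apply: op_nrm_le => [|z]; first by rewrite !mulr_ge0 ?nrm_ge0.
  rewrite -[Q n z]UV (le_trans (nrm_op V _)) // -mulrA.
  rewrite ler_wpM2l ?nrm_ge0 //.
  apply: op_nrm_le => [|x]; first by rewrite !mulr_ge0 ?nrm_ge0.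
  rewrite UQ (le_trans (nrm_op (U z) _)) // mulrAC -mulrA.
  rewrite ?[_ * nrm z]mulrC.
  apply: (@le_trans _ _ ((nrm U * nrm z) * (K * nrm x))).
    by apply: ler_pM; rewrite ?nrm_ge0 //; exact: nrm_op.
  by rewrite le_eqVlt; apply/orP; left; apply/eqP; ring.
- move=> z x; have -> : (fun n => U (Q n z) x) =
      fun n => U z (\sum_(0 <= j < n) f j x *: e j).
    by apply/funext => n; rewrite UQ.
  exact: (op_cvg (U z) (fc x)).
Qed.

End dual_embedded_spaces.

(** * Strictly singular operators *)

Section history_choice.

(** In gliding hump arguments each term is chosen subject to conditions that
    involve all the previous ones. *)
Lemma history_choice (S : Type) (Q : seq S -> S -> Prop) :
  (forall h, exists x, Q h x) ->
  exists u : nat -> S, forall n, Q (mkseq u n) (u n).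
Proof.
move=> /choice[f fQ]; pose h := fix h n := if n is n'.+1 then
  rcons (h n') (f (h n')) else [::].
exists (fun n => f (h n)) => n.
suff -> : mkseq (fun n => f (h n)) n = h n by exact: fQ.
by elim: n => // n IH; rewrite mkseqS IH.
Qed.

Lemma history_mem (S : eqType) (u : nat -> S) m n :
  (m < n)%N -> u m \in mkseq u n.
Proof. by move=> mn; apply/mapP; exists m; rewrite ?mem_iota. Qed.

End history_choice.

Section infinite_dimension.
Variables (R : realType) (E : completeNormedModType R[i]).
Implicit Types (W : set E) (fs : seq (dual E)).

Lemma infinite_dimensional_sub W W' :
  W `<=` W' -> infinite_dimensional W -> infinite_dimensional W'.
Proof. by move=> sW nW [s hs]; apply: nW; exists s => x /sW; exact: hs. Qed.

Lemma infinite_dimensional_neq0 W :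
  infinite_dimensional W -> exists2 x, W x & x != 0.
Proof.
move=> nW; apply: contrapT => h; apply: nW; exists [::] => x Wx.
exists (fun=> 0); rewrite big_ord0; apply/eqP; rewrite -[_ == _]negbK.
by apply/negP => x0; apply: h; exists x.
Qed.

Definition joint_kernel fs : set E := [set x | forall f, f \in fs -> f x = 0].

Lemma joint_kernel_nil : joint_kernel [::] = setT.
Proof. by apply/seteqP; split. Qed.

Lemma joint_kernel_cons f fs x :
  joint_kernel (f :: fs) x <-> f x = 0 /\ joint_kernel fs x.
Proof.
split=> [h|[fx h] g]; last by rewrite inE => /orP[/eqP->|]; last exact: h.
by split=> [|g gs]; apply: h; rewrite inE ?eqxx // gs orbT.
Qed.

Lemma joint_kernel_linear fs : linear_subspace (joint_kernel fs).
Proof.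
split=> [f _|a x y hx hy f ffs]; first exact: linear0.
by rewrite linearP /= (hx f ffs) (hy f ffs) scaler0 addr0.
Qed.

Lemma joint_kernel_sub fs gs :
  {subset fs <= gs} -> joint_kernel gs `<=` joint_kernel fs.
Proof. by move=> sub x hx f /sub; exact: hx. Qed.

Lemma linear_subspaceI W W' : linear_subspace W -> linear_subspace W' ->
  linear_subspace (W `&` W').
Proof.
move=> [W0 WL] [W'0 W'L]; split=> // a x y [? ?] [? ?].
by split; [exact: WL|exact: W'L].
Qed.

Lemma infinite_dimensional_ker W (f : dual E) :
  linear_subspace W -> infinite_dimensional W ->
  infinite_dimensional (W `&` [set x | f x = 0]).
Proof.
move=> [W0 WL] nW [s hs]; have [f0|] := pselect (forall x, W x -> f x = 0).
  by apply: nW; exists s => x Wx; apply: hs; split => //; exact: f0.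
move=> /existsNP[u /not_implyP[Wu /eqP fu]]; apply: nW.
exists (u :: s) => x Wx; pose a := f x / f u.
have [|c cE] := hs (- a *: u + x).
  split; first exact: WL.
  have h : f (- a *: u + x) = - a * f u + f x by rewrite linearP.
  by rewrite /mkset h mulNr divfK // addNr.
exists (fun j => if j is j'.+1 then c j' else a).
rewrite big_ord_recl /=.
by rewrite -cE addrA -scalerDl subrr scale0r add0r.
Qed.

Lemma infinite_dimensional_joint_kernel W fs :
  linear_subspace W -> infinite_dimensional W ->
  infinite_dimensional (W `&` joint_kernel fs).
Proof.
move=> lW nW; elim: fs => [|f fs IH]; first by rewrite joint_kernel_nil setIT.
have h := infinite_dimensional_ker (f := f)
  (linear_subspaceI lW (joint_kernel_linear fs)) IH.
apply: infinite_dimensional_sub h => x [[Wx hx] fx]; split => //.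
by apply/joint_kernel_cons.
Qed.

(** A sequence that is triangular with respect to some functionals is
    linearly independent. *)
Lemma infinite_dimensional_triangular W (x : nat -> E)
    (f : nat -> E -> R[i]) :
  (forall n, W (x n)) ->
  (forall n (c : R[i]) u v, f n (c *: u + v) = c * f n u + f n v) ->
  (forall m n, (m < n)%N -> f m (x n) = 0) -> (forall n, f n (x n) != 0) ->
  infinite_dimensional W.
Proof.
move=> Wx fL f0 f1 [s hs]; pose n := size s.
have [c cP] := choice (fun i => hs _ (Wx i)).
pose M : 'M[R[i]]_(n.+1, n) := \matrix_(i, j) c i j.
have /rowV0Pn[v /sub_kermxP vM v0] : kermx M != 0.
  rewrite kermx_eq0; apply/negP => /eqP rM.
  by have := rank_leq_col M; rewrite rM ltnn.
have fn0 k : f k 0 = 0.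
  by have := fL k (-1) 0 0; rewrite scaler0 addr0 mulN1r addNr.
have fsum k (r : seq 'I_n.+1) : f k (\sum_(i <- r) v 0 i *: x i) =
    \sum_(i <- r) v 0 i * f k (x i).
  elim: r => [|i r IH]; first by rewrite !big_nil.
  by rewrite !big_cons fL IH.
have vx : \sum_(i < n.+1) v 0 i *: x i = 0.
  under eq_bigr => i _ do rewrite cP scaler_sumr.
  rewrite exchange_big big1 //= => j _.
  have vj : \sum_(i < n.+1) v 0 i * c i j = 0.
    have := congr1 (fun A : 'rV[R[i]]_n => A 0 j) vM; rewrite !mxE => h.
    by rewrite -[RHS]h; apply: eq_bigr => i _; rewrite mxE.
  under eq_bigr => i _ do rewrite scalerA.
  by rewrite -scaler_suml vj scale0r.
have v_eq0 : forall m (hm : (m < n.+1)%N), v 0 (Ordinal hm) = 0.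
  move=> m; have [k] := ubnP m; elim: k m => // k IH m mk hm.
  have := fsum m (index_enum _); rewrite vx fn0.
  rewrite (bigD1 (Ordinal hm)) //= big1 ?addr0.
    by move/esym/eqP; rewrite mulf_eq0 (negbTE (f1 m)) orbF => /eqP.
  move=> [j hj] /eqP jm /=; have [lt|gt|e] := ltngtP j m.
  - by rewrite IH ?mul0r // (leq_trans lt).
  - by rewrite f0 ?mulr0.
  - by case: jm; apply: val_inj.
move: v0 => /eqP; apply; apply/rowP => -[m hm]; rewrite mxE; exact: v_eq0.
Qed.

Definition span_seq (u : nat -> E) : set E :=
  [set x | exists n (a : nat -> R[i]), x = \sum_(0 <= k < n) a k *: u k].

Lemma span_seq_pad (u : nat -> E) (a : nat -> R[i]) n N : (n <= N)%N ->
  \sum_(0 <= k < n) a k *: u k =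
  \sum_(0 <= k < N) (if (k < n)%N then a k else 0) *: u k.
Proof.
move=> nN; rewrite (big_nat_widen _ _ N) // big_mkcond /=.
by apply: eq_bigr => k _; case: ifP => // _; rewrite scale0r.
Qed.

Lemma span_seq_linear (u : nat -> E) : linear_subspace (span_seq u).
Proof.
split; first by exists 0%N, (fun=> 0); rewrite big_geq.
move=> c _ _ [n [a ->]] [m [b ->]].
rewrite (span_seq_pad u a (leq_maxl n m)) (span_seq_pad u b (leq_maxr n m)).
exists (maxn n m), (fun k => c * (if (k < n)%N then a k else 0) +
  (if (k < m)%N then b k else 0)).
rewrite scaler_sumr -big_split /=; apply: eq_bigr => k _.
by rewrite scalerA -scalerDl.
Qed.

Lemma span_seq_mem (u : nat -> E) n : span_seq u (u n).
Proof.
exists n.+1, (fun k => (k == n)%:R); rewrite big_nat_recr //= eqxx scale1r.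
rewrite big_nat big1 ?add0r // => k /andP[_ kn].
by rewrite ltn_eqF ?scale0r.
Qed.

(** Applying [f k] to the sum removes the terms after the [k]-th and expresses
    [a k] through the coefficients before it. *)
Lemma triangular_coefficients (u : nat -> E) (f : nat -> dual E) :
  (forall n, nrm (u n) = 1) -> (forall n, f n (u n) = 1) ->
  (forall n x, nrm (f n x) <= nrm x) ->
  (forall m n, (m < n)%N -> f m (u n) = 0) ->
  forall n (a : nat -> R[i]) k, (k < n)%N ->
    nrm (a k) <= 2 ^+ k * nrm (\sum_(0 <= j < n) a j *: u j).
Proof.
move=> u1 fu f1 f0 n a k; set x := \sum_(0 <= j < n) _.
have [m] := ubnP k; elim: m k => // m IH k km kn.
have fZ (c : R[i]) y : f k (c *: y) = c * f k y by rewrite linearZ.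
have fx : f k x = \sum_(0 <= j < k) a j * f k (u j) + a k.
  rewrite linear_sum /= (big_cat_nat (n := k)) //= ?(ltnW kn) //; congr (_ + _).
    by apply: eq_bigr => j _; rewrite fZ.
  rewrite big_ltn // fZ fu mulr1 big_nat big1 ?addr0 // => j /andP[kj _].
  by rewrite fZ f0 // mulr0.
have -> : a k = f k x - \sum_(0 <= j < k) a j * f k (u j).
  by rewrite fx addrAC subrr add0r.
have S : \sum_(0 <= j < k) (2 : R) ^+ j = 2 ^+ k - 1.
  elim: (k) => [|j]; first by rewrite big_geq // expr0 subrr.
  by move=> h; rewrite big_nat_recr //= h exprS; ring.
have B : nrm (\sum_(0 <= j < k) a j * f k (u j)) <= (2 ^+ k - 1) * nrm x.
  rewrite -S mulr_suml (le_trans (nrm_sum _ _ _)) // !big_nat.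
  apply: ler_sum => j /andP[_ jk].
  rewrite nrmM -[leRHS]mulr1; apply: ler_pM; rewrite ?nrm_ge0 //.
    by apply: IH; [exact: (leq_trans jk)|exact: ltn_trans kn].
  by rewrite -(u1 j).
rewrite (le_trans (nrmB _ _)) //; have := f1 k x; lra.
Qed.

End infinite_dimension.

Section strictly_singular_operators.
Variable R : realType.
Implicit Types E F : completeNormedModType R[i].

(** Mazur's construction: unit vectors are chosen in [W], each in the kernel of
    functionals norming the previous ones. Their coefficients in a vector of
    norm one grow at most geometrically, while their images under [T] decrease
    faster. *)
Lemma small_on_infinite_dimensional E F (T : operator E F) (W : set E) :
  linear_subspace W ->
  (forall fs (d : R), 0 < d -> exists x,
     [/\ W x, joint_kernel fs x, nrm x = 1 & nrm (T x) <= d]) ->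
  forall e : R, 0 < e -> exists W' : set E,
    [/\ linear_subspace W', infinite_dimensional W', W' `<=` W &
        forall x, W' x -> nrm (T x) <= e * nrm x].
Proof.
move=> [W0 WL] WT e e0.
pose Q (h : seq (E * dual E)) (p : E * dual E) :=
  [/\ W p.1, nrm p.1 = 1, p.2 p.1 = 1 /\ (forall y, nrm (p.2 y) <= nrm y),
      joint_kernel (map snd h) p.1 &
      nrm (T p.1) <= e / 2 * (1/4) ^+ (size h)].
have [|u uQ] := @history_choice _ Q.
  move=> h; have d0 : 0 < e / 2 * (1/4) ^+ (size h).
    by rewrite mulr_gt0 ?divr_gt0 // exprn_gt0 //; lra.
  have [x [Wx kx x1 Tx]] := WT (map snd h) _ d0.
  have [f [fx f1]] := norming_functional x.
  by exists (x, f); split => //; rewrite fx x1.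
pose v n := (u n).1; pose f n := (u n).2.
have vW n : W (v n) by have [] := uQ n.
have v1 n : nrm (v n) = 1 by have [] := uQ n.
have fv n : f n (v n) = 1 by have [_ _ []] := uQ n.
have f1 n x : nrm (f n x) <= nrm x by have [_ _ []] := uQ n.
have f0 m n : (m < n)%N -> f m (v n) = 0.
  move=> mn; have [_ _ _ h _] := uQ n; apply: h.
  by rewrite (map_f snd (history_mem u mn)).
have Tv n : nrm (T (v n)) <= e / 2 * (1/4) ^+ n.
  by have [_ _ _ _] := uQ n; rewrite size_mkseq.
exists (span_seq v); split.
- exact: span_seq_linear.
- apply: (@infinite_dimensional_triangular _ _ _ v (fun n x => f n x)) => //.
  + exact: span_seq_mem.
  + by move=> n c x y; rewrite linearP.
  + by move=> n; rewrite fv oner_neq0.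
- move=> _ [n [a ->]]; elim: n => [|n IH]; first by rewrite big_geq.
  by rewrite big_nat_recr //= addrC; exact: WL.
move=> x [n [a xE]]; rewrite {1}xE linear_sum (le_trans (nrm_sum _ _ _)) //.
have S : \sum_(0 <= j < n) (1/2 : R) ^+ j <= 2.
  suff -> : \sum_(0 <= j < n) (1/2 : R) ^+ j = 2 - 2 * (1/2) ^+ n.
    have : 0 <= (1/2 : R) ^+ n by rewrite exprn_ge0 //; lra.
    lra.
  elim: (n) => [|j h]; first by rewrite big_geq // expr0; lra.
  by rewrite big_nat_recr //= h exprS; lra.
apply: (@le_trans _ _ (\sum_(0 <= j < n) (e / 2 * nrm x) * (1/2) ^+ j)).
  rewrite !big_nat; apply: ler_sum => j /andP[_ jn].
  rewrite linearZ /= nrmZ.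
  have aj := triangular_coefficients v1 fv f1 f0 a jn.
  have h := ler_pM (nrm_ge0 _) (nrm_ge0 _) aj (Tv j).
  rewrite (le_trans h) // -xE le_eqVlt; apply/orP; left; apply/eqP.
  have -> : (1/2 : R) ^+ j = 2 ^+ j * (1/4) ^+ j.
    by rewrite -exprMn; congr (_ ^+ _); lra.
  ring.
rewrite -mulr_sumr (le_trans (ler_wpM2l _ S)) //.
  by rewrite mulr_ge0 ?nrm_ge0 // divr_ge0 // ltW.
lra.
Qed.

Lemma not_strictly_singularP E F (T : operator E F) :
  (exists W : set E, [/\ linear_subspace W, infinite_dimensional W &
     exists2 e : R, 0 < e & forall x, W x -> e * nrm x <= nrm (T x)]) <->
  ~ strictly_singular T.
Proof.
split=> [[W [lW nW [e e0 he]]]|].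
  apply; exists W; split => //; exists e%:C%C; first by rewrite ltcR.
  by move=> x Wx; rewrite -!nrmE -rmorphM /= lecR he.
move=> /contrapT[W [lW nW [e e0 he]]]; exists W; split => //.
have eE : (complex.Re e)%:C%C = e by exact/ge0_ReK/ltW.
exists (complex.Re e); first by rewrite -ltcR eE.
by move=> x Wx; rewrite -lecR rmorphM /= eE !nrmE; exact: he.
Qed.

Lemma strictly_singular_small E F (T : operator E F) (W : set E) (e : R) :
  strictly_singular T -> linear_subspace W -> infinite_dimensional W ->
  0 < e -> exists W' : set E,
    [/\ linear_subspace W', infinite_dimensional W', W' `<=` W &
        forall x, W' x -> nrm (T x) <= e * nrm x].
Proof.
move=> sT lW nW; move: e; apply: small_on_infinite_dimensional => // fs d d0.
apply: contrapT => h; apply/not_strictly_singularP : sT.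
exists (W `&` joint_kernel fs); split.
- exact: linear_subspaceI (joint_kernel_linear fs).
- exact: infinite_dimensional_joint_kernel.
exists d => // x [Wx kx]; rewrite leNgt; apply/negP => hx; apply: h.
have x0 : 0 < nrm x.
  rewrite lt_def nrm_ge0 andbT; apply/eqP => x0.
  by move: hx; rewrite x0 mulr0 ltNge nrm_ge0.
have xV : 0 <= (nrm x)^-1 by rewrite invr_ge0 ltW.
exists ((nrm x)^-1%:C%C *: x); split.
- by have [W0 WL] := lW; rewrite -[_ *: x]addr0; exact: WL.
- have [K0 KL] := joint_kernel_linear fs.
  by rewrite -[_ *: x]addr0; exact: KL.
- by rewrite nrmZR ger0_norm // mulVf // gt_eqF.
- by rewrite linearZ /= nrmZR ger0_norm // mulrC ler_pdivrMr // ltW.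
Qed.

Lemma strictly_singular_family E F (n : nat) (S : nat -> operator E F)
    (W : set E) (e : R) :
  (forall j, (j < n)%N -> strictly_singular (S j)) ->
  linear_subspace W -> infinite_dimensional W -> 0 < e ->
  exists W' : set E,
    [/\ linear_subspace W', infinite_dimensional W', W' `<=` W &
        forall x, W' x -> forall j, (j < n)%N -> nrm (S j x) <= e * nrm x].
Proof.
move=> sS lW nW e0; elim: n sS => [|n IH] sS; first by exists W; split.
have [j jn|W1 [l1 n1 s1 h1]] := IH; first by apply: sS; rewrite ltnS ltnW.
have [W2 [l2 n2 s2 h2]] := strictly_singular_small (sS n (ltnSn n)) l1 n1 e0.
exists W2; split => //; first exact: subset_trans s1.
move=> x W2x j; rewrite ltnS leq_eqVlt => /orP[/eqP->|]; first exact: h2.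
by apply: h1; exact: s2.
Qed.

(** Sums, compositions and restrictions of strictly singular operators are
    instances of this domination principle. *)
Lemma strictly_singular_dominated E F G (n : nat) (S : nat -> operator E F)
    (T : operator E G) (C : R) :
  (forall j, (j < n)%N -> strictly_singular (S j)) ->
  (forall x, nrm (T x) <= C * \sum_(j < n) nrm (S j x)) ->
  strictly_singular T.
Proof.
move=> sS TC; apply: contrapT => /not_strictly_singularP[W [lW nW [e e0 he]]].
have D0 : 0 < (`|C| + 1) * (n%:R + 1) by rewrite mulr_gt0 // ltr_wpDl.
have [W' [lW' nW' sW' hW']] := strictly_singular_family sS lW nW
  (divr_gt0 e0 D0).
have [x W'x x0] := infinite_dimensional_neq0 nW'.
have nx : 0 < nrm x by rewrite nrm_gt0.
have := le_trans (he _ (sW' _ W'x)) (TC x); rewrite leNgt => /negP; apply.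
set d := e / _ in hW'; have d0 : 0 < d by rewrite divr_gt0.
have B : \sum_(j < n) nrm (S j x) <= n%:R * (d * nrm x).
  rewrite -[n in n%:R]card_ord -sumr_const mulr_suml.
  by apply: ler_sum => j _; rewrite mul1r; exact: hW'.
have -> : e = d * ((`|C| + 1) * (n%:R + 1)) by rewrite divfK // gt_eqF.
have B0 : 0 <= \sum_(j < n) nrm (S j x) by apply: sumr_ge0 => j _; exact: nrm_ge0.
apply: (@le_lt_trans _ _ (`|C| * (n%:R * (d * nrm x)))).
  by rewrite (le_trans (ler_wpM2r B0 (ler_norm C))) // ler_wpM2l.
have dx : 0 < d * nrm x by rewrite mulr_gt0.
rewrite [ltRHS](_ : _ = ((`|C| + 1) * (n%:R + 1)) * (d * nrm x)); last by ring.
rewrite [ltLHS]mulrA (ltr_pM2r dx) mulrDl !mulrDr !mulr1 !mul1r.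
have := normr_ge0 C; have : (0 : R) <= n%:R by []; lra.
Qed.

End strictly_singular_operators.

(** * Fredholm perturbations of the identity *)

Section fredholm.
Variables (R : realType) (E : completeNormedModType R[i]).
Implicit Types (S T V : operator E E) (fs : seq (dual E)).

(** Otherwise [I + t S] is small on an infinite-dimensional subspace, where [S]
    is then bounded below. *)
Lemma strictly_singular_semi_fredholm S (t : R) : strictly_singular S ->
  exists fs (C : R), forall x, joint_kernel fs x ->
    nrm x <= C * nrm (x + t%:C%C *: S x).
Proof.
move=> sS; apply: contrapT => H; apply/not_strictly_singularP : sS.
pose T := id_op E + t%:C%C *: S.
have TE x : T x = x + t%:C%C *: S x by [].
have [|fs d d0||W [lW nW _ hW]] := @small_on_infinite_dimensional _ _ _ T setT
    _ _ (1/2).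
- by split.
- apply: contrapT => h; apply: H; exists fs, d^-1 => x kx.
  rewrite mulrC ler_pdivlMr // leNgt -TE; apply/negP => hx; apply: h.
  have x0 : 0 < nrm x.
    rewrite lt_def nrm_ge0 andbT; apply/eqP => x0.
    by move: hx; rewrite x0 mul0r ltNge nrm_ge0.
  have xV : 0 <= (nrm x)^-1 by rewrite invr_ge0 ltW.
  exists ((nrm x)^-1%:C%C *: x); split => //.
  + have [K0 KL] := joint_kernel_linear fs.
    by rewrite -[_ *: x]addr0; exact: KL.
  + by rewrite nrmZR ger0_norm // mulVf // gt_eqF.
  + by rewrite linearZ /= nrmZR ger0_norm // mulrC ler_pdivrMr // mulrC ltW.
- lra.
exists W; split => //; have t0 : 0 < 2 * (`|t| + 1) by have := normr_ge0 t; lra.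
exists (2 * (`|t| + 1))^-1; first by rewrite invr_gt0.
move=> x Wx; rewrite mulrC ler_pdivrMr //.
have h1 := hW x Wx; rewrite TE in h1.
have := nrm_dist (x + t%:C%C *: S x) x 0; rewrite !subr0 nrm_distC addrAC subrr.
rewrite add0r nrmZR; have := nrm_ge0 (S x); nra.
Qed.

(** The conditions that work for one [t] also work near it, with a larger
    constant; by compactness finitely many values of [t] suffice. *)
Lemma uniform_semi_fredholm S : strictly_singular S ->
  exists fs (C : R), 0 <= C /\ forall t : R, 0 <= t <= 1 ->
    forall x, joint_kernel fs x -> nrm x <= C * nrm (x + t%:C%C *: S x).
Proof.
move=> sS.
pose Fil : set_system (seq (dual E) * R) := [set A | exists fs0 C0,
  forall fs C, {subset fs0 <= fs} -> C0 <= C -> A (fs, C)].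
have FF : Filter Fil.
  split.
  - by exists [::], 0.
  - move=> A B [f1 [c1 h1]] [f2 [c2 h2]]; exists (f1 ++ f2), (Num.max c1 c2).
    move=> fs C sub; rewrite ge_max => /andP[C1 C2]; split.
      by apply: h1 => // f ff; apply: sub; rewrite mem_cat ff.
    by apply: h2 => // f ff; apply: sub; rewrite mem_cat ff orbT.
  - by move=> A B AB [f1 [c1 h1]]; exists f1, c1 => fs C h h'; apply: AB; exact: h1.
have := @segment_compact R 0 1.
move=> /compact_near_coveringP/(_ _ Fil (fun i t => forall x,
  joint_kernel i.1 x -> nrm x <= i.2 * nrm (x + t%:C%C *: S x)) FF).
case=> [t _|fs [C h]]; last first.
  exists fs, (Num.max C 0); split; first by rewrite le_max lexx orbT.
  move=> t t01 x kx; apply: (h fs (Num.max C 0) _ _ t) => //=.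
  by rewrite le_max lexx.
have [fs [C hC]] := strictly_singular_semi_fredholm t sS.
pose D := 2 * (`|C| + 1) * (nrm S + 1).
have D0 : 0 < D.
  by rewrite !mulr_gt0 // ltr_wpDl ?nrm_ge0.
exists ([set t' : R | `|t - t'| < D^-1],
  [set i : seq (dual E) * R | {subset fs <= i.1} /\ 2 * (`|C| + 1) <= i.2]); first split => /=.
- have DV : 0 < D^-1 by rewrite invr_gt0.
  by have := nbhsx_ballx t _ DV.
- by exists fs, (2 * (`|C| + 1)).
move=> [t' [fs' C']] /= [tt' [sub hC']] x kx.
have h := hC x (joint_kernel_sub sub kx).
have h1 := nrm_dist (x + t'%:C%C *: S x) (x + t%:C%C *: S x) 0.
rewrite !subr0 opprD addrACA subrr add0r -scalerBl -rmorphB nrmZR in h1.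
have h2 := nrm_op S x.
have x0 := nrm_ge0 x; have C0 := normr_ge0 C; have S0 := nrm_ge0 S.
have y0 := nrm_ge0 (x + t'%:C%C *: S x).
have h3 : nrm x <= (`|C| + 1) * nrm (x + t%:C%C *: S x).
  apply: (le_trans h); rewrite ler_wpM2r ?nrm_ge0 //.
  by have := ler_norm C; lra.
have h4 : (`|C| + 1) * (`|t - t'| * nrm (S x)) <= 1/2 * nrm x.
  have k1 : `|t - t'| * nrm (S x) <= D^-1 * ((nrm S + 1) * nrm x).
    by apply: ler_pM; rewrite ?nrm_ge0 ?normr_ge0 // ?(ltW tt') //; nra.
  have C1 : 0 <= `|C| + 1 by lra.
  apply: (le_trans (ler_wpM2l C1 k1)).
  rewrite le_eqVlt; apply/orP; left; apply/eqP; rewrite /D; field.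
  by rewrite !gt_eqF //; lra.
have h5 := ler_wpM2l (_ : 0 <= `|C| + 1) h1.
have {}h5 := h5 ltac:(lra).
have h6 : nrm x <= 2 * (`|C| + 1) * nrm (x + t'%:C%C *: S x) by lra.
by apply: (le_trans h6); rewrite ler_wpM2r.
Qed.

(** The operator is [V] composed with [x |-> x + f x *: (B z - e)], whose
    inverse is also a perturbation of the identity of rank one. *)
Lemma rank_one_perturbation_invertible (V : operator E E) (f : dual E)
    (B : operator E E) (z : E) (e : E) :
  cancel V B -> cancel B V -> f e = 1 -> f (B z) != 0 ->
  invertible (V + rank_one (z - V e) f).
Proof.
move=> VB BV fe fz; pose w := B z - e.
pose T := B - (f (B z))^-1 *: op_comp (rank_one w f) B.
have fw : f w = f (B z) - 1 by rewrite linearB /= fe.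
have fZ (c : R[i]) y : f (c *: y) = c * f y by rewrite linearZ.
have TE y : T y = B y - ((f (B z))^-1 * f (B y)) *: w.
  by rewrite /T op_sub op_scale op_compE rank_oneE scalerA.
have zw : z - V e = V w by rewrite linearB /= BV.
exists T => x.
  have BE : B (V x + f x *: V w) = x + f x *: w.
    by rewrite linearD linearZ /= !VB.
  have fE : f (x + f x *: w) = f x + f x * (f (B z) - 1).
    by rewrite linearD /= fZ fw.
  rewrite TE op_add rank_oneE zw BE fE -addrA -scalerBl.
  rewrite [X in X *: w](_ : _ = 0) ?scale0r ?addr0 //.
  by field.
rewrite op_add rank_oneE zw TE linearB linearZ /= BV.
have -> : f (B x - ((f (B z))^-1 * f (B x)) *: w) =
    f (B x) - (f (B z))^-1 * f (B x) * (f (B z) - 1).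
  by rewrite linearB /= fZ fw.
rewrite -addrA -scaleNr -scalerDl [X in X *: _](_ : _ = 0) ?scale0r ?addr0 //.
by field.
Qed.

(** By induction on [fs]. The image under [V] of one direction [e], outside the
    kernel of [f], is replaced by a unit vector on which the functional
    [f o V^-1] almost attains its norm; the new operator controls [f]. *)
Lemma improve_lower_bound fs (c0 : R) : 0 <= c0 ->
  exists2 c : R, 0 <= c & forall V, invertible V ->
    (forall x, joint_kernel fs x -> nrm x <= c0 * nrm (V x)) ->
    exists V', [/\ invertible V', forall x, joint_kernel fs x -> V' x = V x &
      forall x, nrm x <= c * nrm (V' x)].
Proof.
elim: fs c0 => [|f fs IH] c0 c00.
  exists c0 => // V iV hV; exists V; split => // x; apply: hV.
  by rewrite joint_kernel_nil.
have [f0|] := pselect (forall x, joint_kernel fs x -> f x = 0).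
  have [c cp hc] := IH _ c00; exists c => // V iV hV.
  have [|V' [h1 h2 h3]] := hc V iV.
    by move=> x kx; apply: hV; apply/joint_kernel_cons; split => //; exact: f0.
  by exists V'; split => // x /joint_kernel_cons[_]; exact: h2.
move=> /existsNP[e' /not_implyP[ke' /eqP fe']].
pose e := (f e')^-1 *: e'.
have fe : f e = 1.
  have h : f e = (f e')^-1 * f e' by rewrite linearZ.
  by rewrite h mulVf.
have [K0 KL] := joint_kernel_linear fs.
have ke : joint_kernel fs e by rewrite /e -[_ *: _]addr0; exact: KL.
have c10 : 0 <= 3 * c0 + 2 * nrm e by have := nrm_ge0 e; lra.
have [c cp hc] := IH _ c10; exists c => // V [B VB BV] hV.
pose g : dual E := op_comp f B.
have [z z1 gz] : exists2 z, nrm z = 1 & nrm g < 2 * nrm (g z).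
  apply: contrapT => h.
  have g2 : nrm g <= nrm g / 2.
    apply: op_nrm_le => [|z]; first by rewrite divr_ge0 ?nrm_ge0.
    have [->|z0] := eqVneq z 0; first by rewrite linear0 !nrm0 mulr0.
    have nz : 0 < nrm z by rewrite nrm_gt0.
    rewrite leNgt; apply/negP => hz; apply: h.
    exists ((nrm z)^-1%:C%C *: z).
      by rewrite nrmZR ger0_norm ?invr_ge0 ?nrm_ge0 // mulVf // gt_eqF.
    rewrite linearZ /= [nrm (_ *: _)]nrmZR ger0_norm ?invr_ge0 ?nrm_ge0 //.
    rewrite mulrCA mulrC ltr_pdivlMr //; lra.
  have g0 : nrm g = 0 by have := nrm_ge0 g; lra.
  have := nrm_op g (V e); rewrite g0 mul0r op_compE VB fe nrm1; lra.
have gz0 : f (B z) != 0.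
  rewrite -nrm_eq0; apply/eqP => h; have := gz; rewrite op_compE h mulr0.
  by rewrite ltNge nrm_ge0.
have iV1 := rank_one_perturbation_invertible VB BV fe gz0.
set V1 := V + _ in iV1.
have V1E x : V1 x = V (x - f x *: e) + f x *: z.
  have VE : V (x - f x *: e) = V x - f x *: V e by rewrite linearB /= linearZ.
  by rewrite op_add rank_oneE VE scalerBr -!addrA; congr (_ + _); exact: addrC.
have [|V' [h1 h2 h3]] := hc V1 iV1.
  move=> x kx; pose m := x - f x *: e.
  have km : joint_kernel (f :: fs) m.
    apply/joint_kernel_cons; split.
      have h : f m = f x - f x * f e by rewrite linearB /= linearZ.
      by rewrite h fe mulr1 subrr.
    by rewrite /m addrC -scaleNr; exact: KL.
  have gm : g (V m) = 0.
    by rewrite op_compE VB; have /joint_kernel_cons[] := km.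
  have a_le : nrm (f x) <= 2 * nrm (V1 x).
    have gV1 : g (V1 x) = f x * g z.
      have h : g (V m + f x *: z) = g (V m) + f x * g z.
        by rewrite linearD linearZ.
      by rewrite V1E -/m h gm add0r.
    have h := nrm_op g (V1 x); rewrite gV1 nrmM in h.
    have gz' : 0 < nrm (g z) by rewrite nrm_gt0.
    rewrite -(ler_pM2r gz') (le_trans h) // [leRHS]mulrAC ler_wpM2r ?nrm_ge0 //.
    exact: ltW.
  have m_le : nrm m <= c0 * (3 * nrm (V1 x)).
    apply: (le_trans (hV m km)); rewrite ler_wpM2l //.
    have -> : V m = V1 x - f x *: z by rewrite V1E addrK.
    by rewrite (le_trans (nrmB _ _)) // nrmZ z1; lra.
  have -> : x = m + f x *: e by rewrite /m subrK.
  rewrite (le_trans (nrmD _ _)) //; have -> : m + f x *: e = x by rewrite /m subrK.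
  rewrite nrmZ; have := ler_wpM2r (nrm_ge0 e) a_le; lra.
exists V'; split => // x /joint_kernel_cons[fx kx].
by rewrite (h2 _ kx) V1E fx !scale0r subr0 addr0.
Qed.

(** Continuation along [I + t S]: all these operators are bounded below by the
    same constant on the same finite-codimensional subspace, and small steps
    preserve the existence of an invertible operator agreeing with them there. *)
Lemma strictly_singular_continuation S : strictly_singular S ->
  exists fs V, invertible V /\ forall x, joint_kernel fs x -> V x = x + S x.
Proof.
move=> sS; have [fs [C [C0 hC]]] := uniform_semi_fredholm sS.
have [c c0 hc] := improve_lower_bound fs C0.
pose N := Num.bound (2 * c * nrm S).
have N0 : 0 <= 2 * c * nrm S by rewrite !mulr_ge0 ?nrm_ge0.
have hN : 2 * c * nrm S < N%:R by exact: archi_boundP.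
have N1 : (0 : R) < N%:R by exact: le_lt_trans hN.
suff H k : (k <= N)%N -> exists V, invertible V /\
    forall x, joint_kernel fs x -> V x = x + (k%:R / N%:R)%:C%C *: S x.
  have [V [iV hV]] := H N (leqnn _); exists fs, V; split => // x kx.
  by rewrite hV // divff ?gt_eqF // scale1r.
elim: k => [_|k IH kN].
  exists (id_op E); split; first by exists (id_op E).
  by move=> x _; rewrite mul0r scale0r addr0.
have [V [iV hV]] := IH (ltnW kN).
have k01 : 0 <= (k%:R / N%:R : R) <= 1.
  apply/andP; split; first by rewrite divr_ge0.
  by rewrite ler_pdivrMr // mul1r ler_nat ltnW.
have [|V' [iV' V'V hV']] := hc V iV.
  by move=> x kx; rewrite hV //; exact: hC.
exists (V' + (N%:R^-1)%:C%C *: S); split.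
  apply: (invertible_perturb (d := N%:R^-1 * nrm S) iV' hV') => //.
    move=> x; rewrite op_add addrAC subrr add0r op_scale nrmZR.
    by rewrite ger0_norm ?invr_ge0 // -mulrA ler_wpM2l ?invr_ge0 // nrm_op.
  rewrite [leLHS](_ : _ = (c * nrm S) / N%:R); last by ring.
  by rewrite ler_pdivrMr //; lra.
move=> x kx; rewrite op_add op_scale V'V // hV // -addrA -scalerDl.
by congr (_ + _ *: _); rewrite -rmorphD /= -natr1 mulrDl mul1r.
Qed.

Variable L : set (operator E E).
Hypothesis Llin : left_ideal L.
Hypothesis Lrank1 : forall x (f : dual E), L (rank_one x f).

(** Such an operator is a sum of operators of rank one. *)
Lemma vanishing_on_joint_kernel_in_ideal fs T :
  (forall x, joint_kernel fs x -> T x = 0) -> L T.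
Proof.
have [L0 LD LM] := Llin.
elim: fs T => [|f fs IH] T hT.
  rewrite (_ : T = 0) //; apply: op_ext => x; apply: hT.
  by rewrite joint_kernel_nil.
have [f0|] := pselect (forall x, joint_kernel fs x -> f x = 0).
  apply: IH => x kx; apply: hT; apply/joint_kernel_cons; split => //.
  exact: f0.
move=> /existsNP[e /not_implyP[ke /eqP fe]].
pose y := (f e)^-1 *: T e.
rewrite -(subrK (rank_one y f) T); apply: LD => //.
apply: IH => x kx; rewrite op_sub rank_oneE scalerA.
have [K0 KL] := joint_kernel_linear fs.
have fZ (c : R[i]) z : f (c *: z) = c * f z by rewrite linearZ.
have : T (- (f x / f e) *: e + x) = 0.
  apply: hT; apply/joint_kernel_cons; split; last exact: KL.
  by rewrite linearD /= fZ mulNr divfK // addNr.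
by rewrite linearD linearZ /= scaleNr addrC.
Qed.

(** The operator [I + S] differs from an invertible one by an operator of
    finite rank, which is its property of being Fredholm of index zero. *)
Lemma fredholm_identity S : strictly_singular S -> L (id_op E + S) ->
  L (id_op E).
Proof.
move=> sS LS; have [L0 LD LM] := Llin.
have [fs [V [[B VB BV] hV]]] := strictly_singular_continuation sS.
have LV : L V.
  rewrite -(subrK (id_op E + S) V); apply: LD => //.
  apply: (@vanishing_on_joint_kernel_in_ideal fs) => x kx.
  by rewrite op_sub hV // op_add subrr.
rewrite (_ : id_op E = op_comp B V); first exact: LM.
by apply: op_ext => x; rewrite op_compE VB.
Qed.

End fredholm.

Section few_operators.
Variables (R : realType) (E : completeNormedModType R[i]).
Variables (L : set (operator E E)).
Hypothesis Llin : left_ideal L.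
Hypothesis Lrank1 : forall x (f : dual E), L (rank_one x f).

(** If some [T j] has a nonzero scalar part, it is a multiple of a strictly
    singular perturbation of the identity. Otherwise all [T j] are strictly
    singular, which excludes a joint lower bound. *)
Lemma few_operators_identity (n : nat) (T : nat -> operator E E) (C : R) :
  few_operators E -> (forall j, (j < n)%N -> L (T j)) ->
  (forall x, nrm x <= C * \sum_(j < n) nrm (T j x)) -> L (id_op E).
Proof.
move=> [nE few] LT hC; have [L0 LD LM] := Llin.
have [a aP] := choice (fun j => few (T j)).
have [S SP] := choice aP.
have [[j [jn aj]]|a0] := pselect (exists j, (j < n)%N /\ a j != 0).
  have sS : strictly_singular ((a j)^-1 *: S j).
    have [sSj _] := SP j.
    apply: (@strictly_singular_dominated _ _ _ _ 1 (fun _ => S j) _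
      (nrm (a j)^-1)) => // x.
    by rewrite big_ord1 op_scale nrmZ.
  apply: (fredholm_identity Llin Lrank1 sS).
  rewrite (_ : _ + _ = op_comp ((a j)^-1 *: id_op E) (T j)).
    by apply: LM; exact: LT.
  apply: op_ext => x; have [_ h] := SP j.
  rewrite op_compE op_add !op_scale !id_opE h scalerDr scalerA mulVf //.
  by rewrite scale1r.
have sT j : (j < n)%N -> strictly_singular (S j) by have [] := SP j.
exfalso; have : strictly_singular (id_op E).
  apply: (strictly_singular_dominated sT (C := C)) => x; rewrite id_opE.
  suff <- : \sum_(j < n) nrm (T j x) = \sum_(j < n) nrm (S j x) by [].
  apply: eq_bigr => j _; have [_ ->] := SP j.
  have -> : a j = 0.
    apply/eqP; rewrite -[_ == _]negbK; apply/negP => aj.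
    by apply: a0; exists j.
  by rewrite scale0r add0r.
apply/not_strictly_singularP; exists setT; split => //.
by exists 1 => // x _; rewrite mul1r.
Qed.

End few_operators.

(** * Hilbert spaces *)

Lemma Re_conj (R : realType) (z : R[i]) : complex.Re z^* = complex.Re z.
Proof. by case: z. Qed.

Section inner_products.
Variables (R : realType) (H : completeNormedModType R[i]).

Lemma hilbert_form : hilbert_space H -> exists ip : H -> H -> R[i],
  [/\ forall v (c : R[i]) x y, ip (c *: x + y) v = c * ip x v + ip y v,
      forall u (c : R[i]) x y, ip u (c *: x + y) = c^* * ip u x + ip u y,
      forall x, ip x x = (nrm x ^+ 2)%:C%C,
      forall x y, complex.Re (ip x y) = complex.Re (ip y x) &
      forall x y, nrm (ip x y) <= nrm x * nrm y].
Proof.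
move=> [f fE].
have ipl v (c : R[i]) x y : f (c *: x + y) v = c * f x v + f y v.
  exact: (linearPl f v c x y).
have ipr u (c : R[i]) x y : f u (c *: x + y) = c^* * f u x + f u y.
  exact: (linearPr f u c x y).
have ipn x : f x x = (nrm x ^+ 2)%:C%C by rewrite fE -nrmE rmorphXn.
have ips x y : complex.Re (f x y) = complex.Re (f y x).
  have fC : f x y = (f y x)^*.
    by have := hermC f x y; rewrite expr0 mul1r => h; exact: h.
  by rewrite fC Re_conj.
have ipD x y : nrm (x + y) ^+ 2 =
    nrm x ^+ 2 + 2 * complex.Re (f x y) + nrm y ^+ 2.
  have e z : nrm z ^+ 2 = complex.Re (f z z) by rewrite ipn.
  rewrite !e linearDl !linearDr !raddfD /= (ips y x); ring.
exists (fun x y => f x y); split => // x y.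
have [u [u1 uf]] := phase (f x y).
have f0 z : f 0 z = 0.
  by have := ipl z (-1) 0 0; rewrite scaler0 addr0 mulN1r addNr.
have fu : f (u *: x) y = (nrm (f x y))%:C%C.
  by have := ipl y u x 0; rewrite f0 !addr0 uf.
have [y0|y0] := eqVneq y 0.
  have := ipr x (-1) 0 0; rewrite scaler0 addr0 rmorphN rmorph1 mulN1r addNr.
  by rewrite y0 => ->; rewrite nrm0 mulr_ge0 ?nrm_ge0.
have ny : 0 < nrm y by rewrite nrm_gt0.
set a := nrm (f x y) in fu *; pose t := - (a / nrm y ^+ 2).
have h := sqr_ge0 (nrm (u *: x + t%:C%C *: y)).
have ft : complex.Re (f (u *: x) (t%:C%C *: y)) = t * a.
  rewrite ips; have := ipl (u *: x) t%:C%C y 0; rewrite f0 !addr0 => ->.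
  have -> : complex.Re (t%:C%C * f y (u *: x)) = t * complex.Re (f y (u *: x)).
    by case: (f y (u *: x)) => p q /=; ring.
  by rewrite ips fu.
rewrite ipD ft !nrmZ u1 mul1r nrmR in h.
rewrite exprMn real_normK ?num_real // in h.
have a0 : 0 <= a by exact: nrm_ge0.
have h2 : a ^+ 2 <= (nrm x * nrm y) ^+ 2.
  have y2 : 0 < nrm y ^+ 2 by rewrite exprn_gt0.
  have e : t * nrm y ^+ 2 = - a by rewrite /t mulNr divfK // gt_eqF.
  rewrite exprMn; nra.
by rewrite -(ler_pXn2r (ltn0Sn 1)) ?nnegrE ?mulr_ge0 ?nrm_ge0.
Qed.

(** The sign makes the real part of the inner product nonnegative. *)
Lemma hilbert_sign : hilbert_space H -> forall x y : H, exists b : bool,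
  nrm x ^+ 2 + nrm y ^+ 2 <= nrm (x + (-1) ^+ b *: y) ^+ 2.
Proof.
move=> /hilbert_form[ip [ipl ipr ipn ips _]] x y.
have e z : nrm z ^+ 2 = complex.Re (ip z z) by rewrite ipn.
have ip1 v z w : ip (z + w) v = ip z v + ip w v.
  by have := ipl v 1 z w; rewrite scale1r mul1r.
have ip2 v z w : ip v (z + w) = ip v z + ip v w.
  by have := ipr v 1 z w; rewrite scale1r rmorph1 mul1r.
have ip0 v : ip 0 v = 0.
  by have := ipl v (-1) 0 0; rewrite scaler0 addr0 mulN1r addNr.
have ipN v z : ip (- z) v = - ip z v.
  by have := ipl v (-1) z 0; rewrite scaleN1r mulN1r ip0 !addr0.
have expand z : nrm (x + z) ^+ 2 =
    nrm x ^+ 2 + 2 * complex.Re (ip z x) + nrm z ^+ 2.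
  by rewrite !e ip1 !ip2 !raddfD /= (ips x z); ring.
have [h|h] := leP 0 (complex.Re (ip y x)).
  by exists false; rewrite expr0 scale1r expand; lra.
exists true; rewrite expr1 scaleN1r expand ipN nrmN raddfN /=; lra.
Qed.

End inner_products.

(** Riesz representation with respect to an equivalent sesquilinear form, by
    minimising [q (x, x) - 2 Re l x]. *)
Lemma riesz_form (R : realType) (V : completeNormedModType R[i])
    (q : V -> V -> R[i]) (l : V -> R[i]) (c D M : R) :
  (forall v (a : R[i]) x y, q (a *: x + y) v = a * q x v + q y v) ->
  (forall u (a : R[i]) x y, q u (a *: x + y) = a^* * q u x + q u y) ->
  (forall x y, complex.Re (q x y) = complex.Re (q y x)) ->
  (forall x, nrm x ^+ 2 <= c * complex.Re (q x x)) ->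
  (forall x y, nrm (q x y) <= D * nrm x * nrm y) ->
  (forall (a : R[i]) x y, l (a *: x + y) = a * l x + l y) ->
  (forall x, nrm (l x) <= M * nrm x) -> 0 <= M -> 0 < c ->
  exists z, forall x, l x = q x z.
Proof.
move=> ql qr qs qc qD lL lM M0 c0.
have q1 v z w : q (z + w) v = q z v + q w v.
  by have := ql v 1 z w; rewrite scale1r mul1r.
have q2 v z w : q v (z + w) = q v z + q v w.
  by have := qr v 1 z w; rewrite scale1r rmorph1 mul1r.
have l1 x y : l (x + y) = l x + l y.
  by have := lL 1 x y; rewrite scale1r mul1r.
have q0 v : q 0 v = 0.
  by have := ql v (-1) 0 0; rewrite scaler0 addr0 mulN1r addNr.
have l0 : l 0 = 0.
  by have := lL (-1) 0 0; rewrite scaler0 addr0 mulN1r addNr.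
have qZ a z v : q (a *: z) v = a * q z v.
  by have := ql v a z 0; rewrite q0 !addr0.
have lZ a z : l (a *: z) = a * l z.
  by have := lL a z 0; rewrite l0 !addr0.
have ReZ (t : R) (z : R[i]) : complex.Re (t%:C%C * z) = t * complex.Re z.
  by case: z => p r /=; ring.
pose Q x := complex.Re (q x x); pose B x y := complex.Re (q x y).
pose J x := Q x - 2 * complex.Re (l x).
have Bs u v : B u v = B v u by rewrite /B qs.
have Bl u v (t : R) : B (t%:C%C *: u) v = t * B u v by rewrite /B qZ ReZ.
have Br u v (t : R) : B u (t%:C%C *: v) = t * B u v by rewrite Bs Bl Bs.
have QE x y (t : R) : Q (x + t%:C%C *: y) = Q x + 2 * t * B y x + t ^+ 2 * Q y.
  have e : Q (x + t%:C%C *: y) = B x x + B (t%:C%C *: y) x +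
      (B x (t%:C%C *: y) + B (t%:C%C *: y) (t%:C%C *: y)).
    by rewrite /Q q2 !q1 !raddfD.
  rewrite e !Bl !Br (Bs x y) /Q -/(B y y) -/(B x x); ring.
have JE x y (t : R) : J (x + t%:C%C *: y) =
    J x + 2 * t * (B y x - complex.Re (l y)) + t ^+ 2 * Q y.
  by rewrite /J QE l1 lZ raddfD /= ReZ; ring.
have Q0 x : 0 <= Q x.
  by rewrite -(ler_pM2l c0) mulr0 (le_trans _ (qc x)) // sqr_ge0.
have Jlb x : - (c * M ^+ 2) <= J x.
  have h1 := qc x; have h2 := lM x; have h3 := nrm_Re_le (l x).
  have h4 := ler_norm (complex.Re (l x)).
  have h5 : 2 * complex.Re (l x) <= 2 * (M * nrm x) by lra.
  rewrite /J -(ler_pM2l c0).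
  have := sqr_ge0 (nrm x - c * M).
  rewrite -/(Q x) in h1; nra.
pose A := [set J x | x in setT].
have infA : has_inf A.
  split; first by exists (J 0), 0.
  by exists (- (c * M ^+ 2)) => _ [x _ <-].
pose d := inf A.
have dJ x : d <= J x by apply: ge_inf; [exact: infA.2|exists x].
have ch n : exists x, J x <= d + (1/4) ^+ n.
  have e0 : 0 < (1/4 : R) ^+ n by rewrite exprn_gt0 //; lra.
  by have [_ [x _ <-] h] := inf_adherent e0 infA; exists x; exact: ltW.
have [u uP] := choice ch.
have e4 n : (1/4 : R) ^+ n = ((1/2) ^+ n) ^+ 2.
  by rewrite exprAC; congr (_ ^+ _); lra.
(* Approximate minimisers form a Cauchy sequence, since [J] at the midpoint of
   two of them is not below the infimum. *)
have [|z uz _] := @geometric_cvg _ _ u (2 * (c + 1)).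
  move=> n; pose w := u n.+1 - u n.
  have mid := dJ (u n + (1/2)%:C%C *: w).
  have end1 : J (u n.+1) = J (u n) + 2 * (B w (u n) - complex.Re (l w)) + Q w.
    have := JE (u n) w 1; rewrite scale1r mulr1 expr1n mul1r => <-.
    by rewrite /w addrC subrK.
  rewrite JE in mid; have h1 := uP n; have h2 := uP n.+1.
  have e0 : 0 <= (1/4 : R) ^+ n by rewrite exprn_ge0 //; lra.
  rewrite exprS in h2.
  have Qw : Q w <= 4 * (1/4) ^+ n by lra.
  have h : nrm w ^+ 2 <= (2 * (c + 1) * (1/2) ^+ n) ^+ 2.
    apply: (le_trans (qc w)); rewrite -/(Q w) exprMn -e4.
    have : c * Q w <= c * (4 * (1/4) ^+ n) by rewrite ler_wpM2l // ltW.
    have : 0 <= c ^+ 2 by exact: sqr_ge0.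
    nra.
  rewrite -(ler_pXn2r (ltn0Sn 1)) ?nnegrE ?nrm_ge0 //.
  by rewrite !mulr_ge0 ?exprn_ge0 //; lra.
have var n v : `|B v (u n) - complex.Re (l v)| <= (1/2) ^+ n * (Q v + 1).
  set a := _ - _; have p0 : 0 <= (1/2 : R) ^+ n by rewrite exprn_ge0 //; lra.
  have key : a ^+ 2 <= (1/4) ^+ n * Q v.
    have [Qv|Qv] := eqVneq (Q v) 0.
      have v0 : v = 0.
        apply/eqP; rewrite -nrm_eq0 -sqrf_eq0 eq_le sqr_ge0 andbT.
        by have := qc v; rewrite -/(Q v) Qv mulr0.
      by rewrite Qv mulr0 /a /B v0 q0 l0 subrr expr0n.
    have Qp : 0 < Q v by rewrite lt_def Qv Q0.
    have h := dJ (u n + (- (a / Q v))%:C%C *: v); rewrite JE -/a in h.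
    have e : a / Q v * Q v = a by rewrite divfK.
    have h1 := uP n; nra.
  rewrite -(ler_pXn2r (ltn0Sn 1)) ?nnegrE ?normr_ge0 //; last first.
    by rewrite mulr_ge0 // addr_ge0.
  rewrite real_normK ?num_real // exprMn -e4 (le_trans key) //.
  rewrite ler_wpM2l ?e4 ?sqr_ge0 //; have := Q0 v; nra.
have reE v : B v z = complex.Re (l v).
  apply/eqP; rewrite -subr_eq0 -normr_le0; apply/ler_addgt0Pr => e e0.
  rewrite add0r; have e2 : 0 < e / 2 by rewrite divr_gt0.
  have D1 : 0 < (`|D| + 1) * (nrm v + 1) by rewrite mulr_gt0 // ltr_wpDl ?nrm_ge0.
  have [N1 hN1] := half_pow_small (Q v + 1) e2.
  move/nrm_cvg_seqP : uz => /(_ _ (divr_gt0 e2 D1))[N2 hN2].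
  pose n := maxn N1 N2; have h1 := var n v; have h2 := hN2 n (leq_maxr _ _).
  have h3 : (1/2) ^+ n * (Q v + 1) < e / 2.
    apply: le_lt_trans hN1; rewrite mulrC ler_wpM2l //.
      by rewrite addr_ge0.
    rewrite ler_wiXn2l ?leq_maxl //; lra.
  have h4 : `|B v (u n) - B v z| <= e / 2.
    have -> : B v (u n) - B v z = complex.Re (q v (u n - z)).
      have Be : B v (u n) = complex.Re (q v (u n - z)) + B v z.
        by rewrite /B -raddfD -q2 subrK.
      by rewrite Be addrK.
    apply: (le_trans (nrm_Re_le _)); apply: (le_trans (qD _ _)).
    rewrite ltr_pdivlMr // in h2; apply: le_trans (ltW h2).
    rewrite mulrC ler_wpM2l ?nrm_ge0 //;
    by have := ler_norm D; have := nrm_ge0 v; have := normr_ge0 D; nra.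
  have := ler_distD (B v (u n)) (B v z) (complex.Re (l v)).
  rewrite (distrC (B v z) (B v (u n))); lra.
exists z => x; have h1 := reE x; have h2 := reE ('i%C *: x).
rewrite /B qZ lZ in h1 h2; move: h1 h2.
case: (q x z) => a b; case: (l x) => a' b' /= -> h2.
by congr (_ +i* _)%C; lra.
Qed.

(** The form [sum_m <Theta_m x, Theta_m y>] is an equivalent inner product, and
    the left inverse is the adjoint of the family [Theta] with respect to it. *)
Lemma hilbert_left_inverse (R : realType) (H : completeNormedModType R[i])
    (n : nat) (Theta : nat -> operator H H) (c : R) :
  hilbert_space H ->
  (forall h, nrm h ^+ 2 <= c * \sum_(m < n) nrm (Theta m h) ^+ 2) ->
  exists S : nat -> operator H H,
    forall h, \sum_(m < n) S m (Theta m h) = h.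
Proof.
move=> /hilbert_form[ip [ipl ipr ipn ips ipCS]] hc0.
pose C := `|c| + 1; have C0 : 0 < C by rewrite ltr_wpDl.
have hc h : nrm h ^+ 2 <= C * \sum_(m < n) nrm (Theta m h) ^+ 2.
  apply: (le_trans (hc0 h)); rewrite ler_wpM2r //.
    by apply: sumr_ge0 => m _; exact: sqr_ge0.
  by rewrite /C; have := ler_norm c; lra.
pose q x y := \sum_(m < n) ip (Theta m x) (Theta m y).
have ql v (a : R[i]) x y : q (a *: x + y) v = a * q x v + q y v.
  rewrite /q mulr_sumr -big_split /=; apply: eq_bigr => m _.
  by rewrite linearP ipl.
have qr u (a : R[i]) x y : q u (a *: x + y) = a^* * q u x + q u y.
  rewrite /q mulr_sumr -big_split /=; apply: eq_bigr => m _.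
  by rewrite linearP ipr.
have qRe x y : complex.Re (q x y) =
    \sum_(m < n) complex.Re (ip (Theta m x) (Theta m y)).
  by rewrite /q raddf_sum.
have qs x y : complex.Re (q x y) = complex.Re (q y x).
  by rewrite !qRe; apply: eq_bigr => m _; rewrite ips.
have qc x : nrm x ^+ 2 <= C * complex.Re (q x x).
  rewrite (_ : complex.Re _ = \sum_(m < n) nrm (Theta m x) ^+ 2) //.
  by rewrite qRe; apply: eq_bigr => m _; rewrite ipn.
pose D := \sum_(m < n) nrm (Theta m) ^+ 2.
have qD x y : nrm (q x y) <= D * nrm x * nrm y.
  rewrite /q /D !mulr_suml (le_trans (nrm_sum _ _ _)) //.
  apply: ler_sum => m _; apply: (le_trans (ipCS _ _)).
  rewrite [leRHS](_ : _ = (nrm (Theta m) * nrm x) * (nrm (Theta m) * nrm y)).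
    by apply: ler_pM; rewrite ?nrm_ge0 //; exact: nrm_op.
  by ring.
have ch m v : exists z, forall x, ip (Theta m x) v = q x z.
  apply: (@riesz_form R H q (fun x => ip (Theta m x) v) C D
    (nrm (Theta m) * nrm v)) => //.
  - by move=> a x y; rewrite linearP ipl.
  - move=> x; apply: (le_trans (ipCS _ _)); rewrite mulrAC.
    by rewrite ler_wpM2r ?nrm_ge0 // nrm_op.
  - by rewrite mulr_ge0 ?nrm_ge0.
have [s sP] := choice (fun mv : nat * H => ch mv.1 mv.2).
have quniq z w : (forall x, q x z = q x w) -> z = w.
  move=> h; apply/eqP; rewrite -subr_eq0 -nrm_eq0 -sqrf_eq0 eq_le sqr_ge0 andbT.
  apply: (le_trans (qc _)).
  have -> : q (z - w) (z - w) = 0.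
    have := qr (z - w) (-1) w z; rewrite scaleN1r addrC rmorphN rmorph1 mulN1r.
    by move=> ->; rewrite h addNr.
  by rewrite mulr0.
have ops m : exists S : operator H H, forall v, S v = s (m, v).
  apply: (@mk_operator _ _ _ _ (C * nrm (Theta m))).
    move=> a v v'; apply: quniq => x.
    by rewrite qr -!(sP (_, _)) /= ipr.
  move=> v; set z := s (m, v).
  have [->|z0] := eqVneq z 0.
    by rewrite nrm0 !mulr_ge0 ?nrm_ge0 // ltW.
  have nz : 0 < nrm z by rewrite nrm_gt0.
  rewrite -(ler_pM2r nz) -expr2 (le_trans (qc z)) // -(sP (m, v) z) /=.
  have h := le_trans (ler_norm _) (nrm_Re_le (ip (Theta m z) v)).
  have h2 := le_trans h (ipCS _ _).
  have h3 : nrm (Theta m z) * nrm v <= nrm (Theta m) * nrm z * nrm v.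
    by rewrite ler_wpM2r ?nrm_ge0 // nrm_op.
  have := ler_wpM2l (ltW C0) (le_trans h2 h3).
  by move=> /le_trans; apply; rewrite le_eqVlt; apply/orP; left; apply/eqP; ring.
have [S SE] := choice ops.
exists S => h; apply: quniq => x.
have q0 : q x 0 = 0.
  have := qr x (-1) 0 0; rewrite scaler0 addr0 rmorphN rmorph1 mulN1r addNr.
  by [].
have qD1 z w : q x (z + w) = q x z + q x w.
  by have := qr x 1 z w; rewrite scale1r rmorph1 mul1r.
rewrite (big_morph _ qD1 q0); apply: eq_bigr => m _.
by rewrite SE -(sP (_, _)).
Qed.

(** * Operators between [c0(I)] and Hilbert spaces *)

Lemma scaleCE (R : realType) (c z : R[i]) : c *: z = c * z.
Proof. by []. Qed.

Section c0_toolkit.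
Variables (R : realType) (I : choiceType).
Local Notation c0I := (c0 R I).

Definition c0_val (x : c0I) (i : I) : R[i] := ell_infty_fun (csub_val x) i.

Lemma c0_valD x y i : c0_val (x + y) i = c0_val x i + c0_val y i.
Proof. by []. Qed.

Lemma c0_valB x y i : c0_val (x - y) i = c0_val x i - c0_val y i.
Proof. by []. Qed.

Lemma c0_valZ (c : R[i]) x i : c0_val (c *: x) i = c * c0_val x i.
Proof.
have -> : c0_val (c *: x) i = c *: c0_val x i by [].
exact: scaleCE.
Qed.

Lemma c0_valP (c : R[i]) x y i :
  c0_val (c *: x + y) i = c * c0_val x i + c0_val y i.
Proof. by rewrite c0_valD c0_valZ. Qed.

Lemma c0_ext x y : (forall i, c0_val x i = c0_val y i) -> x = y.
Proof. by move=> h; do 2!apply: val_inj; apply/funext. Qed.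

Lemma nrm_c0_val x i : nrm (c0_val x i) <= nrm x.
Proof. by rewrite -lecR !nrmE; exact: (ell_infty_norm_ub (csub_val x) i). Qed.

Lemma nrm_c0_le x (M : R) : 0 <= M -> (forall i, nrm (c0_val x i) <= M) ->
  nrm x <= M.
Proof.
move=> M0 h; rewrite le_nrm; apply: sup_norm_le; first by rewrite lecR.
by move=> i _; rewrite -le_nrm; exact: h.
Qed.

Lemma c0_finite x (e : R) : 0 < e ->
  exists G : seq I, forall i, e <= nrm (c0_val x i) -> i \in G.
Proof.
move=> e0; have /asboolP/(_ e e0)/finite_seqP[G hG] := csub_valP x.
exists G => i hi; suff : [set` G] i by [].
by rewrite -hG /= -nrmE lecR.
Qed.

Lemma mk_c0 (f : I -> R[i]) (M : R) : (forall i, nrm (f i) <= M) ->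
  (forall e : R, 0 < e -> exists G : seq I, forall i,
     e <= nrm (f i) -> i \in G) ->
  exists x : c0I, forall i, c0_val x i = f i.
Proof.
move=> fM fG; have fb : f \in @is_bounded R I.
  by apply/asboolP; exists M%:C%C => i _; rewrite -le_nrm.
have fc : EllInfty fb \in csub_pred (c0 R I).
  apply/asboolP => e e0; have [G hG] := fG e e0.
  apply: sub_finite_set (finite_seq G) => i /=.
  by rewrite -nrmE lecR; exact: hG.
by exists (CSub fc).
Qed.

Lemma c0_unit_subproof (i : I) :
  exists x : c0I, forall k, c0_val x k = (k == i)%:R.
Proof.
apply: (@mk_c0 _ 1) => [k|e e0].
  by case: (k == i); rewrite ?nrm1 ?nrm0.
exists [:: i] => k; rewrite inE; case: (k == i) => //.
by rewrite nrm0 leNgt e0.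
Qed.

Definition c0_unit i : c0I := sval (cid (c0_unit_subproof i)).

Lemma c0_unitE i k : c0_val (c0_unit i) k = (k == i)%:R.
Proof. exact: svalP (cid (c0_unit_subproof i)) k. Qed.

Lemma c0_coordinate (i : I) : exists f : dual c0I, forall x, f x = c0_val x i.
Proof.
apply: (@mk_operator _ _ R[i] (fun x : c0I => c0_val x i) 1) => // x.
by rewrite mul1r nrm_c0_val.
Qed.

Lemma c0_multiplier (m : I -> R[i]) (M : R) : (forall i, nrm (m i) <= M) ->
  exists T : operator c0I c0I, forall x i, c0_val (T x) i = m i * c0_val x i.
Proof.
move=> mM; have mx x i : nrm (m i * c0_val x i) <= (`|M| + 1) * nrm (c0_val x i).
  rewrite nrmM ler_wpM2r ?nrm_ge0 // (le_trans (mM i)) //.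
  by have := ler_norm M; lra.
have M1 : 0 < `|M| + 1 by rewrite ltr_wpDl.
have ex x : exists y : c0I, forall i, c0_val y i = m i * c0_val x i.
  apply: (@mk_c0 _ ((`|M| + 1) * nrm x)) => [i|e e0].
    by rewrite (le_trans (mx x i)) // ler_wpM2l ?nrm_c0_val // ltW.
  have [G hG] := c0_finite x (divr_gt0 e0 M1).
  exists G => i hi; apply: hG; rewrite ler_pdivrMr // mulrC.
  exact: le_trans (mx x i).
have [g gP] := choice ex.
have [||T TE] := @mk_operator _ c0I c0I g (`|M| + 1).
- by move=> c x y; apply: c0_ext => i; rewrite c0_valP !gP c0_valP; ring.
- move=> x; apply: nrm_c0_le => [|i]; first by rewrite mulr_ge0 ?nrm_ge0 // ltW.
  rewrite gP (le_trans (mx x i)) // ler_wpM2l ?nrm_c0_val // ltW //.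
by exists T => x i; rewrite TE gP.
Qed.

Lemma c0_restriction (A : set I) : exists T : operator c0I c0I, forall x i,
  c0_val (T x) i = if `[< A i >] then c0_val x i else 0.
Proof.
have [|T TE] := @c0_multiplier (fun i => if `[< A i >] then 1 else 0) 1.
  by move=> i; case: ifP; rewrite ?nrm1 ?nrm0.
by exists T => x i; rewrite TE; case: ifP; rewrite ?mul1r ?mul0r.
Qed.

Lemma c0_truncation x (e : R) : 0 < e -> exists (G : seq I) (y : c0I),
  [/\ forall i, i \in G -> c0_val y i = c0_val x i,
      forall i, i \notin G -> c0_val y i = 0 & nrm (x - y) <= e].
Proof.
move=> e0; have [G hG] := c0_finite x e0.
have [T TE] := c0_restriction [set` G].
exists G, (T x); split => [i iG|i iG|].
- by rewrite TE; case: asboolP.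
- by rewrite TE; case: asboolP => // h; rewrite h in iG.
apply: nrm_c0_le => [|i]; first exact: ltW.
rewrite c0_valB TE; case: asboolP => h; first by rewrite subrr nrm0 ltW.
by rewrite subr0 leNgt; apply/negP => /ltW/hG.
Qed.

Lemma c0_finite_sum (G : seq I) x : uniq G ->
  (forall i, i \notin G -> c0_val x i = 0) ->
  x = \sum_(i <- G) c0_val x i *: c0_unit i.
Proof.
move=> uG xG; apply: c0_ext => k.
have -> : c0_val (\sum_(i <- G) c0_val x i *: c0_unit i) k =
    \sum_(i <- G) c0_val x i * (k == i)%:R.
  elim: (G) => [|i s IH]; first by rewrite !big_nil.
  by rewrite !big_cons c0_valP IH c0_unitE.
have [kG|kG] := boolP (k \in G); last first.
  rewrite xG // big1_seq // => i /= iG; case: eqVneq => [ki|]; last by rewrite mulr0.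
  by rewrite ki iG in kG.
rewrite (bigD1_seq k) //= eqxx mulr1 big1 ?addr0 // => i ik.
by rewrite eq_sym (negbTE ik) mulr0.
Qed.

(** Vectors of finite support are dense in [c0]. *)
Lemma c0_functional_eq0 (phi : dual c0I) x :
  (forall i, c0_val x i != 0 -> phi (c0_unit i) = 0) -> phi x = 0.
Proof.
move=> h; apply/eqP; rewrite -nrm_eq0 eq_le nrm_ge0 andbT.
apply/ler_addgt0Pr => e e0; rewrite add0r.
have N1 : 0 < nrm phi + 1 by rewrite ltr_wpDl ?nrm_ge0.
have [G0 [y [yG0 y0 xy]]] := c0_truncation x (divr_gt0 e0 N1).
have phiy : phi y = 0.
  rewrite (@c0_finite_sum (undup G0) y) ?undup_uniq //; last first.
    by move=> i; rewrite mem_undup; exact: y0.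
  rewrite linear_sum big1_seq // => i /=; rewrite mem_undup => iG.
  rewrite linearZ /= yG0 //.
  have [->|xi] := eqVneq (c0_val x i) 0; first by rewrite scale0r.
  by rewrite h // scaler0.
rewrite -[x](subrK y) linearD /= phiy addr0 (le_trans (nrm_op phi _)) //.
rewrite ler_pdivlMr // in xy; apply: le_trans xy.
rewrite mulrC ler_wpM2l ?nrm_ge0 //; lra.
Qed.

End c0_toolkit.

(** Finitely many operators into [c0(I)] are combined into one, so that
    Sobczyk's theorem can be applied to a single embedding. *)
Lemma c0_assembly (R : realType) (I : choiceType)
    (F : completeNormedModType R[i]) (n : nat)
    (T : nat -> operator F (c0 R I)) :
  exists W : operator F (c0 R (I * nat)%type), forall y i l,
    c0_val (W y) (i, l) = if (l < n)%N then c0_val (T l y) i else 0.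
Proof.
pose M := \sum_(l < n) nrm (T l).
have TM l y : (l < n)%N -> nrm (T l y) <= M * nrm y.
  move=> ln; rewrite (le_trans (nrm_op _ _)) // ler_wpM2r ?nrm_ge0 //.
  rewrite /M (bigD1 (Ordinal ln)) //= lerDl.
  by apply: sumr_ge0 => k _; exact: nrm_ge0.
have M0 : 0 <= M by apply: sumr_ge0 => k _; exact: nrm_ge0.
pose f y (il : I * nat) := if (il.2 < n)%N then c0_val (T il.2 y) il.1 else 0.
have fM y il : nrm (f y il) <= M * nrm y.
  rewrite /f; case: ifP => ln; last by rewrite nrm0 mulr_ge0 ?nrm_ge0.
  exact: le_trans (nrm_c0_val _ _) (TM _ _ ln).
have ex y : exists z : c0 R (I * nat)%type, forall il, c0_val z il = f y il.
  apply: (mk_c0 (fM y)) => e e0.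
  have [G GP] := choice (fun l => c0_finite (T l y) e0).
  exists [seq (i, l) | l <- iota 0 n, i <- G l] => -[i l].
  rewrite /f /=; case: ifP => ln; last by rewrite nrm0 leNgt e0.
  move=> hi; apply/allpairsPdep; exists l, i.
  by rewrite mem_iota /= ln (GP l i hi).
have [g gP] := choice ex.
have [||W WE] := @mk_operator _ F (c0 R (I * nat)%type) g M.
- move=> c x y; apply: c0_ext => il; rewrite c0_valP !gP /f.
  case: ifP => _; last by rewrite mulr0 addr0.
  by rewrite linearP c0_valP.
- move=> y; apply: nrm_c0_le => [|il]; first by rewrite mulr_ge0 ?nrm_ge0.
  by rewrite gP.
by exists W => y i l; rewrite WE gP.
Qed.

Section c0_and_hilbert.
Variables (R : realType) (I : choiceType) (H : completeNormedModType R[i]).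
Hypothesis hH : hilbert_space H.
Local Notation c0I := (c0 R I).

(** Otherwise disjointly supported vectors of norm at most one with images of
    norm at least [d / 2], added with suitable signs, stay in the unit ball
    while their images grow like the square root of their number. *)
Lemma c0_to_hilbert_small (C : operator c0I H) (d : R) : 0 < d ->
  exists G : seq I, forall x, (forall i, i \in G -> c0_val x i = 0) ->
    nrm (C x) <= d * nrm x.
Proof.
move=> d0; apply: contrapT => nG.
have bump (G : seq I) : exists (x : c0I) (G' : seq I),
    [/\ forall i, i \in G -> c0_val x i = 0,
        forall i, i \notin G' -> c0_val x i = 0,
        nrm x <= 1 & d / 2 <= nrm (C x)].
  have [x [xG hx]] : exists x, (forall i, i \in G -> c0_val x i = 0) /\
      d * nrm x < nrm (C x).
    apply: contrapT => nx; apply: nG; exists G => x xG.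
    by rewrite leNgt; apply/negP => hx; apply: nx; exists x.
  have nx : 0 < nrm x.
    rewrite lt_def nrm_ge0 andbT; apply/eqP => x0; move: hx.
    have -> : x = 0 by apply/eqP; rewrite -nrm_eq0 x0.
    by rewrite linear0 !nrm0 mulr0 ltxx.
  pose x1 := (nrm x)^-1%:C%C *: x.
  have x11 : nrm x1 = 1.
    by rewrite nrmZR ger0_norm ?invr_ge0 ?nrm_ge0 // mulVf // gt_eqF.
  have Cx1 : d < nrm (C x1).
    rewrite linearZ /= nrmZR ger0_norm ?invr_ge0 ?nrm_ge0 //.
    by rewrite mulrC ltr_pdivlMr.
  have N1 : 0 < 2 * (nrm C + 1) by have := nrm_ge0 C; lra.
  have [G' [y [yG' y0 xy]]] := c0_truncation x1 (divr_gt0 d0 N1).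
  exists y, G'; split => //.
  - move=> i iG; have [iG'|/y0//] := boolP (i \in G').
    by rewrite yG' // c0_valZ xG // mulr0.
  - apply: nrm_c0_le => // i; have [iG'|/y0 ->] := boolP (i \in G').
      by rewrite yG' // -x11 nrm_c0_val.
    by rewrite nrm0.
  have := nrm_op C (x1 - y); rewrite linearB /=.
  have := nrm_ler_dist (C x1) (C y).
  rewrite ler_pdivlMr // in xy; have := nrm_ge0 (x1 - y); lra.
have grow N : exists (s : c0I) (G : seq I),
    [/\ forall i, i \notin G -> c0_val s i = 0, nrm s <= 1 &
        N%:R * (d / 2) ^+ 2 <= nrm (C s) ^+ 2].
  elim: N => [|N [s [G [sG s1 hs]]]].
    exists 0, [::]; split => //; rewrite ?nrm0 //.
    by rewrite mul0r sqr_ge0.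
  have [x [G' [xG xG' x1 hx]]] := bump G.
  have [b hb] := hilbert_sign hH (C s) (C x).
  exists (s + (-1) ^+ b *: x), (G ++ G'); split.
  - move=> i; rewrite mem_cat negb_or => /andP[iG iG'].
    by rewrite c0_valD c0_valZ sG // xG' // mulr0 addr0.
  - apply: nrm_c0_le => // i; rewrite c0_valD c0_valZ.
    have [iG|iG] := boolP (i \in G).
      by rewrite xG // mulr0 addr0; exact: le_trans (nrm_c0_val _ _) s1.
    rewrite sG // add0r nrmM.
    have -> : nrm ((-1) ^+ b : R[i]) = 1.
      by case: b {hb}; rewrite ?expr1 ?nrmN ?expr0 nrm1.
    by rewrite mul1r; exact: le_trans (nrm_c0_val _ _) x1.
  - rewrite linearD linearZ /= -natr1 mulrDl mul1r (le_trans _ hb) // lerD //.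
    by rewrite ler_pXn2r ?nnegrE ?nrm_ge0 // divr_ge0 // ltW.
have d2 : 0 < (d / 2) ^+ 2 by rewrite exprn_gt0 // divr_gt0.
have q0 : 0 <= nrm C ^+ 2 / (d / 2) ^+ 2 by rewrite divr_ge0 ?sqr_ge0 // ltW.
have [s [G [_ s1 hs]]] := grow (Num.bound (nrm C ^+ 2 / (d / 2) ^+ 2)).
have := archi_boundP q0; rewrite ltr_pdivrMr // => h.
have h2 : nrm (C s) ^+ 2 <= nrm C ^+ 2.
  rewrite ler_pXn2r ?nnegrE ?nrm_ge0 // (le_trans (nrm_op _ _)) //.
  by rewrite ler_piMr ?nrm_ge0.
by have := lt_le_trans h (le_trans hs h2); rewrite ltxx.
Qed.

(** A Hilbert space does not embed into [c0]; quantitatively, finitely many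
    coordinates of the [B l] suffice. Otherwise unit vectors that almost vanish
    on the relevant coordinates, added with suitable signs, have norm at least
    the square root of their number while their images stay bounded. *)
Lemma hilbert_to_c0_coordinates (n : nat) (B : nat -> operator H c0I)
    (D : nat -> operator H H) (C : R) :
  (forall h, nrm h <= C * \sum_(l < n) (nrm (B l h) + nrm (D l h))) ->
  exists (G : seq I) (C' : R), forall h, nrm h <=
    C' * \sum_(l < n) (nrm (D l h) + \sum_(i <- G) nrm (c0_val (B l h) i)).
Proof.
move=> hC; apply: contrapT => nG.
have unit (G : seq I) (d : R) : 0 < d -> exists h, [/\ nrm h = 1,
    forall l, (l < n)%N -> nrm (D l h) <= d &
    forall l i, (l < n)%N -> i \in G -> nrm (c0_val (B l h) i) <= d].
  move=> d0; have [h hh] : exists h, d^-1 * \sum_(l < n) (nrm (D l h) +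
      \sum_(i <- G) nrm (c0_val (B l h) i)) < nrm h.
    apply: contrapT => nx; apply: nG; exists G, d^-1 => h.
    by rewrite leNgt; apply/negP => hx; apply: nx; exists h.
  set s := \sum_(l < n) _ in hh.
  have G0 l : 0 <= \sum_(i <- G) nrm (c0_val (B l h) i).
    by apply: sumr_ge0 => i _; exact: nrm_ge0.
  have t0 l : 0 <= nrm (D l h) + \sum_(i <- G) nrm (c0_val (B l h) i).
    by rewrite addr_ge0 ?nrm_ge0.
  have tle l : (l < n)%N ->
      nrm (D l h) + \sum_(i <- G) nrm (c0_val (B l h) i) <= s.
    by move=> ln; rewrite /s (bigD1 (Ordinal ln)) //= lerDl sumr_ge0.
  have s0 : 0 <= s by apply: sumr_ge0.
  have nh : 0 < nrm h.
    by apply: le_lt_trans hh; rewrite mulr_ge0 ?invr_ge0 // ltW.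
  have sd : s <= d * nrm h by rewrite mulrC -ler_pdivrMr // mulrC ltW.
  have hV : 0 <= (nrm h)^-1 by rewrite invr_ge0 ltW.
  exists ((nrm h)^-1%:C%C *: h); split.
  - by rewrite nrmZR ger0_norm // mulVf // gt_eqF.
  - move=> l ln; rewrite linearZ /= nrmZR ger0_norm // mulrC ler_pdivrMr //.
    by have := tle l ln; have := G0 l; lra.
  - move=> l i ln iG; rewrite linearZ /= c0_valZ nrmM nrmR ger0_norm //.
    rewrite mulrC ler_pdivrMr //; have := tle l ln; have := nrm_ge0 (D l h).
    suff : nrm (c0_val (B l h) i) <= \sum_(i <- G) nrm (c0_val (B l h) i) by lra.
    rewrite (big_rem i) //= lerDl sumr_ge0 // => k _; exact: nrm_ge0.
have grow (d : R) N : 0 < d -> exists s, [/\ N%:R <= nrm s ^+ 2,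
    forall l, (l < n)%N -> nrm (D l s) <= N%:R * d &
    forall l, (l < n)%N -> nrm (B l s) <= nrm (B l) + N%:R * d].
  move=> d0; elim: N => [|N [s [hs Ds Bs]]].
    exists 0; split => [|l _|l _]; first by rewrite sqr_ge0.
      by rewrite linear0 nrm0 mul0r.
    by rewrite linear0 nrm0 mul0r addr0 nrm_ge0.
  have [G GP] := choice (fun l => c0_finite (B l s) d0).
  have [h [h1 Dh Bh]] := unit (flatten [seq G l | l <- iota 0 n]) d d0.
  have [b hb] := hilbert_sign hH s h.
  have sgn (V : normedModType R[i]) (x : V) : nrm ((-1) ^+ b *: x) = nrm x.
    by case: b {hb}; rewrite ?expr1 ?expr0 ?scaleN1r ?scale1r ?nrmN.
  exists (s + (-1) ^+ b *: h); split.
  - by rewrite (le_trans _ hb) // h1 expr1n -natr1 lerD2r.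
  - move=> l ln; rewrite linearD linearZ /= (le_trans (nrmD _ _)) // sgn.
    by rewrite -natr1 mulrDl mul1r lerD ?Ds ?Dh.
  - move=> l ln; have Nd : 0 <= N%:R * d by rewrite mulr_ge0 // ltW.
    apply: nrm_c0_le => [|i].
      by rewrite addr_ge0 ?nrm_ge0 // mulr_ge0 // ltW.
    rewrite linearD linearZ /= c0_valD c0_valZ (le_trans (nrmD _ _)) //.
    rewrite (sgn R[i] (c0_val (B l h) i)) -natr1 mulrDl mul1r.
    have [iG|iG] := boolP (i \in G l).
      have h2 : nrm (c0_val (B l h) i) <= d.
        apply: Bh => //; apply/flattenP; exists (G l) => //.
        by apply/mapP; exists l; rewrite ?mem_iota.
      by have := le_trans (nrm_c0_val (B l s) i) (Bs l ln); lra.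
    have h2 : nrm (c0_val (B l s) i) <= d.
      by rewrite leNgt; apply/negP => /ltW/GP; rewrite (negbTE iG).
    have h3 : nrm (c0_val (B l h) i) <= nrm (B l).
      by rewrite (le_trans (nrm_c0_val _ _)) // (le_trans (nrm_op _ _)) // h1 mulr1.
    lra.
pose K := `|C| * \sum_(l < n) (nrm (B l) + 2).
have K0 : 0 <= K.
  by rewrite mulr_ge0 // sumr_ge0 // => l _; rewrite addr_ge0 ?nrm_ge0.
have K20 : 0 <= K ^+ 2 by exact: sqr_ge0.
set N := Num.bound (K ^+ 2); have hN : K ^+ 2 < N%:R by exact: archi_boundP.
have N0 : (0 : R) < N%:R by exact: le_lt_trans hN.
have NV : (0 : R) < N%:R^-1 by rewrite invr_gt0.
have [s [hs Ds Bs]] := grow _ N NV.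
have sK : nrm s <= K.
  apply: (le_trans (hC s)); apply: (@le_trans _ _ (`|C| * \sum_(l < n)
      (nrm (B l s) + nrm (D l s)))).
    rewrite ler_wpM2r ?ler_norm // sumr_ge0 // => l _.
    by rewrite addr_ge0 ?nrm_ge0.
  rewrite ler_wpM2l //; apply: ler_sum => l _.
  have := Ds l (ltn_ord l); have := Bs l (ltn_ord l).
  rewrite divff ?gt_eqF //; lra.
have : nrm s ^+ 2 <= K ^+ 2 by rewrite ler_pXn2r ?nnegrE ?nrm_ge0.
by move=> /(le_trans hs); rewrite leNgt hN.
Qed.

End c0_and_hilbert.

(** * Sobczyk's theorem for [c0(I)] *)

Lemma finite_rank_below (K : choiceType) (A : set K) (f : K -> nat) n :
  {in A &, injective f} -> finite_set (A `&` [set k | (f k < n)%N]).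
Proof.
move=> inj; set B := _ `&` _.
have injB : {in B &, injective f}.
  by move=> x y /set_mem[Ax _] /set_mem[Ay _]; apply: inj; exact: mem_set.
have := inj_card_eq injB; rewrite card_eq_le => /andP[_ Bf].
apply: card_le_finite Bf _; apply: sub_finite_set (finite_II n).
by move=> _ [x [_ xn] <-].
Qed.

Section c0_embeddings.
Variables (R : realType) (I J : choiceType).
Variables (T : operator (c0 R I) (c0 R J)) (C0 : R).
Hypothesis C0_gt0 : 0 < C0.
Hypothesis TC0 : forall x, nrm x <= C0 * nrm (T x).

Local Notation entry i j := (c0_val (T (c0_unit R i)) j).

(** Two indices are adjacent if the images of their unit vectors have
    overlapping supports. The components of this graph are countable and [T] is
    a direct sum over them, so that the indices can be enumerated component by
    component. *)
Let adjacent : rel I :=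
  fun i i' => `[< exists j, entry i j != 0 /\ entry i' j != 0 >].

Let adjacent_sym i i' : adjacent i i' = adjacent i' i.
Proof.
by apply/asboolP/asboolP => -[j [h1 h2]]; exists j.
Qed.

Let component i : set I :=
  [set i' | exists2 p, path adjacent i p & last i p = i'].

Let component_refl i : component i i. Proof. by exists [::]. Qed.

Let component_trans i i' i'' :
  component i i' -> component i' i'' -> component i i''.
Proof.
move=> [p hp pi'] [q hq qi'']; exists (p ++ q).
  by rewrite cat_path hp pi'.
by rewrite last_cat pi'.
Qed.

Let component_sym i i' : component i i' -> component i' i.
Proof.
move=> [p]; elim: p i => [|k p IH] i /= => [_ <-|/andP[ik hp] pi'].
  exact: component_refl.
apply: component_trans (IH _ hp pi') _.
by exists [:: i] => //=; rewrite adjacent_sym ik.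
Qed.

Let component_eq i i' : component i i' -> component i = component i'.
Proof.
move=> h; apply/seteqP; split => k hk; apply: component_trans hk => //.
exact: component_sym.
Qed.

Let component_step i i' i'' j :
  component i i' -> entry i' j != 0 -> entry i'' j != 0 -> component i i''.
Proof.
move=> h h1 h2; apply: component_trans h _; exists [:: i''] => //=.
by rewrite andbT; apply/asboolP; exists j.
Qed.

Let columns i : set J :=
  [set j | exists2 i', component i i' & entry i' j != 0].

Let columns_eq i i' : component i i' -> columns i = columns i'.
Proof. by move=> h; rewrite /columns (component_eq h). Qed.

Lemma c0_support_countable (K : choiceType) (x : c0 R K) :
  countable [set k | c0_val x k != 0].
Proof.
have e0 n : 0 < (n.+1%:R^-1 : R) by rewrite invr_gt0.
have [G GP] := choice (fun n => c0_finite x (e0 n)).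
apply: (@sub_countable _ _ _ (\bigcup_n [set` G n])).
  apply: subset_card_le => k /= xk.
  have nx : 0 < nrm (c0_val x k) by rewrite nrm_gt0.
  have h : 0 <= (nrm (c0_val x k))^-1 by rewrite invr_ge0 ltW.
  exists (Num.bound (nrm (c0_val x k))^-1) => //=; apply: GP.
  rewrite -[leRHS]invrK lef_pV2 ?posrE ?invr_gt0 // ltW //.
  by apply: lt_trans (archi_boundP h) _; rewrite ltr_nat.
by apply: bigcup_countable => // n _; apply: finite_set_countable.
Qed.

(** A row of [T] is a functional on [c0], hence absolutely summable. *)
Let row_countable j : countable [set i | entry i j != 0].
Proof.
have [phi phiE] : exists phi : dual (c0 R I),
    forall x, phi x = c0_val (T x) j.
  have [f fE] := c0_coordinate R j.
  by exists (op_comp f T) => x; rewrite op_compE fE.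
have e0 n : 0 < (n.+1%:R^-1 : R) by rewrite invr_gt0.
have fin n : finite_set [set i | n.+1%:R^-1 <= nrm (entry i j)].
  apply: contrapT => inf.
  pose N := Num.bound (nrm phi * n.+1%:R).
  have [s [us sN sA]] : exists s : seq I, [/\ uniq s, size s = N &
      forall i, i \in s -> n.+1%:R^-1 <= nrm (entry i j)].
    elim: N => [|N [s [us sN sA]]]; first by exists [::].
    have [i [iA is_]] : exists i, n.+1%:R^-1 <= nrm (entry i j) /\ i \notin s.
      apply: contrapT => ni; apply: inf; apply: sub_finite_set (finite_seq s).
      move=> i iA /=; rewrite -[_ \in _]negbK; apply/negP => h.
      by apply: ni; exists i.
    exists (i :: s); split; rewrite /= ?is_ ?sN // => k.
    by rewrite inE => /orP[/eqP->|/sA].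
  have [u uP] := choice (fun i => phase (entry i j)).
  pose x := \sum_(i <- s) u i *: c0_unit R i.
  have xE k : c0_val x k = \sum_(i <- s) u i * (k == i)%:R.
    rewrite /x; elim: (s) => [|i r IH]; first by rewrite !big_nil.
    by rewrite !big_cons c0_valP IH c0_unitE.
  have x1 : nrm x <= 1.
    apply: nrm_c0_le => // k; rewrite xE.
    have [ks|ks] := boolP (k \in s).
      rewrite (bigD1_seq k) //= eqxx mulr1 big1 ?addr0 ?(uP k).1 // => i ik.
      by rewrite eq_sym (negbTE ik) mulr0.
    rewrite big1_seq ?nrm0 // => i /= is_; case: eqVneq => [ki|_].
      by rewrite -ki (negbTE ks) in is_.
    by rewrite mulr0.
  have phix : phi x = (\sum_(i <- s) nrm (entry i j))%:C%C.
    rewrite /x linear_sum rmorph_sum /=; apply: eq_bigr => i _.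
    by rewrite linearZ /= phiE scaleCE (uP i).2.
  have low : N%:R * n.+1%:R^-1 <= \sum_(i <- s) nrm (entry i j).
    rewrite -sN; elim: (s) sA => [|i r IH] sA; first by rewrite big_nil mul0r.
    rewrite big_cons /= -natr1 mulrDl mul1r addrC lerD ?sA ?mem_head //.
    by apply: IH => k kr; apply: sA; rewrite inE kr orbT.
  have := nrm_op phi x; rewrite phix nrmR ger0_norm; last first.
    by apply: sumr_ge0 => i _; exact: nrm_ge0.
  move=> /(le_trans low) h.
  have {}h : N%:R * n.+1%:R^-1 <= nrm phi.
    by apply: (le_trans h); rewrite ler_piMr ?nrm_ge0.
  rewrite ler_pdivrMr // leNgt archi_boundP // in h.
  by rewrite mulr_ge0 ?nrm_ge0.
apply: (@sub_countable _ _ _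
  (\bigcup_n [set i | n.+1%:R^-1 <= nrm (entry i j)])).
  apply: subset_card_le => k /= xk.
  have nx : 0 < nrm (entry k j) by rewrite nrm_gt0.
  have h : 0 <= (nrm (entry k j))^-1 by rewrite invr_ge0 ltW.
  exists (Num.bound (nrm (entry k j))^-1) => //=.
  rewrite -[leRHS]invrK lef_pV2 ?posrE ?invr_gt0 // ltW //.
  by apply: lt_trans (archi_boundP h) _; rewrite ltr_nat.
by apply: bigcup_countable => // n _; exact: finite_set_countable.
Qed.

Let component_countable i : countable (component i).
Proof.
pose N := fix N k : set I := if k is k'.+1 then
  \bigcup_(i' in N k') \bigcup_(j in [set j | entry i' j != 0])
    [set i'' | entry i'' j != 0] else [set i].
have Nc k : countable (N k).
  elim: k => [|k IH] /=; first exact: countable1.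
  apply: bigcup_countable => // i' _; apply: bigcup_countable => [|j _].
    exact: c0_support_countable.
  exact: row_countable.
apply: (@sub_countable _ _ _ (\bigcup_k N k)); last first.
  by apply: bigcup_countable => // k _; exact: Nc.
apply: subset_card_le => _ [p + <-].
elim/last_ind: p => [_|p k IH]; first by exists 0%N.
rewrite rcons_path last_rcons => /andP[/IH[n _ hn] /asboolP[j [h1 h2]]].
by exists n.+1 => //=; exists (last i p) => //; exists j.
Qed.

Let columns_countable i : countable (columns i).
Proof.
apply: (@sub_countable _ _ _
  (\bigcup_(i' in component i) [set j | entry i' j != 0])).
  by apply: subset_card_le => j [i' h1 h2]; exists i'.
by apply: bigcup_countable => // i' _; exact: c0_support_countable.
Qed.

(** The images of the unit vectors vanish on [columns i] outside the component
    of [i], and off [columns i] inside it. *)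
Let restrict_component i x : exists y : c0 R I,
  [/\ forall k, component i k -> c0_val y k = c0_val x k,
      forall j, columns i j -> c0_val (T y) j = c0_val (T x) j &
      forall j, ~ columns i j -> c0_val (T y) j = 0].
Proof.
have [P PE] := c0_restriction R (component i).
have coord j : exists phi : dual (c0 R I), forall x, phi x = c0_val (T x) j.
  have [f fE] := c0_coordinate R j.
  by exists (op_comp f T) => z; rewrite op_compE fE.
exists (P x); split => [k ik|j ij|j ij].
- by rewrite PE; case: asboolP.
- have [phi phiE] := coord j.
  apply/eqP; rewrite -subr_eq0 -!phiE -linearB /=; apply/eqP.
  apply: c0_functional_eq0 => k; rewrite c0_valB PE.
  case: asboolP => ik; first by rewrite subrr eqxx.
  move=> _; rewrite phiE; apply/eqP; rewrite -[_ == _]negbK; apply/negP => kj.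
  have [i' ii' i'j] := ij; apply: ik.
  exact: component_step ii' i'j kj.
- have [phi phiE] := coord j; rewrite -phiE.
  apply: c0_functional_eq0 => k; rewrite PE.
  case: asboolP => ik; last by rewrite eqxx.
  move=> _; rewrite phiE; apply/eqP; rewrite -[_ == _]negbK; apply/negP => kj.
  by apply: ij; exists k.
Qed.

Let C := 3 * C0.

Let rankJ : {f : set J -> J -> nat |
  forall A, countable A -> {in A &, injective (f A)}}.
Proof.
apply: cid; have ex (A : set J) : exists g : J -> nat,
    countable A -> {in A &, injective g}.
  have [/countable_injP[f hf]|nA] := pselect (countable A); first by exists f.
  by exists (fun=> 0%N).
by have [f fP] := choice ex; exists f.
Qed.

Let rankI : {f : set I -> I -> nat |
  forall A, countable A -> {in A &, injective (f A)}}.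
Proof.
apply: cid; have ex (A : set I) : exists g : I -> nat,
    countable A -> {in A &, injective g}.
  have [/countable_injP[f hf]|nA] := pselect (countable A); first by exists f.
  by exists (fun=> 0%N).
by have [f fP] := choice ex; exists f.
Qed.

(** On the columns of the component of [i], the weight is [C], lowered to
    [C / n.+1] on the first [n] of them. A coordinate functional dominated with
    a large [n] is small on every given column. *)
Let weight (n : nat) (i : I) (j : J) : R :=
  if `[< columns i j >] then
    (if (sval rankJ (columns i) j < n)%N then C / n.+1%:R else C) else 0.

Let C_gt0 : 0 < C. Proof. by rewrite mulr_gt0. Qed.

Let weight_ge0 n i j : 0 <= weight n i j.
Proof. by rewrite /weight; do 2?case: ifP => // _; rewrite ?divr_ge0 ?ltW. Qed.

Let weight_le n i j : weight n i j <= C.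
Proof.
rewrite /weight; case: ifP => _; last exact: ltW.
case: ifP => _; last exact: lexx.
by rewrite ler_pdivrMr // ler_peMr ?ler1n // ltW.
Qed.

Let weighted n i : exists W : operator (c0 R J) (c0 R J), forall y j,
  c0_val (W y) j = (weight n i j)%:C%C * c0_val y j.
Proof.
apply: (@c0_multiplier _ _ _ C) => j.
by rewrite nrmR ger0_norm ?weight_ge0 ?weight_le.
Qed.

Let W n i := sval (cid (weighted n i)).
Let WE n i y j : c0_val (W n i y) j = (weight n i j)%:C%C * c0_val y j.
Proof. exact: (svalP (cid (weighted n i))). Qed.

Let nrmWE n i y j :
  nrm (c0_val (W n i y) j) = weight n i j * nrm (c0_val y j).
Proof. by rewrite WE nrmM nrmR ger0_norm ?weight_ge0. Qed.

Let good n i := forall x, nrm (c0_val x i) <= nrm (W n i (T x)).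

Let good0 i : good 0 i.
Proof.
move=> x; have [y [y1 y2 y3]] := restrict_component i x.
rewrite -(y1 i (component_refl i)) (le_trans (nrm_c0_val _ _)) //.
rewrite (le_trans (TC0 y)) // -ler_pdivlMl //.
apply: nrm_c0_le => [|j]; first by rewrite mulr_ge0 ?nrm_ge0 ?invr_ge0 ?ltW.
have [ij|ij] := pselect (columns i j); last first.
  by rewrite y3 // nrm0 mulr_ge0 ?nrm_ge0 ?invr_ge0 ?ltW.
rewrite y2 // ler_pdivlMl //.
have := nrm_c0_val (W 0 i (T x)) j; rewrite nrmWE /weight.
case: asboolP => // _; rewrite ltn0 => h; apply: le_trans h.
rewrite ler_wpM2r ?nrm_ge0 // /C; have := C0_gt0; lra.
Qed.

(** If infinitely many indices were bad, two of the witnesses would have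
    images that are close on the finitely many coordinates of small weight;
    their difference contradicts the lower bound of [T]. *)
Let bad_finite n i : finite_set (component i `&` [set k | ~ good n k]).
Proof.
apply: contrapT => inf; set G := component i `&` _ in inf.
have wit k : G k -> exists x : c0 R I, [/\ nrm (c0_val x k) = 1,
    forall j, columns i j -> weight n i j * nrm (c0_val (T x) j) <= 1 &
    forall j, ~ columns i j -> c0_val (T x) j = 0].
  move=> [ik /existsNP[x /negP]]; rewrite -ltNge => hx.
  have [y [y1 y2 y3]] := restrict_component i x.
  have xk0 : 0 < nrm (c0_val x k) by exact: le_lt_trans (nrm_ge0 _) hx.
  exists ((nrm (c0_val x k))^-1%:C%C *: y); split.
  - rewrite c0_valZ y1 // nrmM nrmR ger0_norm ?invr_ge0 ?nrm_ge0 //.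
    by rewrite mulVf // gt_eqF.
  - move=> j ij; rewrite linearZ /= c0_valZ nrmM nrmR y2 //.
    rewrite ger0_norm ?invr_ge0 ?nrm_ge0 // mulrCA mulrC ler_pdivrMr // mul1r.
    have := nrm_c0_val (W n k (T x)) j; rewrite nrmWE.
    have -> : weight n k j = weight n i j by rewrite /weight (columns_eq ik).
    by move=> h; exact: le_trans h (ltW hx).
  - by move=> j ij; rewrite linearZ /= c0_valZ y3 // mulr0.
have wit' k : exists x : c0 R I, G k -> [/\ nrm (c0_val x k) = 1,
    forall j, columns i j -> weight n i j * nrm (c0_val (T x) j) <= 1 &
    forall j, ~ columns i j -> c0_val (T x) j = 0].
  have [/wit[x hx]|nGk] := pselect (G k); first by exists x.
  by exists 0.
have [x xP] := choice wit'.
pose A := [set j | columns i j /\ (sval rankJ (columns i) j < n)%N].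
have fA : finite_set A.
  apply: finite_rank_below; exact: (svalP rankJ) (columns_countable i).
have [sA hsA] : exists s : seq J, A = [set` s] by apply/finite_seqP.
pose Fil : set_system I := [set B | finite_set (G `\` B)].
have PF : ProperFilter Fil.
  split; first by rewrite /Fil /= setD0.
  split.
  - by rewrite /Fil /= setDT.
  - by move=> B1 B2 h1 h2; rewrite /Fil /= setDIr finite_setU.
  - move=> B1 B2 B12; apply: sub_finite_set => k [Gk nB]; split => //.
    by move=> /B12.
have [U [UU sU]] := ultraFilterLemma PF.
have UG : U G by apply: sU; rewrite /Fil /= setDv.
have UPF : ProperFilter U by exact: ultra_proper.
have wpos j : A j -> weight n i j = C / n.+1%:R.
  by move=> [h1 h2]; rewrite /weight; case: asboolP => // _; rewrite h2.
pose eta : R := Num.min (1/4) (1/(3 * C0)).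
have eta0 : 0 < eta by rewrite lt_min !divr_gt0 // mulr_gt0.
have eta1 : eta <= 1/4 by rewrite ge_min lexx.
have eta2 : eta * (3 * C0) <= 1.
  by rewrite -ler_pdivlMr ?mulr_gt0 // ge_min lexx orbT.
have [l lP] : exists l : J -> R[i], forall j, j \in sA ->
    U [set k | nrm (c0_val (T (x k)) j - l j) < eta].
  have lim j : exists l : R[i], j \in sA ->
      U [set k | nrm (c0_val (T (x k)) j - l) < eta].
    have [jA|jA] := boolP (j \in sA); last by exists 0.
    have Aj : A j by rewrite hsA.
    pose a k := if `[< G k >] then c0_val (T (x k)) j else 0.
    have [k|l al] := @ultra_lim R I U a (n.+1%:R / C) UU.
      rewrite /a; case: asboolP => Gk; last by rewrite nrm0 divr_ge0 // ltW.
      have [_ h _] := xP k Gk; have := h j Aj.1.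
      by rewrite wpos // ler_pdivlMr // mulrAC ler_pdivrMr // mul1r mulrC.
    exists l => _; move/nrm_cvgP : al => /(_ _ eta0) hU.
    apply: filterS (filterI UG hU) => k [Gk]; rewrite /a /=.
    by case: asboolP.
  by have [f fP] := choice lim; exists f.
have Ucl : U [set k | forall j, j \in sA ->
    nrm (c0_val (T (x k)) j - l j) < eta].
  elim: sA {hsA} lP => [|j s IH] lP; first exact: filterE.
  have h1 := lP j (mem_head _ _).
  have h2 := IH (fun j' h => lP j' (mem_behead (s := j :: s) h)).
  apply: filterS (filterI h1 h2) => k [a1 a2] j'.
  by rewrite inE => /orP[/eqP->|/a2].
have [k1 [Gk1 hk1]] := filter_ex (filterI UG Ucl).
have Usm : U [set k | nrm (c0_val (x k1) k) < eta].
  apply: sU; have [s hs] := c0_finite (x k1) eta0.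
  apply: sub_finite_set (finite_seq s) => k [_ /negP]; rewrite -leNgt.
  exact: hs.
have [k2 [[Gk2 hk2] sm]] := filter_ex (filterI (filterI UG Ucl) Usm).
have [a1 b1 c1] := xP _ Gk1; have [a2 b2 c2] := xP _ Gk2.
have low : 1 - eta <= nrm (x k2 - x k1).
  apply: le_trans (nrm_c0_val _ k2); rewrite c0_valB.
  have := nrm_ler_dist (c0_val (x k2) k2) (c0_val (x k1) k2); rewrite a2.
  by move: sm; rewrite /mkset; lra.
have up : nrm (T (x k2 - x k1)) <= 2 / C.
  have eta3 : 2 * eta <= 2 / C by rewrite ler_pdivlMr // /C; lra.
  apply: nrm_c0_le => [|j]; first by rewrite divr_ge0 // ltW.
  rewrite linearB /= c0_valB.
  have [ij|ij] := pselect (columns i j); last first.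
    by rewrite c1 // c2 // subrr nrm0 divr_ge0 // ltW.
  have [jA|jA] := boolP (j \in sA).
    have := nrm_dist (l j) (c0_val (T (x k2)) j) (c0_val (T (x k1)) j).
    rewrite [nrm (l j - _)]nrm_distC.
    by have := hk1 j jA; have := hk2 j jA; lra.
  have wC : weight n i j = C.
    rewrite /weight; case: asboolP => // _; case: ifP => // h.
    have : A j by []; rewrite hsA /= => jA'; by rewrite jA' in jA.
  have h1 := b1 j ij; have h2 := b2 j ij; rewrite wC in h1 h2.
  rewrite ler_pdivlMr // mulrC.
  have := nrmB (c0_val (T (x k2)) j) (c0_val (T (x k1)) j).
  by move=> h; have := ler_wpM2l (ltW C_gt0) h; lra.
have := TC0 (x k2 - x k1); have := ler_wpM2l (ltW C0_gt0) up.
have -> : C0 * (2 / C) = 2 / 3 by rewrite /C; field; rewrite gt_eqF.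
lra.
Qed.

Let levelP i : exists n, [/\ good n i, (n <= sval rankI (component i) i)%N &
  forall m, good m i -> (m <= sval rankI (component i) i)%N -> (m <= n)%N].
Proof.
pose P m := `[< good m i >] && (m <= sval rankI (component i) i)%N.
have P0 : exists m, P m by exists 0%N; rewrite /P leq0n andbT; exact/asboolP/good0.
have Pb m : P m -> (m <= sval rankI (component i) i)%N by move=> /andP[].
have [n /andP[/asboolP h1 h2] h3] := ex_maxnP P0 Pb.
exists n; split => // m h h'; apply: h3; rewrite /P h' andbT; exact/asboolP.
Qed.

Let level i := sval (cid (levelP i)).

(** The level [n] is the largest good one not above the rank of [i] in its
    component; it tends to infinity along each component, because only finitely
    many indices are bad for a given [n]. *)
Let level_finite i m : finite_set (component i `&` [set k | (level k < m)%N]).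
Proof.
have inj : {in component i &, injective (sval rankI (component i))}.
  exact: (svalP rankI) (component_countable i).
have f1 : finite_set
    (component i `&` [set k | (sval rankI (component i) k < m)%N]).
  exact: finite_rank_below.
have := bad_finite m i => f2.
apply: sub_finite_set (_ : finite_set (_ `|` _)); last first.
  by rewrite finite_setU; split; [exact: f1|exact: f2].
move=> k [ik /= km]; have [_ _ h] := svalP (cid (levelP k)).
have [gk|gk] := pselect (good m k); last by right.
left; split => //=; rewrite ltnNge; apply/negP => hm.
have mk : (m <= level k)%N by apply: h => //; rewrite -(component_eq ik).
by rewrite leqNgt km in mk.
Qed.

(** Sobczyk's theorem, for arbitrary index sets: the coordinate functionals on
    the range extend to functionals dominated by weights that tend to zero. *)
Lemma c0_left_inverse : exists S : operator (c0 R J) (c0 R I),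
  forall x, S (T x) = x.
Proof.
have ext i : exists phi : dual (c0 R J),
    (forall y, nrm (phi y) <= nrm (W (level i) i y)) /\
    (forall x, phi (T x) = c0_val x i).
  have [g _ _] := svalP (cid (levelP i)).
  have [|||psi [p1 p2]] := @hahn_banach_dual R (c0 R I) (c0 R J) setT
    (fun x => W (level i) i (T x)) (fun x => c0_val x i) 1 ler01 Logic.I
    (fun _ _ _ _ _ => Logic.I).
  - by move=> c x y; rewrite !linearP.
  - by move=> c x y; rewrite c0_valP.
  - by move=> x _; rewrite mul1r.
  exists (op_comp psi (W (level i) i)); split => [y|x]; rewrite op_compE.
    by rewrite (le_trans (p1 _)) // mul1r.
  exact: p2.
have [phi phiP] := choice ext.
have WC n i y : nrm (W n i y) <= C * nrm y.
  apply: nrm_c0_le => [|j]; first by rewrite mulr_ge0 ?nrm_ge0 // ltW.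
  rewrite nrmWE; apply: ler_pM; rewrite ?nrm_ge0 ?weight_ge0 ?weight_le //.
  exact: nrm_c0_val.
have ex y : exists x : c0 R I, forall i, c0_val x i = phi i y.
  apply: (@mk_c0 _ _ _ (C * nrm y)) => [i|e e0].
    exact: le_trans ((phiP i).1 y) (WC _ _ _).
  have e2C : 0 < e / 2 / C by rewrite !divr_gt0.
  have [Y hY] := c0_finite y e2C.
  have fin j : finite_set [set i | e / 2 <= weight (level i) i j * nrm y].
    have [[i0 h0]|none] := pselect (exists i0, columns i0 j); last first.
      apply: (@sub_finite_set _ _ set0) => // i /=.
      rewrite /weight; case: asboolP => hi; first by case: none; exists i.
      by rewrite mul0r; lra.
    pose m := maxn (sval rankJ (columns i0) j).+1 (Num.bound (2 * C * nrm y / e)).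
    apply: sub_finite_set (level_finite i0 m) => i /= hi.
    have ij : columns i j.
      apply: contrapT => ij; move: hi; rewrite /weight; case: asboolP => // _.
      by rewrite mul0r; lra.
    have i0i : component i0 i.
      have [i' h1 h2] := ij; have [i'' h3 h4] := h0.
      apply: component_trans (component_step h3 h4 h2) _.
      exact: component_sym.
    split => //=; rewrite ltnNge; apply/negP => hm.
    move: hm; rewrite geq_max => /andP[m1 m2].
    move: hi; rewrite /weight; case: asboolP => // _.
    rewrite -(columns_eq i0i) m1; apply/negP; rewrite -ltNge.
    have q0 : 0 <= 2 * C * nrm y / e.
      by rewrite divr_ge0 ?mulr_ge0 ?nrm_ge0 // ltW.
    have h : 2 * C * nrm y / e < (level i).+1%:R.
      by apply: lt_le_trans (archi_boundP q0) _; rewrite ler_nat ltnW.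
    rewrite ltr_pdivrMr // in h; rewrite mulrAC ltr_pdivrMr //.
    by rewrite [ltRHS]mulrAC ltr_pdivlMr // mulrC mulrA [ltRHS]mulrC.
  have : finite_set (\bigcup_(j in [set` Y])
      [set i | e / 2 <= weight (level i) i j * nrm y]).
    by apply: bigcup_finite => [|j _]; [exact: finite_seq|exact: fin].
  move=> /finite_seqP[G hG]; exists G => i hi.
  suff : [set` G] i by []. rewrite -hG.
  have [j hj] : exists j, e / 2 <= weight (level i) i j * nrm (c0_val y j).
    apply: contrapT => nj.
    have : nrm (W (level i) i y) <= e / 2.
      apply: nrm_c0_le => [|j]; first by lra.
      rewrite nrmWE leNgt; apply/negP => h; apply: nj; exists j; exact: ltW.
    have := le_trans hi ((phiP i).1 y); lra.
  exists j => /=.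
    apply: hY; rewrite ler_pdivrMr //; apply: (le_trans hj).
    by rewrite mulrC ler_wpM2l ?nrm_ge0.
  by apply: (le_trans hj); rewrite ler_wpM2l ?weight_ge0 // nrm_c0_val.
have [g gP] := choice ex.
have [||S SE] := @mk_operator _ (c0 R J) (c0 R I) g C.
- by move=> c x y; apply: c0_ext => i; rewrite c0_valP !gP linearP.
- move=> y; apply: nrm_c0_le => [|i]; first by rewrite mulr_ge0 ?nrm_ge0 // ltW.
  rewrite gP; exact: le_trans ((phiP i).1 y) (WC _ _ _).
by exists S => x; apply: c0_ext => i; rewrite SE gP (phiP i).2.
Qed.

End c0_embeddings.

(** * Sums of [c0(I)] and a Hilbert space *)

Lemma sum_sqr_le (R : realType) (n : nat) (a : nat -> R) :
  (\sum_(m < n) a m) ^+ 2 <= n%:R * \sum_(m < n) a m ^+ 2.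
Proof.
elim: n => [|n IH]; first by rewrite !big_ord0 expr0n mul0r.
rewrite !big_ord_recr /= -natr1; set s := \sum_(m < n) a m in IH *.
set t := \sum_(m < n) a m ^+ 2 in IH *; set b := a n.
have [n0|n0] := eqVneq (n%:R : R) 0.
  move: IH; rewrite n0 mul0r => h; have s0 : s = 0.
    by apply/eqP; rewrite -sqrf_eq0 eq_le h sqr_ge0.
  have t0 : 0 <= t by apply: sumr_ge0 => m _; exact: sqr_ge0.
  by rewrite s0; nra.
have np : 0 < (n%:R : R) by rewrite lt_def n0 ler0n.
have h1 : 0 <= (s - n%:R * b) ^+ 2 by exact: sqr_ge0.
have h2 := ler_wpM2l (ltW np) IH.
rewrite -(ler_pM2l np); nra.
Qed.

Section c0_plus_hilbert.
Variables (R : realType) (I : choiceType) (H F : completeNormedModType R[i]).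
Hypothesis hH : hilbert_space H.
Local Notation c0I := (c0 R I).

(** The functional [f] factors through [Phi] by the Hahn-Banach theorem. *)
Lemma rank_one_factor (X Y : completeNormedModType R[i]) (Phi : operator X F)
    (C : R) (y : Y) (f : dual X) :
  0 <= C -> (forall x, nrm x <= C * nrm (Phi x)) ->
  exists S : operator F Y, forall x, S (Phi x) = f x *: y.
Proof.
move=> C0 hC; have CC : 0 <= nrm f * C by rewrite mulr_ge0 ?nrm_ge0.
have [|||g [_ gf]] := @hahn_banach_dual R X F setT Phi f (nrm f * C) CC Logic.I
  (fun _ _ _ _ _ => Logic.I).
- by move=> c x z; rewrite linearP.
- by move=> c x z; rewrite linearP.
- move=> x _; rewrite (le_trans (nrm_op f x)) // -mulrA.
  by rewrite ler_wpM2l ?nrm_ge0.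
by exists (rank_one y g) => x; rewrite rank_oneE gf.
Qed.

(** The target [F] is a finite power of [c0 (+) H], of which only the
    coordinate operators matter. *)
Variables (n : nat) (A : nat -> operator F c0I) (D : nat -> operator F H) (K : R).
Hypothesis FK : forall y, nrm y <= K * \sum_(l < n) (nrm (A l y) + nrm (D l y)).

Let K1 := `|K| + 1.
Let K1_gt0 : 0 < K1. Proof. by rewrite ltr_wpDl. Qed.
Let FK1 y : nrm y <= K1 * \sum_(l < n) (nrm (A l y) + nrm (D l y)).
Proof.
apply: (le_trans (FK y)); rewrite ler_wpM2r //.
  by apply: sumr_ge0 => l _; rewrite addr_ge0 ?nrm_ge0.
by rewrite /K1; have := ler_norm K; lra.
Qed.

(** On the Hilbert space [H], the Hilbert coordinates of [Phi] together with
    finitely many scalar coordinates are jointly bounded below. *)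
Lemma hilbert_part_left_inverse (Phi : operator H F) (C : R) :
  0 <= C -> (forall h, nrm h <= C * nrm (Phi h)) ->
  exists S : operator F H, forall h, S (Phi h) = h.
Proof.
move=> C0 hC.
have [H0|] := pselect (forall u : H, u = 0).
  by exists 0 => h; rewrite [RHS]H0 op_zero.
move=> /existsNP[u /eqP u0]; have nu : 0 < nrm u by rewrite nrm_gt0.
have [|G [C' hC']] := @hilbert_to_c0_coordinates R I H hH n
    (fun l => op_comp (A l) Phi) (fun l => op_comp (D l) Phi) (C * K1).
  by move=> h; rewrite -mulrA (le_trans (hC h)) // ler_wpM2l //.
have coord l i : exists S : operator F H, forall h,
    S (Phi h) = c0_val (A l (Phi h)) i *: u.
  have [f fE] := c0_coordinate R i.
  by exists (rank_one u (op_comp f (A l))) => h; rewrite rank_oneE op_compE fE.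
have [Sc ScE] := choice (fun li : nat * I => coord li.1 li.2).
(* The coordinate functionals are turned into operators on [H] by means of the
   fixed nonzero vector [u]. *)
pose ops : seq (operator F H) := flatten
  [seq D l :: [seq Sc (l, i) | i <- G] | l <- iota 0 n].
pose Theta m := op_comp (nth 0 ops m) Phi.
pose N := size ops.
have bound h : nrm h <= `|C'| * (1 + (nrm u)^-1) * \sum_(m < N) nrm (Theta m h).
  have E : \sum_(m < N) nrm (Theta m h) = \sum_(S <- ops) nrm (S (Phi h)).
    by rewrite (big_nth 0) big_mkord.
  have E2 : \sum_(S <- ops) nrm (S (Phi h)) = \sum_(l < n)
      (nrm (D l (Phi h)) + \sum_(i <- G) nrm (c0_val (A l (Phi h)) i) * nrm u).
    rewrite big_flatten /= big_map -{1}[n]subn0 -/(index_iota 0 n) big_mkord.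
    apply: eq_bigr => l _; rewrite big_cons big_map; congr (_ + _).
    by apply: eq_bigr => i _; rewrite (ScE (_, _)) nrmZ.
  rewrite E E2; apply: (le_trans (hC' h)).
  apply: (@le_trans _ _ (`|C'| * \sum_(l < n) (nrm (D l (Phi h)) +
      \sum_(i <- G) nrm (c0_val (A l (Phi h)) i)))).
    rewrite ler_wpM2r ?ler_norm // sumr_ge0 // => l _.
    by rewrite addr_ge0 ?nrm_ge0 // sumr_ge0 // => i _; exact: nrm_ge0.
  rewrite -mulrA ler_wpM2l // mulr_sumr; apply: ler_sum => l _.
  rewrite mulrDr; have uV : 0 <= (nrm u)^-1 by rewrite invr_ge0 ltW.
  apply: lerD; first by rewrite ler_peMl ?nrm_ge0 // lerDl.
  rewrite -mulr_suml mulrCA ler_peMr //.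
    by apply: sumr_ge0 => i _; exact: nrm_ge0.
  by rewrite mulrDl mul1r mulVf ?gt_eqF //; lra.
have [|S SE] := @hilbert_left_inverse R H N Theta
    ((`|C'| * (1 + (nrm u)^-1)) ^+ 2 * N%:R) hH.
  move=> h; set c := `|C'| * _ in bound *.
  have c0 : 0 <= c by rewrite mulr_ge0 // addr_ge0 // invr_ge0 ltW.
  have s0 : 0 <= \sum_(m < N) nrm (Theta m h).
    by apply: sumr_ge0 => m _; exact: nrm_ge0.
  have h1 : nrm h ^+ 2 <= (c * \sum_(m < N) nrm (Theta m h)) ^+ 2.
    by rewrite ler_pXn2r ?nnegrE ?nrm_ge0 // mulr_ge0.
  apply: (le_trans h1); rewrite exprMn -(mulrA (c ^+ 2)).
  apply: ler_wpM2l; [exact: sqr_ge0|exact: (sum_sqr_le N (fun m => nrm (Theta m h)))].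
exists (\sum_(m < N) op_comp (S m) (nth 0 ops m)) => h.
by rewrite op_sum; rewrite -[RHS](SE h).
Qed.

(** Outside finitely many coordinates of [c0(I)], the Hilbert coordinates of
    [Phi] are negligible, so that the other ones embed [c0(I)] into a [c0]. *)
Lemma c0_part_left_inverse (Phi : operator c0I F) (C : R) :
  0 <= C -> (forall x, nrm x <= C * nrm (Phi x)) ->
  exists S : operator F c0I, forall x, S (Phi x) = x.
Proof.
move=> C0 hC.
pose d := (2 * (C * K1 + 1) * (n%:R + 1))^-1.
have CK : 0 < C * K1 + 1 by rewrite ltr_wpDl // mulr_ge0 // ltW.
have d0 : 0 < d by rewrite invr_gt0 !mulr_gt0 // ltr_wpDl.
have [G0 hG0] := choice (fun l =>
  c0_to_hilbert_small hH (op_comp (D l) Phi) d0).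
pose G := undup (flatten [seq G0 l | l <- iota 0 n]).
have hG l x : (l < n)%N -> (forall i, i \in G -> c0_val x i = 0) ->
    nrm (D l (Phi x)) <= d * nrm x.
  move=> ln xG; apply: hG0 => i iG; apply: xG; rewrite mem_undup.
  by apply/flattenP; exists (G0 l) => //; apply/mapP; exists l; rewrite ?mem_iota.
have off x : (forall i, i \in G -> c0_val x i = 0) ->
    nrm x <= 2 * (C * K1) * \sum_(l < n) nrm (A l (Phi x)).
  move=> xG; have h1 := hC x; have h2 := ler_wpM2l C0 (FK1 (Phi x)).
  rewrite big_split /= mulrA mulrDr in h2.
  have h3 : \sum_(l < n) nrm (D l (Phi x)) <= n%:R * (d * nrm x).
    rewrite -[n in n%:R]card_ord -sumr_const mulr_suml.
    by apply: ler_sum => l _; rewrite mul1r; exact: hG.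
  have CK0 : 0 <= C * K1 by rewrite mulr_ge0 // ltW.
  have h4 : C * K1 * (n%:R * (d * nrm x)) <= 1/2 * nrm x.
    rewrite !mulrA ler_wpM2r ?nrm_ge0 // /d ler_pdivrMr; last first.
      by rewrite !mulr_gt0 // ltr_wpDl.
    have : (0 : R) <= n%:R by []; nra.
  have h5 := ler_wpM2l CK0 h3; lra.
have [P PE] := c0_restriction R [set` G].
have P1 x i : i \in G -> c0_val (P x) i = c0_val x i.
  by move=> iG; rewrite PE; case: asboolP.
have P0 x i : i \notin G -> c0_val (P x) i = 0.
  by move=> iG; rewrite PE; case: asboolP => // h; rewrite h in iG.
have Psum x : P x = \sum_(i <- G) c0_val x i *: c0_unit R i.
  rewrite {1}(@c0_finite_sum _ _ G (P x)) ?undup_uniq //; last exact: P0.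
  by apply: eq_big_seq => i iG; rewrite P1.
(* The projection onto the finitely many exceptional coordinates has finite
   rank; adding it to the [A l] makes them jointly bounded below. *)
have [SP SPE] : exists S : operator F c0I, forall x, S (Phi x) = P x.
  have ex i : exists S : operator F c0I, forall x,
      S (Phi x) = c0_val x i *: c0_unit R i.
    have [f fE] := c0_coordinate R i.
    have [S SE] := rank_one_factor (c0_unit R i) f C0 hC.
    by exists S => x; rewrite SE fE.
  have [S SE] := choice ex.
  exists (\sum_(i <- G) S i) => x; rewrite op_sum Psum.
  by apply: eq_bigr => i _; rewrite SE.
have [W WE] := c0_assembly n.+1 (fun l => if (l < n)%N then A l else SP).
pose M := \sum_(l < n) nrm (op_comp (A l) Phi).
have M0 : 0 <= M by apply: sumr_ge0 => l _; exact: nrm_ge0.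
have CK0 : 0 <= C * K1 by rewrite mulr_ge0 // ltW.
pose C1 := 1 + 2 * (C * K1) * (n%:R + M).
have C1_gt0 : 0 < C1 by rewrite ltr_pwDl // !mulr_ge0 // addr_ge0.
have TC x : nrm x <= C1 * nrm (op_comp W Phi x).
  rewrite op_compE; set w := nrm (W _).
  have wA l : (l < n)%N -> nrm (A l (Phi x)) <= w.
    move=> ln; apply: nrm_c0_le => [|i]; first exact: nrm_ge0.
    have := nrm_c0_val (W (Phi x)) (i, l).
    by rewrite WE ltnS (ltnW ln) ln.
  have wP : nrm (P x) <= w.
    apply: nrm_c0_le => [|i]; first exact: nrm_ge0.
    have := nrm_c0_val (W (Phi x)) (i, n).
    by rewrite WE ltnSn ltnn SPE.
  have h := off (x - P x); rewrite -[x in nrm x](subrK (P x)).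
  apply: (le_trans (nrmD _ _)).
  have {}h := h (fun i iG => ltac:(by rewrite c0_valB P1 // subrr)).
  have h2 : \sum_(l < n) nrm (A l (Phi (x - P x))) <= n%:R * w + M * w.
    apply: (@le_trans _ _ (\sum_(l < n) (w + nrm (op_comp (A l) Phi) * w))).
      apply: ler_sum => l _; rewrite linearB linearB /=.
      apply: (le_trans (nrmB _ _)); apply: lerD; first exact: wA.
      rewrite (le_trans (nrm_op (op_comp (A l) Phi) (P x))) //.
      by rewrite ler_wpM2l ?nrm_ge0.
    rewrite big_split /= -mulr_suml lerD2r sumr_const card_ord.
    by rewrite mulr_natl.
  have CK2 : 0 <= 2 * (C * K1) by rewrite mulr_ge0.
  have h3 := ler_wpM2l CK2 h2; rewrite /C1; lra.
have [S SE] := c0_left_inverse C1_gt0 TC.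
by exists (op_comp S W) => x; rewrite op_compE -[RHS]SE.
Qed.

End c0_plus_hilbert.

(** A left inverse [S1] for the restriction to [c0(I)] gives a projection of [F]
    along which the restriction to [H] is still bounded below, with left inverse
    [S2]; the two combine like the inverse of a triangular matrix. *)
Lemma c0_hilbert_identity (R : realType) (I : choiceType)
    (H E F : completeNormedModType R[i]) (Psi : operator E F) (C : R)
    (n : nat) (pi : nat -> operator F E) (iota : nat -> operator E F) :
  hilbert_space H -> isomorphic E (c0 R I * H)%type -> 0 <= C ->
  (forall x, nrm x <= C * nrm (Psi x)) ->
  (forall y, y = \sum_(l < n) iota l (pi l y)) ->
  exists S : operator F E, forall x, S (Psi x) = x.
Proof.
move=> hH [U [V [UV VU]]] C0 hC piE.
have [p1 p1E] := fst_op (c0 R I) H; have [p2 p2E] := snd_op (c0 R I) H.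
have [j1 j1E] := pair_op (id_op (c0 R I)) (0 : operator (c0 R I) H).
have [j2 j2E] := pair_op (0 : operator H (c0 R I)) (id_op H).
pose p := op_comp p1 U; pose q := op_comp p2 U.
pose i1 := op_comp V j1; pose i2 := op_comp V j2.
have pi1 x : p (i1 x) = x by rewrite !op_compE VU p1E j1E.
have qi1 x : q (i1 x) = 0 by rewrite !op_compE VU p2E j1E.
have qi2 x : q (i2 x) = x by rewrite !op_compE VU p2E j2E.
have pi2 x : p (i2 x) = 0 by rewrite !op_compE VU p1E j2E.
have sum x : i1 (p x) + i2 (q x) = x.
  rewrite -[RHS]UV !op_compE -linearD /=; congr (V _).
  rewrite j1E j2E p1E p2E; case: (U x) => a b.
  by congr (_, _); rewrite ?addr0 ?add0r.
pose M := nrm i1 + nrm i2.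
have M0 : 0 <= M by rewrite addr_ge0 ?nrm_ge0.
have Esplit x : nrm x <= M * (nrm (p x) + nrm (q x)).
  rewrite -[x in nrm x]sum (le_trans (nrmD _ _)) //.
  have := nrm_op i1 (p x); have := nrm_op i2 (q x); rewrite /M.
  have := nrm_ge0 (p x); have := nrm_ge0 (q x).
  have := nrm_ge0 i1; have := nrm_ge0 i2; nra.
pose K := (\sum_(l < n) nrm (iota l)) * M.
have FK y : nrm y <= K * \sum_(l < n)
    (nrm (op_comp p (pi l) y) + nrm (op_comp q (pi l) y)).
  rewrite {1}(piE y) (le_trans (nrm_sum _ _ _)) // /K -mulrA.
  rewrite mulr_suml; apply: ler_sum => l _.
  rewrite (le_trans (nrm_op _ _)) // ler_wpM2l ?nrm_ge0 //.
  apply: (le_trans (Esplit _)); rewrite ler_wpM2l //.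
  rewrite [leRHS](bigD1 l) //= lerDl sumr_ge0 // => k _.
  by rewrite addr_ge0 ?nrm_ge0.
have [|S1 S1E] := c0_part_left_inverse hH
    (A := fun l => op_comp p (pi l)) (D := fun l => op_comp q (pi l)) FK
    (Phi := op_comp Psi i1)
    (C := nrm p * C) (mulr_ge0 (nrm_ge0 _) C0).
  move=> x; rewrite -[x in nrm x]pi1 (le_trans (nrm_op p _)) // -mulrA.
  by rewrite ler_wpM2l ?nrm_ge0.
pose Q := id_op F - op_comp (op_comp Psi i1) S1.
have QE y : Q y = y - Psi (i1 (S1 y)) by [].
have [|S2 S2E] := hilbert_part_left_inverse hH
    (A := fun l => op_comp p (pi l)) (D := fun l => op_comp q (pi l)) FK
    (Phi := op_comp Q (op_comp Psi i2))
    (C := nrm q * C) (mulr_ge0 (nrm_ge0 _) C0).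
  move=> h; set z := S1 (Psi (i2 h)).
  have qB x y : q (x - y) = q x - q y by rewrite linearB.
  have hE : h = q (i2 h - i1 z) by rewrite qB qi1 qi2 subr0.
  rewrite {1}hE (le_trans (nrm_op q _)) // -mulrA ler_wpM2l ?nrm_ge0 //.
  apply: (le_trans (hC _)); rewrite ler_wpM2l //.
  by rewrite op_compE QE op_compE -/z linearB.
pose T := op_comp S2 Q.
have T1 x : T (Psi (i1 x)) = 0.
  rewrite op_compE QE; have := S1E x; rewrite op_compE => ->.
  by rewrite subrr linear0.
have T2 h : T (Psi (i2 h)) = h by have := S2E h; rewrite !op_compE.
have TD a b : T (a + b) = T a + T b by rewrite linearD.
have S1D a b : S1 (a + b) = S1 a + S1 b by rewrite linearD.
have PsiD a b : Psi (a + b) = Psi a + Psi b by rewrite linearD.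
exists (op_comp i1 (S1 - op_comp S1 (op_comp Psi (op_comp i2 T))) +
  op_comp i2 T) => x.
have S1x : S1 (Psi (i1 (p x))) = p x by have := S1E (p x); rewrite op_compE.
have Tx : T (Psi x) = q x by rewrite -{1}(sum x) PsiD TD T1 T2 add0r.
have S1x' : S1 (Psi x) = p x + S1 (Psi (i2 (q x))).
  by rewrite -{1}(sum x) PsiD S1D S1x.
have E1 : (op_comp i1 (S1 - op_comp S1 (op_comp Psi (op_comp i2 T)))) (Psi x) =
    i1 (S1 (Psi x) - S1 (Psi (i2 (T (Psi x))))) by [].
by rewrite op_add E1 Tx S1x' addrK op_compE Tx sum.
Qed.

(** * Weakly compact operators and unconditional series *)

Section continuous_functions_toolkit.
Variables (R : realType) (K : topologicalType).
Local Notation CK := (cts R K).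
Implicit Types (f g : CK) (k : K).

Lemma cts_evalD f g k : cts_eval (f + g) k = cts_eval f k + cts_eval g k.
Proof. by []. Qed.

Lemma cts_evalB f g k : cts_eval (f - g) k = cts_eval f k - cts_eval g k.
Proof. by []. Qed.

Lemma cts_evalZ (c : R[i]) f k : cts_eval (c *: f) k = c * cts_eval f k.
Proof.
have -> : cts_eval (c *: f) k = c *: cts_eval f k by [].
exact: scaleCE.
Qed.

Lemma cts_eval0 k : cts_eval (0 : CK) k = 0.
Proof. by []. Qed.

Lemma cts_eval_sum (I : Type) (s : seq I) (F : I -> CK) k :
  cts_eval (\sum_(i <- s) F i) k = \sum_(i <- s) cts_eval (F i) k.
Proof.
by elim: s => [|i s IH]; rewrite ?big_nil // !big_cons cts_evalD IH.
Qed.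

Lemma cts_ext f g : (forall k, cts_eval f k = cts_eval g k) -> f = g.
Proof. by move=> h; do 2!apply: val_inj; apply/funext. Qed.

Lemma nrm_cts_eval f k : nrm (cts_eval f k) <= nrm f.
Proof. by rewrite -lecR !nrmE; exact: (ell_infty_norm_ub (csub_val f) k). Qed.

Lemma nrm_cts_le f (M : R) : 0 <= M -> (forall k, nrm (cts_eval f k) <= M) ->
  nrm f <= M.
Proof.
move=> M0 h; rewrite le_nrm; apply: sup_norm_le; first by rewrite lecR.
by move=> k _; rewrite -le_nrm; exact: h.
Qed.

Lemma cts_continuous f : continuous (cts_eval f).
Proof. by have /asboolP := csub_valP f. Qed.

Lemma mk_cts (f : K -> R[i]) (M : R) : continuous f ->
  (forall k, nrm (f k) <= M) -> exists g : CK, forall k, cts_eval g k = f k.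
Proof.
move=> fc fM; have fb : f \in @is_bounded R K.
  by apply/asboolP; exists M%:C%C => k _; rewrite -le_nrm.
have fC : EllInfty fb \in csub_pred (cts R K) by apply/asboolP.
by exists (CSub fC).
Qed.

Lemma cts_evaluation (k : K) : exists phi : dual CK, forall f, phi f = cts_eval f k.
Proof.
apply: (@mk_operator _ _ R[i] (fun f : CK => cts_eval f k) 1).
  by move=> c f g; rewrite cts_evalD cts_evalZ.
by move=> f; rewrite mul1r nrm_cts_eval.
Qed.

Lemma nrm_continuous (u : K -> R[i]) : continuous u ->
  continuous (fun k => nrm (u k)).
Proof.
move=> uc k; apply/cvgrPdist_lt => e e0.
have /nrm_cvgP/(_ e e0) := uc k; apply: filterS => k' h.
apply: le_lt_trans h; rewrite ler_norml.
have := nrm_ler_dist (u k') (u k); have := nrm_ler_dist (u k) (u k').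
rewrite (nrm_distC (u k)); lra.
Qed.

Lemma complex_continuous (u : K -> R) : continuous u ->
  continuous (fun k => (u k)%:C%C : R[i]).
Proof.
move=> uc k; apply/nrm_cvgP => e e0.
have /cvgrPdist_lt/(_ e e0) := uc k; apply: filterS => k'.
by rewrite -rmorphB nrmR distrC.
Qed.

Lemma nrm_mul_continuous (u v : K -> R[i]) : continuous u -> continuous v ->
  continuous (fun k => u k * v k).
Proof. by move=> uc vc k; apply: cvgM; [exact: uc|exact: vc]. Qed.

Lemma cts_multiplier (m : K -> R[i]) (M : R) : continuous m ->
  (forall k, nrm (m k) <= M) ->
  exists T : operator CK CK, forall f k,
    cts_eval (T f) k = m k * cts_eval f k.
Proof.
move=> mc mM.
have mfM f k : nrm (m k * cts_eval f k) <= `|M| * nrm f.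
  rewrite nrmM; apply: ler_pM; rewrite ?nrm_ge0 ?nrm_cts_eval //.
  exact: le_trans (mM k) (ler_norm M).
have ex f : exists g : CK, forall k, cts_eval g k = m k * cts_eval f k.
  apply: (@mk_cts (fun k => m k * cts_eval f k) (`|M| * nrm f)).
    exact: (nrm_mul_continuous mc (@cts_continuous f)).
  exact: mfM.
have [g gP] := choice ex.
have [||T TE] := @mk_operator _ CK CK g `|M|.
- move=> c x y; apply: cts_ext => k.
  by rewrite cts_evalD cts_evalZ !gP cts_evalD cts_evalZ; ring.
- move=> x; apply: nrm_cts_le => [|k]; first by rewrite mulr_ge0 ?nrm_ge0.
  rewrite gP; exact: mfM.
by exists T => f k; rewrite TE gP.
Qed.

Hypothesis Kc : compact [set: K].

Lemma ultra_limit_point (U : set_system nat) (u : nat -> K) :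
  UltraFilter U -> exists p : K, forall V, nbhs p V -> U (u @^-1` V).
Proof.
move=> UU; have [//|p [_ up]] := ultra_cvg_compact (f := u) UU Kc.
by exists p => V /up.
Qed.

Lemma ultra_limit_cts (V : topologicalType) (U : set_system nat)
    (u : nat -> K) p (f : K -> V) :
  (forall A, nbhs p A -> U (u @^-1` A)) -> continuous f ->
  (fun n => f (u n)) @ U --> f p.
Proof. by move=> up fc A /fc /up. Qed.

End continuous_functions_toolkit.

Section weakly_compact_operators.
Variables (R : realType) (E F : completeNormedModType R[i]).

Lemma weakly_compact_limit (W : operator E F) (U : set_system nat)
    (u : nat -> E) :
  weakly_compact W -> UltraFilter U -> (forall n, nrm (u n) <= 1) ->
  exists w, forall phi : dual F, (fun n => phi (W (u n))) @ U --> phi w.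
Proof.
move=> cW UU u1.
pose v n : weak_space F := W (u n).
have [|w [_ vw]] := ultra_cvg_compact (f := v) UU cW.
  move=> n; apply: subset_closure; exists (u n) => //=.
  by rewrite -[1](rmorph1 (real_complex R)) -le_nrm u1.
exists w => phi.
pose ev (x : weak_space F) : {ptws dual F -> R[i]} := fun f : dual F => f x.
have evc : continuous ev by exact: initial_continuous.
have h1 : (fun n => ev (v n)) @ U --> ev w.
  by move=> A /evc /vw.
move=> A hA; apply: (h1 (fun g : {ptws dual F -> R[i]} => A (g phi))).
exact: (@proj_continuous (dual F) (fun _ => R[i]) phi (ev w)).
Qed.

End weakly_compact_operators.

Section unconditional_series.
Variable R : realType.

Lemma sum_uniq_le (a : nat -> R) (s : seq nat) : (forall n, 0 <= a n) ->
  uniq s -> exists N, \sum_(i <- s) a i <= \sum_(0 <= i < N) a i.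
Proof.
move=> a0 us; exists (\max_(i <- s) i).+1; set N := _.+1.
have sN i : i \in s -> (i < N)%N by move=> is_; rewrite ltnS; exact: leq_bigmax_seq.
rewrite (perm_big [seq i <- index_iota 0 N | i \in s]); last first.
  apply: uniq_perm => //; first by rewrite filter_uniq ?iota_uniq.
  move=> i; rewrite mem_filter mem_index_iota.
  by case: (boolP (i \in s)) => //= /sN ->.
rewrite big_filter [leRHS](bigID (mem s)) /= lerDl.
by apply: sumr_ge0.
Qed.

Lemma bounded_sums_small (a : nat -> R) (M : R) : (forall n, 0 <= a n) ->
  (forall N, \sum_(0 <= i < N) a i <= M) ->
  forall e, 0 < e -> exists N, forall n, (N <= n)%N -> a n <= e.
Proof.
move=> a0 aM e e0; apply: contrapT => h.
have H N : exists n, (N <= n)%N /\ e < a n.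
  apply: contrapT => hN; apply: h; exists N => n Nn.
  by rewrite leNgt; apply/negP => hn; apply: hN; exists n.
have S k : exists N, k%:R * e <= \sum_(0 <= i < N) a i.
  elim: k => [|k [N hN]]; first by exists 0%N; rewrite mul0r big_geq.
  have [n [Nn hn]] := H N; exists n.+1.
  rewrite (big_cat_nat (n := N)) //=; last by rewrite leqW.
  rewrite -natr1 mulrDl mul1r lerD //.
  rewrite big_nat_recr //= (le_trans (ltW hn)) // lerDr.
  by apply: sumr_ge0.
have M0 : 0 <= M by have := aM 0%N; rewrite big_geq.
have [N hN] := S (Num.bound (M / e)).
have := le_trans hN (aM N); rewrite leNgt => /negP; apply.
by rewrite -ltr_pdivrMr // archi_boundP // divr_ge0 // ltW.
Qed.

Variable K : topologicalType.
Hypothesis Kc : compact [set: K].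
Local Notation CK := (cts R K).

(** The images of a weakly unconditionally Cauchy series tend to zero.
    Otherwise, choosing points [q n] where [W (g n)] is large and a cluster
    point [p] of them, a gliding hump yields a subseries whose weak sum is a
    continuous function [w] that separates the chosen points from [p], although
    they have a cluster point where [w] agrees with its value at [p]. *)
Lemma weakly_compact_unconditional (W : operator CK CK) (g : nat -> CK) (e : R) :
  weakly_compact W ->
  (forall k (s : seq nat), uniq s -> \sum_(n <- s) nrm (cts_eval (g n) k) <= 1) ->
  0 < e -> ~ (forall n, e <= nrm (W (g n))).
Proof.
move=> wW gs e0 hW.
pose z n := W (g n).
have gsum (c : nat -> R[i]) (s : seq nat) : uniq s -> (forall n, nrm (c n) <= 1) ->
    nrm (\sum_(n <- s) c n *: g n) <= 1.
  move=> us c1; apply: nrm_cts_le => // k; rewrite cts_eval_sum.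
  apply: le_trans (gs k s us); apply: le_trans (nrm_sum _ _ _) _.
  apply: ler_sum => n _; rewrite cts_evalZ nrmM ler_piMl ?nrm_ge0 //.
(* Unimodular coefficients turn the sum of the values at [x] into the sum of
   their absolute values. *)
have zsum x N : \sum_(0 <= n < N) nrm (cts_eval (z n) x) <= nrm W.
  have [u uP] := choice (fun n => phase (cts_eval (z n) x)).
  have h : cts_eval (W (\sum_(0 <= n < N) u n *: g n)) x =
      (\sum_(0 <= n < N) nrm (cts_eval (z n) x))%:C%C.
    rewrite linear_sum cts_eval_sum rmorph_sum /=; apply: eq_bigr => n _.
    by rewrite linearZ cts_evalZ (uP n).2.
  have := nrm_cts_eval (W (\sum_(0 <= n < N) u n *: g n)) x.
  rewrite h nrmR ger0_norm; last by apply: sumr_ge0 => n _; exact: nrm_ge0.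
  move=> /le_trans; apply; apply: (le_trans (nrm_op _ _)).
  rewrite ler_piMr ?nrm_ge0 //; apply: gsum; first exact: iota_uniq.
  by move=> n; rewrite (uP n).1.
have znull x (d : R) : 0 < d -> exists N, forall n, (N <= n)%N ->
    nrm (cts_eval (z n) x) <= d.
  exact: (bounded_sums_small (fun n => nrm_ge0 _) (zsum x)).
have pk n : exists k, e / 2 <= nrm (cts_eval (z n) k).
  apply: contrapT => h; have := hW n; rewrite leNgt => /negP; apply.
  apply: (@le_lt_trans _ _ (e / 2)); last by lra.
  apply: nrm_cts_le => [|k]; first lra.
  by rewrite leNgt; apply/negP => hk; apply: h; exists k; exact: ltW.
have [q qP] := choice pk.
have [U UU sU] := nat_ultra.
have [p pP] := ultra_limit_point Kc q UU.
pose d := e / 8; have d0 : 0 < d by rewrite divr_gt0.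
(* A new index is large enough for its function to be small at [p] and at the
   earlier points, and for its point to be close to [p] as seen by the earlier
   functions. *)
pose Q (h : seq nat) n := [/\ forall m, m \in h -> (m < n)%N,
  nrm (cts_eval (z n) p) <= d,
  forall m, m \in h ->
    nrm (cts_eval (z m) (q n) - cts_eval (z m) p) <= d * (1/2) ^+ (size h) &
  forall m, m \in h ->
    nrm (cts_eval (z n) (q m) - cts_eval (z n) p) <= d * (1/2) ^+ (size h)].
have UPF : ProperFilter U by exact: ultra_proper.
have forall_mem (h : seq nat) (P : nat -> nat -> Prop) :
    (forall m, U (P m)) -> U [set n | forall m, m \in h -> P m n].
  move=> UP; elim: h => [|m h IH]; first exact: filterE.
  apply: filterS (filterI (UP m) IH) => n [h1 h2] m'.
  by rewrite inE => /orP[/eqP->|/h2].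
have [|u uQ] := @history_choice _ Q.
  move=> h; have dh : 0 < d * (1/2) ^+ (size h).
    by rewrite mulr_gt0 // exprn_gt0 //; lra.
  have U1 := forall_mem h (fun m n => (m < n)%N) (fun m => sU _ (nbhs_infty_gt m)).
  have U2 : U [set n | nrm (cts_eval (z n) p) <= d].
    by have [N hN] := znull p d d0; apply: sU; exists N.
  have U3 := forall_mem h (fun m n =>
    nrm (cts_eval (z m) (q n) - cts_eval (z m) p) <= d * (1/2) ^+ (size h)).
  have {}U3 := U3 (fun m => ltac:(
    have /nrm_cvgP/(_ _ dh) := ultra_limit_cts pP (@cts_continuous _ _ (z m));
    apply: filterS => n; exact: ltW)).
  have U4 := forall_mem h (fun m n =>
    nrm (cts_eval (z n) (q m) - cts_eval (z n) p) <= d * (1/2) ^+ (size h)).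
  have {}U4 : U [set n | forall m, m \in h ->
      nrm (cts_eval (z n) (q m) - cts_eval (z n) p) <= d * (1/2) ^+ (size h)].
    apply: U4 => m; have dh2 : 0 < d * (1/2) ^+ (size h) / 2 by rewrite divr_gt0.
    have [N1 h1] := znull (q m) _ dh2; have [N2 h2] := znull p _ dh2.
    apply: sU; exists (maxn N1 N2) => // n /=; rewrite geq_max => /andP[n1 n2].
    apply: (le_trans (nrmB _ _)); have := h1 n n1; have := h2 n n2; lra.
  have [n [[[n1 n2] n3] n4]] := filter_ex (filterI (filterI (filterI U1 U2) U3) U4).
  by exists n.
have umono m n : (m < n)%N -> (u m < u n)%N.
  by move=> mn; have [h _ _ _] := uQ n; apply: h; exact: history_mem.
have close l m : (l < m)%N ->
    nrm (cts_eval (z (u l)) (q (u m)) - cts_eval (z (u l)) p) <= d * (1/2) ^+ m.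
  move=> lm; have [_ _ h _] := uQ m.
  by have := h _ (history_mem u lm); rewrite size_mkseq.
have close' l m : (m < l)%N ->
    nrm (cts_eval (z (u l)) (q (u m)) - cts_eval (z (u l)) p) <= d * (1/2) ^+ l.
  move=> ml; have [_ _ _ h] := uQ l.
  by have := h _ (history_mem u ml); rewrite size_mkseq.
have us N : uniq (mkseq u N).
  apply/mkseq_uniqP => m n _ _ umn; apply/eqP; have [h|h|//] := ltngtP m n.
    by have := umono _ _ h; rewrite umn ltnn.
  by have := umono _ _ h; rewrite umn ltnn.
have [w wP] : exists w : CK, forall phi : dual CK,
    (fun N => phi (W (\sum_(0 <= l < N) g (u l)))) @ U --> phi w.
  apply: weakly_compact_limit => // N.
  have -> : \sum_(0 <= l < N) g (u l) = \sum_(n <- mkseq u N) 1 *: g n.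
    rewrite big_map -[N in LHS]subn0 -/(index_iota 0 N).
    by rewrite /index_iota !subn0; apply: eq_bigr => l _; rewrite scale1r.
  by apply: gsum => // n; rewrite nrm1.
have wE x : (fun N => \sum_(0 <= l < N) cts_eval (z (u l)) x) @ U --> cts_eval w x.
  have [phi phiE] := cts_evaluation R x.
  rewrite -phiE (_ : (fun _ => _) =
    fun N => phi (W (\sum_(0 <= l < N) g (u l)))); first exact: wP.
  by apply/funext => N; rewrite phiE linear_sum cts_eval_sum.
have [p' p'P] := ultra_limit_point Kc (fun m => q (u m)) UU.
have zp' l : cts_eval (z (u l)) p' = cts_eval (z (u l)) p.
  apply: (nrm_cvg_unique U (ultra_limit_cts p'P (@cts_continuous _ _ (z (u l))))).
  apply/nrm_cvgP => r r0; have [N hN] := half_pow_small d r0.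
  apply: sU; exists (maxn N l.+1) => // m /=; rewrite geq_max => /andP[Nm lm].
  apply: le_lt_trans (close l m lm) _; apply: le_lt_trans hN.
  rewrite ler_wpM2l ?(ltW d0) // ler_wiXn2l //; lra.
have wpp' : cts_eval w p' = cts_eval w p.
  apply: (nrm_cvg_unique U (wE p')).
  rewrite (_ : (fun _ => _) = fun N => \sum_(0 <= l < N) cts_eval (z (u l)) p).
    exact: wE.
  by apply/funext => N; apply: eq_bigr => l _; exact: zp'.
have sep m : d <= nrm (cts_eval w (q (u m)) - cts_eval w p).
  rewrite -[leLHS]opprK lerNl; apply/ler_addgt0Pr => r r0.
  rewrite -lerBlDr.
  have : (fun N => \sum_(0 <= l < N) cts_eval (z (u l)) (q (u m)) -
      \sum_(0 <= l < N) cts_eval (z (u l)) p) @ U -->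
      cts_eval w (q (u m)) - cts_eval w p by apply: cvgB; exact: wE.
  move=> /nrm_cvgP/(_ r r0) h.
  have Um : U [set N | (m < N)%N] by apply: sU; exact: nbhs_infty_gt.
  have [N [/= h1 h2]] := filter_ex (filterI h Um).
  rewrite -sumrB in h1.
  pose a l := cts_eval (z (u l)) (q (u m)) - cts_eval (z (u l)) p.
  have h3 : nrm (\sum_(0 <= l < N | l != m) a l) <= 2 * d.
    apply: (le_trans (nrm_sum _ _ _)).
    apply: (@le_trans _ _ (\sum_(0 <= l < N) d * (1/2) ^+ l)).
      rewrite [leRHS](bigID (fun l => l != m)) /= -[leLHS]addr0 lerD //.
        apply: ler_sum => l lm; have [lt|gt|] := ltngtP l m.
        - apply: (le_trans (close l m lt)).
          by rewrite ler_wpM2l ?(ltW d0) // ler_wiXn2l ?(ltnW lt) //; lra.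
        - exact: close'.
        - by move=> E; rewrite E eqxx in lm.
      apply: sumr_ge0 => l _; rewrite mulr_ge0 ?(ltW d0) // exprn_ge0 //; lra.
    suff -> : \sum_(0 <= l < N) d * (1/2) ^+ l = d * (2 - 2 * (1/2) ^+ N).
      have : 0 <= d * (1/2 : R) ^+ N.
        by rewrite mulr_ge0 ?(ltW d0) // exprn_ge0 //; lra.
      lra.
    elim: (N) => [|j IH]; first by rewrite big_geq // expr0; lra.
    by rewrite big_nat_recr //= IH exprS; lra.
  have h4 : e / 2 - d <= nrm (a m).
    have := nrm_ler_dist (cts_eval (z (u m)) (q (u m))) (cts_eval (z (u m)) p).
    have := qP (u m); have [_ + _ _] := uQ m; rewrite /a; lra.
  have h5 : \sum_(0 <= l < N) a l = a m + \sum_(0 <= l < N | l != m) a l.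
    by rewrite (bigD1_seq m) ?mem_index_iota ?iota_uniq.
  have h6 := nrm_ler_dist (\sum_(0 <= l < N) a l) (cts_eval w (q (u m)) - cts_eval w p).
  have h7 : nrm (a m) - 2 * d <= nrm (\sum_(0 <= l < N) a l).
    rewrite h5 -[X in _ <= nrm (_ + X)]opprK.
    have := nrm_ler_dist (a m) (- \sum_(0 <= l < N | l != m) a l).
    rewrite nrmN; lra.
  have := h1; rewrite /d in h3 h4 h7 *; lra.
have := ultra_limit_cts p'P (@cts_continuous _ _ w).
move=> /nrm_cvgP/(_ d d0) h; have [m] := filter_ex h.
by rewrite wpp' ltNge sep.
Qed.

End unconditional_series.

(** * The Dunford-Pettis property of [C(K)] *)

Section truncation.
Variables (R : realType) (K : topologicalType).
Local Notation CK := (cts R K).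

Lemma cts_max_continuous (a b : K -> R) : continuous a -> continuous b ->
  continuous (fun k => Num.max (a k) (b k)).
Proof. by move=> ac bc k; exact: (continuous_max (ac k) (bc k)). Qed.

Fixpoint running_max (f : nat -> K -> R) i d k : R :=
  if d is d'.+1 then Num.max (running_max f i d' k) (f (i + d)%N k) else f i k.

Lemma running_max_continuous f i d : (forall n, continuous (f n)) ->
  continuous (running_max f i d).
Proof. by move=> fc; elim: d => //= d IH; exact: cts_max_continuous. Qed.

Lemma running_max_mono f i d d' k : (d <= d')%N ->
  running_max f i d k <= running_max f i d' k.
Proof.
elim: d' => [|d' IH]; first by rewrite leqn0 => /eqP ->.
rewrite leq_eqVlt => /orP[/eqP -> //|/IH h] /=.
by apply: (le_trans h); rewrite le_max lexx.
Qed.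

Lemma running_max_ge f i d n k : (i <= n <= i + d)%N ->
  f n k <= running_max f i d k.
Proof.
move=> /andP[h]; elim: d => [|d IH] /=.
  by rewrite addn0 => h'; rewrite (_ : n = i) //; apply/eqP; rewrite eqn_leq h h'.
by rewrite leq_eqVlt addnS ltnS => /orP[/eqP ->|/IH h']; rewrite le_max ?lexx ?h' ?orbT.
Qed.

Lemma running_max_le f i d k (M : R) :
  (forall n, (i <= n)%N -> f n k <= M) -> running_max f i d k <= M.
Proof.
by move=> fM; elim: d => [|d IH] /=; rewrite ?ge_max ?IH ?fM ?leq_addr.
Qed.

(** The radial truncation of [y] at height [r] changes [y] only by its excess
    over [r]. *)
Lemma cts_truncate (y : CK) (r : K -> R) : continuous r -> (forall k, 0 < r k) ->
  exists y' : CK, forall k,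
    [/\ nrm (cts_eval y' k) <= r k, nrm (cts_eval y' k) <= nrm (cts_eval y k) &
        nrm (cts_eval (y - y') k) <= Num.max 0 (nrm (cts_eval y k) - r k)].
Proof.
move=> rc r0; pose a k := nrm (cts_eval y k); pose m k := Num.max (r k) (a k).
have ac : continuous a := nrm_continuous (@cts_continuous _ _ y).
have mc : continuous m := cts_max_continuous rc ac.
have m0 k : 0 < m k by rewrite lt_max r0.
pose q k := r k / m k.
have qc : continuous q.
  move=> k; apply: cvgM; first exact: rc.
  by apply: cvgV; [rewrite gt_eqF|exact: mc].
have q0 k : 0 <= q k by rewrite divr_ge0 // ltW.
have q1 k : q k <= 1 by rewrite ler_pdivrMr // mul1r le_max lexx.
have [T TE] := @cts_multiplier R K (fun k => (q k)%:C%C) 1 (complex_continuous qc)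
  (fun k => ltac:(by rewrite nrmR ger0_norm)).
exists (T y) => k; rewrite cts_evalB TE.
have -> : cts_eval y k - (q k)%:C%C * cts_eval y k = (1 - q k)%:C%C * cts_eval y k.
  by rewrite rmorphB /= rmorph1; ring.
rewrite !nrmM !nrmR !ger0_norm ?subr_ge0 // -/(a k).
have a0 : 0 <= a k by exact: nrm_ge0.
have qa : q k * a k <= r k.
  rewrite /q mulrAC ler_pdivrMr // ler_wpM2l ?(ltW (r0 k)) //.
  by rewrite le_max lexx orbT.
split => //; first by rewrite ler_piMl.
have [h|h] := leP (a k) (r k).
  have -> : q k = 1 by rewrite /q /m (max_l h) divff // gt_eqF.
  by rewrite subrr mul0r le_max lexx.
rewrite le_max; apply/orP; right.
have -> : q k = r k / a k by rewrite /q /m (max_r (ltW h)).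
by rewrite mulrBl mul1r divfK // gt_eqF // (lt_trans (r0 k)).
Qed.

End truncation.

Section dunford_pettis.
Variables (R : realType) (K : topologicalType).
Hypothesis Kc : compact [set: K].
Local Notation CK := (cts R K).
Variable W : operator CK CK.
Hypothesis wW : weakly_compact W.

(** If the conclusion failed, one could choose increments of the increasing
    bounded sequence [h] dominating functions [g n] with [W (g n)] large; these
    increments telescope. *)
Lemma weakly_compact_increments (h : nat -> K -> R) (e : R) : 0 < e ->
  (forall m n k, (m <= n)%N -> h m k <= h n k) -> (forall n k, 0 <= h n k <= 1) ->
  exists m, forall n (g : CK), (m <= n)%N ->
    (forall k, nrm (cts_eval g k) <= h n k - h m k) -> nrm (W g) <= e.
Proof.
move=> e0 hmono h01; apply: contrapT => H.
have ex m : exists z : nat * CK, [/\ (m <= z.1)%N,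
    forall k, nrm (cts_eval z.2 k) <= h z.1 k - h m k & e <= nrm (W z.2)].
  apply: contrapT => Hm; apply: H; exists m => n g mn gh.
  rewrite leNgt; apply/negP => lt; apply: Hm; exists (n, g); split => //.
  exact: ltW.
have [z zP] := choice ex.
pose m n := iter n (fun m => (z m).1) 0%N.
apply: (weakly_compact_unconditional Kc (g := fun n => (z (m n)).2) wW _ e0).
  move=> k s us.
  have [N hN] := sum_uniq_le (a := fun n => nrm (cts_eval (z (m n)).2 k))
    (fun n => nrm_ge0 _) us.
  apply: (le_trans hN); apply: (@le_trans _ _ (h (m N) k - h 0%N k)).
    elim: N {hN} => [|N IH]; first by rewrite big_geq // subrr.
    rewrite big_nat_recr //=; have [_ /(_ k) + _] := zP (m N); lra.
  by have := h01 (m N) k; have := h01 0%N k; lra.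
by move=> n; have [] := zP (m n).
Qed.

(** The Dunford-Pettis property of [C(K)] for weakly compact operators. The
    running maxima [h i d] of the functions [|x n|], [i <= n <= i + d], increase
    with [d]; up to a small error under [W] the function [x N] may be cut down
    to the height of [h i (m i)] for every [i < N], and by compactness the
    infimum of these heights is uniformly small for large [N]. *)
Lemma weakly_compact_null (x : nat -> CK) (e : R) :
  (forall n, nrm (x n) <= 1) ->
  (forall k d, 0 < d -> exists N, forall n, (N <= n)%N ->
     nrm (cts_eval (x n) k) <= d) ->
  0 < e -> ~ (forall n, e <= nrm (W (x n))).
Proof.
move=> x1 x0 e0 hx.
pose f n k := nrm (cts_eval (x n) k).
have fc n : continuous (f n) := nrm_continuous (@cts_continuous _ _ (x n)).
have f1 n k : f n k <= 1 := le_trans (nrm_cts_eval _ _) (x1 n).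
pose h := running_max f.
have h01 i d k : 0 <= h i d k <= 1.
  rewrite running_max_le ?andbT // (le_trans (nrm_ge0 (cts_eval (x i) k))) //.
  by apply: (@running_max_ge _ _ f); rewrite leqnn leq_addr.
pose dl i := e / 8 * (1/2) ^+ i.
have dl0 i : 0 < dl i by rewrite mulr_gt0 ?exprn_gt0 //; lra.
have [m mP] := choice (fun i => @weakly_compact_increments (h i) (dl i) (dl0 i)
  (fun d d' k => @running_max_mono R K f i d d' k) (h01 i)).
pose H i := h i (m i).
have Hc i : continuous (H i) by exact: running_max_continuous.
pose eta := e / (8 * (nrm W + 1)).
have W0 : 0 < nrm W + 1 by rewrite ltr_wpDl ?nrm_ge0.
have eta0 : 0 < eta by rewrite divr_gt0 // mulr_gt0.
(* At every point the heights have infimum zero; by compactness finitely many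
   of them suffice for [eta]. *)
have [N hN] : exists N, forall k, exists2 i, (i < N)%N & H i k <= eta.
  apply: contrapT => hN.
  have ex N : exists k, forall i, (i < N)%N -> eta <= H i k.
    apply: contrapT => hk; apply: hN; exists N => k.
    apply: contrapT => hi; apply: hk; exists k => i iN.
    rewrite leNgt; apply/negP => lt; apply: hi; exists i => //; exact: ltW.
  have [q qP] := choice ex.
  have [U UU sU] := nat_ultra.
  have [p pP] := ultra_limit_point Kc q UU.
  have Hp i : eta <= H i p.
    rewrite leNgt; apply/negP => lt.
    have d0 : 0 < eta - H i p by rewrite subr_gt0.
    have /cvgrPdist_lt/(_ _ d0) h1 := ultra_limit_cts pP (@Hc i).
    have h2 : U [set n | (i < n)%N] by apply: sU; exact: nbhs_infty_gt.
    have [n [/= + /qP]] := filter_ex (filterI h1 h2).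
    by rewrite ltr_norml; lra.
  have eta2 : 0 < eta / 2 by rewrite divr_gt0.
  have [i hi] := x0 p _ eta2.
  have := Hp i; have : H i p <= eta / 2 by exact: running_max_le.
  lra.
have step i (y : CK) : exists y' : CK, forall k,
    [/\ nrm (cts_eval y' k) <= H i k + eta,
        nrm (cts_eval y' k) <= nrm (cts_eval y k) &
        nrm (cts_eval (y - y') k) <= Num.max 0 (nrm (cts_eval y k) - (H i k + eta))].
  apply: cts_truncate => k.
    by apply: cvgD; [exact: Hc|exact: cvg_cst].
  by have := h01 i (m i) k; rewrite /H; lra.
have [t tP] : exists t : nat -> CK -> CK, forall i y k,
    [/\ nrm (cts_eval (t i y) k) <= H i k + eta,
        nrm (cts_eval (t i y) k) <= nrm (cts_eval y k) &
        nrm (cts_eval (y - t i y) k) <=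
          Num.max 0 (nrm (cts_eval y k) - (H i k + eta))].
  have [t tP] := choice (fun z : nat * CK => step z.1 z.2).
  by exists (fun i y => t (i, y)) => i y; exact: (tP (i, y)).
(* The function [x N] is cut down to the heights one after another. *)
pose y := fix y i := if i is i'.+1 then t i' (y i') else x N.
have yx i k : nrm (cts_eval (y i) k) <= f N k.
  elim: i => [|i IH] //=; apply: le_trans IH; by have [] := tP i (y i) k.
have yr i j k : (i < j)%N -> nrm (cts_eval (y j) k) <= H i k + eta.
  elim: j => // j IH; rewrite ltnS leq_eqVlt => /orP[/eqP <-|/IH {}IH] /=.
    by have [] := tP i (y i) k.
  by apply: le_trans IH; have [] := tP j (y j) k.
have yW i : (i <= N)%N -> nrm (W (y i - y i.+1)) <= dl i.
  move=> iN; apply: (mP i (maxn (m i) (N - i))); first exact: leq_maxl.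
  move=> k; have [_ _ /= le] := tP i (y i) k; apply: (le_trans le).
  have h1 : h i (m i) k <= h i (maxn (m i) (N - i)) k.
    by apply: running_max_mono; exact: leq_maxl.
  have h2 : f N k <= h i (maxn (m i) (N - i)) k.
    by apply: running_max_ge; rewrite iN -leq_subLR leq_maxr.
  rewrite ge_max subr_ge0 h1 /=; have := yx i k; rewrite /H; lra.
have Wx i : (i <= N)%N -> nrm (W (x N)) <= nrm (W (y i)) + e / 4 * (1 - (1/2) ^+ i).
  elim: i => [|i IH] iN; first by rewrite expr0 subrr mulr0 addr0.
  apply: (le_trans (IH (ltnW iN))).
  have WD : W (y i) = W (y i.+1) + W (y i - y i.+1).
    by rewrite linearB /= addrC subrK.
  have := nrmD (W (y i.+1)) (W (y i - y i.+1)); rewrite -WD.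
  have := yW i (ltnW iN); rewrite /dl exprS; lra.
have yN : nrm (y N) <= 2 * eta.
  apply: nrm_cts_le => [|k]; first lra.
  have [i iN hi] := hN k; have := yr i N k iN; lra.
have WyN : nrm (W (y N)) <= e / 4.
  apply: (le_trans (nrm_op _ _)); apply: (@le_trans _ _ ((nrm W + 1) * (2 * eta))).
    by apply: ler_pM; rewrite ?nrm_ge0 ?lerDl.
  rewrite le_eqVlt; apply/orP; left; apply/eqP; rewrite /eta; field.
  by rewrite gt_eqF.
have := Wx N (leqnn N); have := hx N.
have : 0 < (1/2 : R) ^+ N by rewrite exprn_gt0 //; lra.
have : 0 < e / 4 by lra.
move=> e4 pN; have : 0 < e / 4 * (1/2) ^+ N by rewrite mulr_gt0.
lra.
Qed.

End dunford_pettis.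

(** * Weakly compact operators are strictly singular *)

Section weakly_compact_strictly_singular.
Variables (R : realType) (K : topologicalType).
Hypothesis Kc : compact [set: K].
Local Notation CK := (cts R K).

Lemma finitely_many_functions_net (ys : seq CK) (d : R) : 0 < d ->
  exists P : seq K, forall k, exists2 p, p \in P &
    forall y, y \in ys -> nrm (cts_eval y k - cts_eval y p) <= d.
Proof.
move=> d0; apply: contrapT => H.
have [h|u uP] := @history_choice K (fun h k => forall p, p \in h ->
    ~ forall y, y \in ys -> nrm (cts_eval y k - cts_eval y p) <= d).
  apply: contrapT => Hk; apply: H; exists h => k; apply: contrapT => Hp.
  by apply: Hk; exists k => p ph yh; apply: Hp; exists p.
have [U UU sU] := nat_ultra.
have [p pP] := ultra_limit_point Kc u UU.
have d2 : 0 < d / 2 by rewrite divr_gt0.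
have near : U [set n | forall y, y \in ys ->
    nrm (cts_eval y (u n) - cts_eval y p) <= d / 2].
  elim: (ys) => [|y s IH]; first exact: filterE.
  have hy := ultra_limit_cts pP (@cts_continuous _ _ y).
  have /nrm_cvgP/(_ _ d2) {}hy := hy.
  apply: filterS (filterI hy IH) => n [h1 h2] y'.
  by rewrite inE => /orP[/eqP->|/h2 //]; exact: ltW.
have [m hm] := filter_ex near.
have Um : U [set n | (m < n)%N] by apply: sU; exact: nbhs_infty_gt.
have [n [hn /= mn]] := filter_ex (filterI near Um).
apply: (uP n (u m) (history_mem u mn)) => y yys.
apply: (le_trans (nrm_dist (cts_eval y p) _ _)).
by rewrite [leRHS]splitr lerD ?hn // nrm_distC hm.
Qed.

Lemma net_error_le (M N : nat) (a b : R) : (N <= M)%N -> a <= b -> 0 <= a ->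
  (3 ^+ M - 1) * (1/8) ^+ M * a <= 2 * b * (1/2) ^+ N.
Proof.
move=> NM ab a0; have b0 := le_trans a0 ab.
have p3 : (3 ^+ M - 1) * (1/8) ^+ M <= (1/2) ^+ N :> R.
  apply: (@le_trans _ _ ((1/2) ^+ M)); last by rewrite ler_wiXn2l //; lra.
  apply: (@le_trans _ _ (3 ^+ M * (1/8) ^+ M)).
    by rewrite ler_wpM2r ?exprn_ge0 //; lra.
  by rewrite -exprMn; apply: lerXn2r; rewrite ?nnegrE; lra.
have p0 : 0 <= (1/2 : R) ^+ N by rewrite exprn_ge0 //; lra.
apply: (@le_trans _ _ ((1/2) ^+ N * b)).
  apply: (@le_trans _ _ ((1/2) ^+ N * a)); first exact: ler_wpM2r.
  exact: ler_wpM2l.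
by rewrite mulrC ler_wpM2r //; lra.
Qed.

Variable W : operator CK CK.
Hypothesis wW : weakly_compact W.

(** A cluster point [w] of the functions [W (x n)] vanishes on all the finite
    sets [P m]. It is also a norm limit of linear combinations of these
    functions, whose coefficients are controlled by their norm, so that the
    values of a combination are almost attained on a set [P m]. *)
Lemma gliding_cluster_point (x : nat -> CK) (P : nat -> seq K) :
  (forall n, nrm (W (x n)) = 1) ->
  (forall m n p, (m < n)%N -> p \in P m -> cts_eval (W (x n)) p = 0) ->
  (forall n, exists2 p, p \in P n & 1/2 <= nrm (cts_eval (W (x n)) p)) ->
  (forall n k, exists2 p, p \in P n & forall i, (i <= n)%N ->
    nrm (cts_eval (W (x i)) k - cts_eval (W (x i)) p) <= (1/8) ^+ n) ->
  forall (sg : nat -> nat) (U : set_system nat) (w : CK) (c : R[i]),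
    UltraFilter U -> \oo `<=` U -> (forall n, (n <= sg n)%N) ->
    (forall phi : dual CK, (fun n => phi (W (c *: x (sg n)))) @ U --> phi w) ->
    w = 0.
Proof.
move=> Wx1 Wx0 Wxp net sg U w c UU sU sgn wP.
pose y n := W (x n).
have yE n : W (c *: x (sg n)) = c *: y (sg n) by rewrite linearZ.
have UPF : ProperFilter U by exact: ultra_proper.
have wp m p : p \in P m -> cts_eval w p = 0.
  move=> pP; have [phi phiE] := cts_evaluation R p.
  have := wP phi; rewrite phiE => h; apply: (nrm_cvg_unique U h).
  apply/nrm_cvgP => d d0; apply: sU; exists m.+1 => // n /= mn.
  rewrite yE phiE cts_evalZ (Wx0 m) ?mulr0 ?subrr ?nrm0 //.
  exact: leq_trans mn (sgn n).
(* At a point of [P i] where [y i] is at least 1/2, the later functions vanish,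
   and the [i]-th coefficient is expressed through the earlier ones. *)
have coef n (a : nat -> R[i]) i : (i < n)%N ->
    nrm (a i) <= 2 * 3 ^+ i * nrm (\sum_(0 <= j < n) a j *: y j).
  set u := \sum_(0 <= j < n) _.
  have [m] := ubnP i; elim: m i => // m IH i im in_.
  have [p pP yp] := Wxp i.
  have up : cts_eval u p = \sum_(0 <= j < i) a j * cts_eval (y j) p
      + a i * cts_eval (y i) p.
    have yj j : cts_eval (a j *: y j) p = a j * cts_eval (y j) p := cts_evalZ _ _ _.
    rewrite /u cts_eval_sum (eq_bigr _ (fun j _ => yj j)).
    rewrite (big_cat_nat (leq0n i.+1) in_) big_nat_recr //.
    rewrite [X in _ + _ + X = _]big1_seq ?[LHS]addr0 // => j /andP[_].
    rewrite mem_index_iota => /andP[ij _].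
    by rewrite (Wx0 i) ?mulr0.
  have s1 : nrm (\sum_(0 <= j < i) a j * cts_eval (y j) p) <= (3 ^+ i - 1) * nrm u.
    apply: (le_trans (nrm_sum _ _ _)).
    apply: (@le_trans _ _ (\sum_(0 <= j < i) 2 * 3 ^+ j * nrm u)).
      rewrite !big_seq; apply: ler_sum => j; rewrite mem_index_iota => /= ji.
      rewrite nrmM (@le_trans _ _ (nrm (a j))) //.
        by rewrite ler_piMr ?nrm_ge0 // -(Wx1 j) nrm_cts_eval.
      by apply: IH; [exact: leq_trans ji _|exact: ltn_trans ji _].
    elim: (i) => [|q IHq]; first by rewrite big_geq // expr0 subrr mul0r.
    rewrite big_nat_recr //= exprS; lra.
  have h1 : nrm (a i * cts_eval (y i) p) <= nrm u + (3 ^+ i - 1) * nrm u.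
    have -> : a i * cts_eval (y i) p = cts_eval u p
        - \sum_(0 <= j < i) a j * cts_eval (y j) p by rewrite up; ring.
    by apply: (le_trans (nrmB _ _)); rewrite lerD // nrm_cts_eval.
  have h2 : nrm (a i) * (1/2) <= nrm (a i * cts_eval (y i) p).
    by rewrite nrmM ler_wpM2l ?nrm_ge0.
  lra.
have dense d : 0 < d -> exists2 u, span_seq y u & nrm (w - u) < d.
  move=> d0; apply: contrapT => h.
  have [|f [fw fy]] := @separating_functional _ _ _ w d (span_seq_linear y) d0.
    move=> u uy; rewrite leNgt; apply/negP => lt; apply: h; exists u => //.
  have := wP f; rewrite fw => f1.
  have f0 : (fun n => f (W (c *: x (sg n)))) @ U --> (0 : R[i]).
    apply/nrm_cvgP => r r0; apply: filterE => n.
    rewrite yE fy ?subrr ?nrm0 //.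
    have [y0 yL] := span_seq_linear y.
    by rewrite -[_ *: _]addr0; apply: yL => //; exact: span_seq_mem.
  have /eqP : (1 : R[i]) = 0 by apply: (nrm_cvg_unique U f1 f0).
  by rewrite oner_eq0.
apply: cts_ext => k; apply/eqP; rewrite cts_eval0 -nrm_eq0 eq_le nrm_ge0 andbT.
apply/ler_addgt0Pr => d d0; rewrite add0r.
pose d' := Num.min (d / 3) 1.
have d'0 : 0 < d' by rewrite lt_min ltr01 divr_gt0.
have [d'd d'1] : d' <= d / 3 /\ d' <= 1.
  by split; rewrite /d' ge_min lexx ?orbT.
have [_ [n [a ->]] hu] := dense d' d'0.
have [N hN] := half_pow_small (2 * (nrm w + 1)) d'0.
(* Padding the combination with zeros makes the net [P M] fine in comparison
   with the bound on the coefficients. *)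
rewrite (span_seq_pad y a (leq_maxl n N)) in hu.
move: hu; set b := fun j => _; set M := maxn n N => hu.
set u := \sum_(_ <= _ < _) _ in hu.
have [p pP hp] := net M k.
have nu : nrm u <= nrm w + 1.
  by have := nrm_ler_dist u w; rewrite nrm_distC; lra.
have up : nrm (cts_eval u p) <= d'.
  have -> : cts_eval u p = - cts_eval (w - u) p.
    by rewrite cts_evalB (wp M p pP) sub0r opprK.
  by rewrite nrmN (le_trans (nrm_cts_eval _ _)) // ltW.
have ukp : nrm (cts_eval u k - cts_eval u p) <= d'.
  rewrite !cts_eval_sum -sumrB; apply: (le_trans (nrm_sum _ _ _)).
  apply: (@le_trans _ _ (\sum_(0 <= j < M) 2 * 3 ^+ j * nrm u * (1/8) ^+ M)).
    rewrite !big_seq; apply: ler_sum => j; rewrite mem_index_iota => /= jM.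
    rewrite !cts_evalZ -mulrBr nrmM; apply: ler_pM; rewrite ?nrm_ge0 //.
      exact: coef.
    by apply: hp; exact: ltnW.
  rewrite -mulr_suml -mulr_suml.
  have -> : \sum_(0 <= j < M) 2 * 3 ^+ j = 3 ^+ M - 1 :> R.
    elim: (M) => [|q IHq]; first by rewrite big_geq // expr0 subrr.
    by rewrite big_nat_recr //= IHq exprS; ring.
  apply: le_trans (ltW hN).
  rewrite mulrAC; exact: net_error_le (leq_maxr _ _) nu (nrm_ge0 _).
have wu : nrm (cts_eval w k - cts_eval u k) <= d'.
  by rewrite -cts_evalB (le_trans (nrm_cts_eval _ _)) // ltW.
have := nrm_ler_dist (cts_eval w k) (cts_eval u k).
have := nrm_ler_dist (cts_eval u k) (cts_eval u p).
lra.
Qed.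

(** On an infinite-dimensional subspace where [W] is bounded below, there is a
    sequence [x n] whose images have norm one and no weak cluster point other
    than 0. Point evaluations factor through [W] on that subspace, so [x n]
    tends to 0 pointwise, against the Dunford-Pettis property. *)
Lemma weakly_compact_strictly_singular : strictly_singular W.
Proof.
apply: contrapT => /not_strictly_singularP[X [lX nX [e e0 he]]].
pose Q (h : seq (CK * seq K)) (z : CK * seq K) := [/\ X z.1 /\ nrm (W z.1) = 1,
  forall z' p, z' \in h -> p \in z'.2 -> cts_eval (W z.1) p = 0,
  exists2 p, p \in z.2 & 1/2 <= nrm (cts_eval (W z.1) p) &
  forall k, exists2 p, p \in z.2 & forall x, x \in z.1 :: map fst h ->
    nrm (cts_eval (W x) k - cts_eval (W x) p) <= (1/8) ^+ size h].
have [h|z zQ] := @history_choice _ Q.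
  have [ev evE] := choice (cts_evaluation R (K := K)).
  pose fs := [seq op_comp (ev p) W | p <- flatten (map snd h)].
  have [x [Xx xfs] x0] := infinite_dimensional_neq0
    (infinite_dimensional_joint_kernel (fs := fs) lX nX).
  have Wx0 : 0 < nrm (W x).
    by apply: lt_le_trans (he x Xx); rewrite mulr_gt0 // nrm_gt0.
  pose c : R[i] := (nrm (W x))^-1%:C%C.
  have Wc : W (c *: x) = c *: W x by rewrite linearZ.
  have nc : nrm (W (c *: x)) = 1.
    by rewrite Wc nrmZR ger0_norm ?invr_ge0 ?mulVf ?gt_eqF // ltW.
  have [P PP] := finitely_many_functions_net
    (map W ((c *: x) :: map fst h)) (d := (1/8) ^+ size h)
    (ltac:(by rewrite exprn_gt0 //; lra)).
  have [k hk] : exists k, 1/2 <= nrm (cts_eval (W (c *: x)) k).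
    apply: contrapT => hk; have : nrm (W (c *: x)) <= 1/2.
      apply: nrm_cts_le => [|k]; first by rewrite divr_ge0.
      by rewrite leNgt; apply/negP => lt; apply: hk; exists k; exact: ltW.
    by rewrite nc leNgt ltr_pdivrMr // mul1r ltr1n.
  exists (c *: x, k :: P); split => /=.
  - by split => //; rewrite -[_ *: _]addr0; apply: lX.2 => //; exact: lX.1.
  - move=> z' p z'h pz'; rewrite Wc cts_evalZ -evE.
    have -> : ev p (W x) = op_comp (ev p) W x by [].
    rewrite xfs ?mulr0 //; apply: map_f; apply/flattenP; exists z'.2 => //.
    exact: map_f.
  - by exists k => //; rewrite inE eqxx.
  - move=> k'; have [p pP hp] := PP k'; exists p; first by rewrite inE pP orbT.
    by move=> x' hx'; apply: hp; exact: (map_f W).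
pose x n := (z n).1; pose P n := (z n).2.
have zh m n : (m < n)%N -> z m \in mkseq z n by exact: history_mem.
have Wx1 n : nrm (W (x n)) = 1 by have [[]] := zQ n.
have Xx n : X (x n) by have [[]] := zQ n.
have cl := @gliding_cluster_point x P Wx1.
have {}cl : forall (sg : nat -> nat) (U : set_system nat) (w : CK) (c : R[i]),
    UltraFilter U -> \oo `<=` U -> (forall n, (n <= sg n)%N) ->
    (forall phi : dual CK, (fun n => phi (W (c *: x (sg n)))) @ U --> phi w) ->
    w = 0.
  apply: cl.
  - by move=> m n p mn pm; have [_ h _ _] := zQ n; apply: h pm; exact: zh.
  - by move=> n; have [] := zQ n.
  - move=> n k; have [_ _ _ /(_ k)[p pP hp]] := zQ n; exists p => // i.
    rewrite size_mkseq in hp; rewrite leq_eqVlt => /orP[/eqP ->|iN]; apply: hp.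
      by rewrite inE eqxx.
    by rewrite inE; apply/orP; right; exact: (map_f fst (zh _ _ iN)).
have ex1 n : nrm (e%:C%C *: x n) <= 1.
  by rewrite nrmZR (ger0_norm (ltW e0)) -(Wx1 n) he.
apply: (@weakly_compact_null R K Kc W wW (fun n => e%:C%C *: x n) e ex1 _ e0).
  move=> k d d0; apply: contrapT => hN.
  have sgP N : exists n, (N <= n)%N /\ d < nrm (cts_eval (e%:C%C *: x n) k).
    apply: contrapT => hn; apply: hN; exists N => n Nn.
    by rewrite leNgt; apply/negP => lt; apply: hn; exists n.
  have [sg sgE] := choice sgP.
  have evL (c : R[i]) f g :
      cts_eval (c *: f + g) k = c * cts_eval f k + cts_eval g k.
    by rewrite cts_evalD cts_evalZ.
  have evW f : X f -> nrm (cts_eval f k) <= e^-1 * nrm (W f).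
    move=> Xf; rewrite ler_pdivlMl //; apply: le_trans (he f Xf).
    by rewrite ler_wpM2l ?(ltW e0) // nrm_cts_eval.
  have [psi [_ psiE]] := @hahn_banach_dual R CK CK X W
    (fun f => cts_eval f k) e^-1 (ltac:(by rewrite invr_ge0 ltW)) lX.1 lX.2
    (fun c f g => linearP W c f g)
    evL evW.
  have [U UU sU] := nat_ultra.
  have [w wP] := weakly_compact_limit wW UU (fun n => ex1 (sg n)).
  have w0 : w = 0 by apply: (cl sg U w e%:C%C) => // n; have [] := sgE n.
  have psi0 : psi w = 0 by rewrite w0 linear0.
  have := wP psi; rewrite psi0 => /nrm_cvgP/(_ d d0) hU.
  have [n /=] := filter_ex hU.
  rewrite psiE; last by rewrite -[_ *: _]addr0; apply: lX.2 => //; exact: lX.1.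
  rewrite subr0; have [_ h] := sgE n; lra.
move=> n; have -> : W (e%:C%C *: x n) = e%:C%C *: W (x n) by rewrite linearZ.
by rewrite nrmZR (ger0_norm (ltW e0)) Wx1 mulr1.
Qed.

End weakly_compact_strictly_singular.

(** * Weak multiplications *)

Section perfect_compact_spaces.
Variables (R : realType) (K : topologicalType).
Hypotheses (Kc : compact [set: K]) (Kh : hausdorff_space K)
  (Ki : isolated [set: K] = set0).
Local Notation CK := (cts R K).

Lemma closed_seq (h : seq K) : closed [set k | k \in h].
Proof.
have /accessible_finite_set_closed h1 := hausdorff_accessible Kh.
by apply: h1; exact: finite_seq.
Qed.

Lemma open_not_finite (O : set K) (k0 : K) (h : seq K) : open O -> O k0 ->
  exists2 k, O k & k \notin h.
Proof.
move=> oO Ok0; apply: contrapT => H.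
have Oh k : O k -> k \in h.
  by move=> Ok; apply/negPn/negP => kh; apply: H; exists k.
have : isolated [set: K] k0.
  split; first by rewrite inE.
  exists (O `&` ~` [set k | k \in rem k0 (undup h)]).
    apply: open_nbhs_nbhs; split; last first.
      by split => //; rewrite /= mem_rem_uniq ?undup_uniq // inE eqxx.
    by apply: openI => //; apply: closed_openC; exact: closed_seq.
  rewrite setIT; apply/seteqP; split => k; last first.
    by move=> ->; split => //; rewrite /= mem_rem_uniq ?undup_uniq // inE eqxx.
  move=> [/Oh kh]; rewrite /= mem_rem_uniq ?undup_uniq // inE mem_undup kh andbT.
  by move=> /negP/negPn/eqP.
by rewrite Ki.
Qed.

Lemma cts_separation (A : set K) (k : K) : closed A -> ~ A k ->
  exists f : CK, cts_eval f k = 1 /\ forall x, A x -> cts_eval f x = 0.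
Proof.
move=> cA Ak.
have crs := @normal_completely_regular R K (compact_normal Kh Kc) (hausdorff_accessible Kh).
have /(@uniform_separatorP _ R)[f [fc f01 f0 f1]] := crs k A cA Ak.
have [||g gE] := @mk_cts R K (fun x => (1 - f x)%:C%C) 1.
- by apply: complex_continuous => x; apply: cvgB; [exact: cvg_cst|exact: fc].
- move=> x; rewrite nrmR.
  have /f01 /= : range f (f x) by exists x.
  by rewrite in_itv /= ler_norml; lra.
exists g; split => [|x Ax]; rewrite gE.
  by have -> : f k = 0 by [apply: f0; exists k]; rewrite subr0.
have -> : f x = 1 by apply: f1; exists x.
by rewrite subrr.
Qed.

(** A nonempty open set is infinite; functions separating one of its points from
    the previous ones form a triangular sequence. *)
Lemma infinite_dimensional_supported (O : set K) (k0 : K) : open O -> O k0 ->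
  infinite_dimensional [set f : CK | forall k, ~ O k -> cts_eval f k = 0].
Proof.
move=> oO Ok0.
pose Q (h : seq (K * CK)) (z : K * CK) := [/\ O z.1, cts_eval z.2 z.1 = 1,
  forall k, ~ O k -> cts_eval z.2 k = 0 &
  forall z', z' \in h -> cts_eval z.2 z'.1 = 0].
have [h|z zQ] := @history_choice _ Q.
  have [k Ok kh] := open_not_finite (map fst h) oO Ok0.
  have [||f [fk f0]] := @cts_separation (~` O `|` [set x | x \in map fst h]) k.
  - by apply: closedU; [exact: open_closedC|exact: closed_seq].
  - by move=> [|/=] //; apply/negP.
  exists (k, f); split => //= [k' Ok'|z' z'h]; apply: f0; first by left.
  by right; exact: (map_f fst).
apply: (@infinite_dimensional_triangular _ _ _ (fun n => (z n).2)
  (fun n f => cts_eval f (z n).1)) => [n|n c u v|m n mn|n].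
- by have [] := zQ n.
- by rewrite cts_evalD cts_evalZ.
- by have [_ _ _ h] := zQ n; exact: h (history_mem z mn).
- by have [_ -> _ _] := zQ n; exact: oner_neq0.
Qed.

End perfect_compact_spaces.

Section weak_multiplications.
Variables (R : realType) (K : topologicalType).
Hypotheses (Kc : compact [set: K]) (Kh : hausdorff_space K)
  (Ki : isolated [set: K] = set0).
Local Notation CK := (cts R K).

Lemma compact_bounded_cts (f : K -> R[i]) : continuous f ->
  exists M : R, forall k, nrm (f k) <= M.
Proof.
move=> fc; apply: contrapT => H.
have ex (n : nat) : exists k, n%:R <= nrm (f k).
  apply: contrapT => h; apply: H; exists n%:R => k.
  by rewrite leNgt; apply/negP => lt; apply: h; exists k; exact: ltW.
have [u uP] := choice ex; have [U UU sU] := nat_ultra.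
have [p pP] := ultra_limit_point Kc u UU.
have /nrm_cvgP/(_ 1 ltr01) h1 := ultra_limit_cts pP fc.
pose N := Num.bound (nrm (f p) + 1).
have h2 : U [set n | (N < n)%N] by apply: sU; exact: nbhs_infty_gt.
have [n [/= lt Nn]] := filter_ex (filterI h1 h2).
have := nrm_ler_dist (f (u n)) (f p); have := uP n.
have : N%:R <= n%:R :> R by rewrite ler_nat ltnW.
have : nrm (f p) + 1 < N%:R by rewrite archi_boundP // addr_ge0 ?nrm_ge0.
lra.
Qed.

Lemma conj_continuous (f : CK) : continuous (fun k => (cts_eval f k)^*).
Proof.
move=> k; apply/nrm_cvgP => e e0.
have /nrm_cvgP/(_ e e0) := @cts_continuous _ _ f k; apply: filterS => k'.
by rewrite -rmorphB /= /nrm norm_conjC.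
Qed.

Variables (n : nat) (g : nat -> CK).

(** The coefficients are [conj (g j) / h] with [h] the sum of the [|g j|^2]. *)
Lemma cts_partition : (forall k, exists2 j, (j < n)%N & cts_eval (g j) k != 0) ->
  exists A : nat -> operator CK CK, exists a : nat -> CK,
    (forall j f k, cts_eval (A j f) k = cts_eval (a j) k * cts_eval f k) /\
    (forall k, \sum_(j < n) cts_eval (a j) k * cts_eval (g j) k = 1).
Proof.
move=> g0.
have exB j : exists B : operator CK CK, forall f k,
    cts_eval (B f) k = (cts_eval (g j) k)^* * cts_eval f k.
  apply: (cts_multiplier (M := nrm (g j)) (@conj_continuous (g j))) => k.
  by rewrite /nrm norm_conjC; exact: nrm_cts_eval.
have [B BE] := choice exB.
pose h := \sum_(j < n) B j (g j).
have hE k : cts_eval h k = \sum_(j < n) (cts_eval (g j) k)^* * cts_eval (g j) k.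
  by rewrite cts_eval_sum; apply: eq_bigr => j _; rewrite BE.
have h0 k : cts_eval h k != 0.
  have [j jn gj] := g0 k; rewrite hE; apply/negP => /eqP s0.
  have /psumr_eq0P/(_ s0)/(_ (Ordinal jn) isT)/eqP : forall i : 'I_n,
      true -> 0 <= (cts_eval (g i) k)^* * cts_eval (g i) k.
    by move=> i _; rewrite mulrC mul_conjC_ge0.
  by rewrite mulf_eq0 conjC_eq0 orbb => /eqP g0k; rewrite /= g0k eqxx in gj.
have hc : continuous (fun k => (cts_eval h k)^-1).
  by move=> k; apply: cvgV => //; exact: cts_continuous.
have [M hM] := compact_bounded_cts hc.
have [I IE] := cts_multiplier hc hM.
have [|one oneE] := @mk_cts R K (fun=> 1) 1 (fun k => cvg_cst _).
  by move=> k; rewrite nrm1.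
exists (fun j => op_comp I (B j)), (fun j => I (B j one)); split.
  by move=> j f k; rewrite op_compE !IE !BE oneE mulr1 mulrA.
move=> k; have := mulVf (h0 k); rewrite {2}hE mulr_sumr => <-; apply: eq_bigr => j _.
by rewrite IE BE oneE mulr1 mulrA.
Qed.

Variables (S : nat -> operator CK CK) (C : R).
Hypothesis Sss : forall j, (j < n)%N -> strictly_singular (S j).

(** Near a common zero of the [g j], functions of small support would be almost
    annihilated by all multiplications by [g j], and, on a further
    infinite-dimensional subspace, by all [S j]. *)
Lemma weak_multiplications_no_common_zero (T : nat -> operator CK CK) :
  (forall j f k, cts_eval (T j f) k =
     cts_eval (g j) k * cts_eval f k + cts_eval (S j f) k) ->
  (forall f, nrm f <= C * \sum_(j < n) nrm (T j f)) ->
  forall k, exists2 j, (j < n)%N & cts_eval (g j) k != 0.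
Proof.
have arith (c m : R) : 0 <= c -> 0 <= m -> c * m * 2 < 4 * ((c + 1) * (m + 1)).
  by move=> c0 m0; have := mulr_ge0 c0 m0; lra.
move=> TE TC k0; apply: contrapT => H.
have gk0 j : (j < n)%N -> cts_eval (g j) k0 = 0.
  move=> jn; apply/eqP; rewrite -[_ == _]negbK; apply/negP => gj.
  by apply: H; exists j.
have D0 : 0 < (`|C| + 1) * (n%:R + 1) by rewrite mulr_gt0 // ltr_wpDl.
pose d := (4 * ((`|C| + 1) * (n%:R + 1)))^-1.
have d0 : 0 < d by rewrite invr_gt0 mulr_gt0.
have nb : nbhs k0 [set k | forall j, (j < n)%N -> nrm (cts_eval (g j) k) < d].
  elim: (n) gk0 => [|m IH] gk0; first exact: filterE.
  have gm : cts_eval (g m) @ k0 --> (0 : R[i]).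
    by rewrite -(gk0 m (ltnSn m)); exact: cts_continuous.
  have /nrm_cvgP/(_ d d0) {}gm := gm.
  have {}IH := IH (fun j jm => gk0 j (ltnW jm)).
  apply: filterS (filterI gm IH) => k [h1 h2] j.
  rewrite ltnS leq_eqVlt => /orP[/eqP ->|/h2 //].
  by rewrite subr0 in h1.
set N := [set k | _] in nb.
have nW := @infinite_dimensional_supported R K Kc Kh Ki _ k0
  (@open_interior _ N) nb.
set W := [set f | _] in nW.
have lW : linear_subspace W.
  split=> [k _|c f1 f2 h1 h2 k Ok]; first exact: cts_eval0.
  by rewrite cts_evalD cts_evalZ h1 ?h2 // mulr0 addr0.
have [W' [_ nW' sW' hW']] := strictly_singular_family Sss lW nW d0.
have [f Wf f0] := infinite_dimensional_neq0 nW'.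
have nf : 0 < nrm f by rewrite nrm_gt0.
have Tf j : (j < n)%N -> nrm (T j f) <= 2 * d * nrm f.
  move=> jn; apply: nrm_cts_le => [|k]; first by rewrite !mulr_ge0 // ltW.
  rewrite TE (le_trans (nrmD _ _)) // -mulrA mulr2n mulrDl !mul1r lerD //.
    rewrite nrmM; have [Ok|nOk] := pselect (N° k).
      apply: ler_pM; rewrite ?nrm_ge0 ?nrm_cts_eval // ltW //.
      exact: (interior_subset Ok).
    by rewrite (sW' f Wf k nOk) nrm0 mulr0 mulr_ge0 // ltW.
  exact: le_trans (nrm_cts_eval _ _) (hW' f Wf j jn).
have B : \sum_(j < n) nrm (T j f) <= n%:R * (2 * d * nrm f).
  rewrite -[n in n%:R * _]card_ord -sumr_const mulr_suml.
  by apply: ler_sum => j _; rewrite mul1r Tf.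
have B0 : 0 <= \sum_(j < n) nrm (T j f).
  by apply: sumr_ge0 => j _; exact: nrm_ge0.
have C0 := normr_ge0 C; have n0 : (0 : R) <= n%:R by [].
have := le_trans (TC f) (ler_wpM2r B0 (ler_norm C)).
move=> /le_trans/(_ (ler_wpM2l C0 B)).
rewrite leNgt => /negP; apply.
rewrite /d; set D := _ * _ in D0 *.
rewrite [ltLHS](_ : _ = `|C| * n%:R * 2 / (4 * D) * nrm f); last by ring.
rewrite -[ltRHS]mul1r (ltr_pM2r nf) ltr_pdivrMr ?mul1r /D; last by rewrite mulr_gt0.
exact: arith.
Qed.

End weak_multiplications.

Section weak_multiplication_spaces.
Variable R : realType.

Lemma strictly_singular_isometry (E F G : completeNormedModType R[i])
    (U : operator E F) (V : operator F E) (S : operator F G) :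
  cancel U V -> (forall x, nrm (U x) = nrm x) -> strictly_singular S ->
  strictly_singular (op_comp S U).
Proof.
move=> UV Un; apply: contraPP => /not_strictly_singularP[X [[X0 XL] nX [e e0 he]]].
apply/not_strictly_singularP; exists (U @` X); split.
- split; first by exists 0; rewrite // linear0.
  move=> c _ _ [x Xx <-] [y Xy <-]; exists (c *: x + y); first exact: XL.
  by rewrite linearP.
- move=> [s hs]; apply: nX; exists (map V s) => x Xx.
  have [|c cE] := hs (U x); first by exists x.
  exists c; rewrite -(UV x) cE linear_sum size_map; apply: eq_bigr => j _.
  by rewrite linearZ (nth_map 0).
- by exists e => // _ [x Xx <-]; rewrite Un; exact: he.
Qed.

Variables (E : completeNormedModType R[i]) (K : topologicalType).
Hypotheses (Kc : compact [set: K]) (Kh : hausdorff_space K)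
  (Ki : isolated [set: K] = set0).
Local Notation CK := (cts R K).
Hypothesis wm : forall T : operator CK CK, weak_multiplication T.
Variables (L : set (operator E E)).
Hypothesis Llin : left_ideal L.
Hypothesis Lrank1 : forall x (f : dual E), L (rank_one x f).

(** The operators are carried to [C(K)], where they are multiplications by
    functions [g j] up to strictly singular operators; a combination of the
    multiplications with coefficients in [C(K)] is the identity. *)
Lemma weak_multiplication_identity (n : nat) (T : nat -> operator E E) (C : R) :
  isometrically_isomorphic E CK -> (forall j, (j < n)%N -> L (T j)) ->
  (forall x, nrm x <= C * \sum_(j < n) nrm (T j x)) -> L (id_op E).
Proof.
move=> [U [Un Us]] LT TC; have [L0 LD LM] := Llin.
have {}Un x : nrm (U x) = nrm x by rewrite /nrm Un.
have [||V UV VU] := @inverse_operator R E CK U 1.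
- by move=> x; rewrite mul1r Un.
- by move=> y; have [x _ <-] : range U y by [rewrite Us]; exists x.
have Vn f : nrm (V f) = nrm f by rewrite -{2}(VU f) Un.
pose T' j := op_comp (op_comp U (T j)) V.
have [g gP] := choice (fun j => wm (T' j)); have [S SP] := choice gP.
have Sss j : strictly_singular (S j).
  by apply: weakly_compact_strictly_singular => //; have [] := SP j.
have T'E j f k : cts_eval (T' j f) k =
    cts_eval (g j) k * cts_eval f k + cts_eval (S j f) k.
  by have [_ ->] := SP j.
have T'C f : nrm f <= C * \sum_(j < n) nrm (T' j f).
  rewrite -(Vn f) (le_trans (TC _)) // le_eqVlt; apply/orP; left; apply/eqP.
  by congr (_ * _); apply: eq_bigr => j _; rewrite /T' !op_compE Un.
have g0 := weak_multiplications_no_common_zero Kc Kh Ki (fun j _ => Sss j) T'E T'C.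
have [A [a [AE a1]]] := cts_partition Kc g0.
pose Q := op_comp V (op_comp (\sum_(j < n) op_comp (A j) (S j)) U).
have Qss : strictly_singular Q.
  pose M := \sum_(j < n) nrm (A j).
  apply: (@strictly_singular_dominated _ _ _ _ n (fun j => op_comp (S j) U) _ M).
    by move=> j _; exact: (strictly_singular_isometry UV Un).
  move=> x; rewrite /Q !op_compE Vn op_sum (le_trans (nrm_sum _ _ _)) // mulr_sumr.
  apply: ler_sum => j _; rewrite !op_compE (le_trans (nrm_op _ _)) //.
  rewrite ler_wpM2r ?nrm_ge0 // /M (bigD1 j) //= lerDl.
  by apply: sumr_ge0 => i _; exact: nrm_ge0.
apply: (fredholm_identity Llin Lrank1 Qss).
have -> : id_op E + Q = \sum_(j < n) op_comp (op_comp V (op_comp (A j) U)) (T j).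
  apply: op_ext => x; rewrite op_add op_sum id_opE.
  have VD y z : V (y + z) = V y + V z by rewrite linearD.
  have -> : \sum_(j < n) op_comp (op_comp V (op_comp (A j) U)) (T j) x =
      V (\sum_(j < n) A j (U (T j x))).
    by rewrite linear_sum; apply: eq_bigr => j _; rewrite !op_compE.
  rewrite -{1}(UV x) -VD; congr (V _); rewrite op_compE op_sum.
  apply: cts_ext => k; rewrite cts_evalD !cts_eval_sum.
  rewrite -[cts_eval (U x) k]mul1r -(a1 k) mulr_suml -big_split.
  apply: eq_bigr => j _; rewrite op_compE !AE.
  have -> : U (T j x) = T' j (U x) by rewrite /T' !op_compE UV.
  by rewrite T'E mulrDr mulrA.
elim: (n) LT => [|m IH] LT; first by rewrite big_ord0.
rewrite big_ord_recr; apply: LD; first by apply: IH => j jm; apply: LT; exact: ltnW.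
by apply: LM; exact: LT.
Qed.

End weak_multiplication_spaces.

(** * The six classes of spaces *)

Section trivial_space.
Variables (R : realType).

Lemma zero_subspace_linear : linear_subspace [set (0 : R[i])].
Proof. by split=> // a x y -> ->; rewrite scaler0 addr0. Qed.

Lemma zero_subspace_closed : closed [set (0 : R[i])].
Proof. exact/accessible_closed_set1/hausdorff_accessible/norm_hausdorff. Qed.

Definition zero_space : closed_subspace R[i] :=
  ClosedSubspace zero_subspace_linear zero_subspace_closed.

Lemma zero_spaceE (x : zero_space) : x = 0.
Proof. by apply: val_inj; have /asboolP := csub_valP x. Qed.

Definition zero_form : zero_space -> zero_space -> R[i] := fun _ _ => 0.

Lemma zero_form_zmodl u : zmod_morphism (zero_form ^~ u).
Proof. by move=> x y; rewrite /zero_form subrr. Qed.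

Lemma zero_form_zmodr u : zmod_morphism (zero_form u).
Proof. by move=> x y; rewrite /zero_form subrr. Qed.

Lemma zero_form_linearl u : scalable_for *%R (zero_form ^~ u).
Proof. by move=> a x; rewrite /zero_form mulr0. Qed.

Lemma zero_form_linearr u : scalable_for (Num.conj \; *%R) (zero_form u).
Proof. by move=> a x; rewrite /zero_form /= mulr0. Qed.

Lemma zero_form_hermitian x y :
  zero_form x y = (-1) ^+ false * Num.conj (zero_form y x).
Proof. by rewrite /zero_form rmorph0 mulr0. Qed.

Lemma zero_form_positive u : u != 0 -> 0 < zero_form u u.
Proof. by rewrite (zero_spaceE u) eqxx. Qed.

HB.instance Definition _ := isBilinear.Build R[i] zero_space zero_space R[i]
  *%R (Num.conj \; *%R) zero_form zero_form_zmodl zero_form_zmodr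
  zero_form_linearl zero_form_linearr.
HB.instance Definition _ := isHermitianSesquilinear.Build R[i] zero_space
  false Num.conj zero_form zero_form_hermitian.
HB.instance Definition _ := isDotProduct.Build R[i] zero_space zero_form
  zero_form_positive.

Lemma hilbert_zero_space : hilbert_space zero_space.
Proof.
exists (zero_form : {dot zero_space for Num.conj}) => x.
by rewrite (zero_spaceE x) normr0 expr0n.
Qed.

End trivial_space.

Section isomorphisms.
Variable R : realType.
Implicit Types E F G : completeNormedModType R[i].

Lemma isometric_isomorphic E F : isometrically_isomorphic E F -> isomorphic E F.
Proof.
move=> [U [Un Us]]; have [||V UV VU] := @inverse_operator R E F U 1.
- by move=> x; rewrite mul1r /nrm Un.
- by move=> y; have [x _ <-] : range U y by [rewrite Us]; exists x.
by exists U, V.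
Qed.

Lemma isomorphic_prod_trivial E F G : (forall z : G, z = 0) ->
  isomorphic E F -> isomorphic E (F * G)%type /\ isomorphic E (G * F)%type.
Proof.
move=> G0 [U [V [UV VU]]]; split.
  have [P PE] := pair_op U (0 : operator E G); have [p pE] := fst_op F G.
  exists P, (op_comp V p); split => [x|[y z]]; first by rewrite op_compE PE pE UV.
  by rewrite op_compE PE pE /= VU (G0 z) [X in (_, X)]G0.
have [P PE] := pair_op (0 : operator E G) U; have [p pE] := snd_op G F.
exists P, (op_comp V p); split => [x|[z y]]; first by rewrite op_compE PE pE UV.
by rewrite op_compE PE pE /= VU (G0 z) [X in (X, _)]G0.
Qed.

(** The zero space serves as Hilbert summand for [c0(I)] alone, and the empty
    index set for a Hilbert space alone. *)
Lemma c0_or_hilbert_sum E :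
  (exists I : Type, inhabited I /\ isometrically_isomorphic E (c0 R I)) \/
  hilbert_space E \/
  (exists (I : Type) (H : completeNormedModType R[i]),
     [/\ inhabited I, hilbert_space H & isomorphic E (c0 R I * H)%type]) ->
  exists (I : choiceType) (H : completeNormedModType R[i]),
    hilbert_space H /\ isomorphic E (c0 R I * H)%type.
Proof.
move=> [[I [_ /isometric_isomorphic EI]]|[hE|[I [H [_ hH EH]]]]].
- exists {classic I}, (zero_space R); split; first exact: hilbert_zero_space.
  by have [] := isomorphic_prod_trivial (@zero_spaceE R) EI.
- exists void, E; split => //.
  have z0 (z : c0 R void) : z = 0 by do 2!apply: val_inj; apply/funext => -[].
  have EE : isomorphic E E by exists (id_op E), (id_op E).
  by have [] := isomorphic_prod_trivial z0 EE.
- by exists {classic I}, H.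
Qed.

End isomorphisms.

Theorem theorem1p4 (R : realType) (E : completeNormedModType R[i])
  (hE :
    (has_schauder_basis E /\ complemented_in_bidual E) \/
    (exists X : completeNormedModType R[i],
        has_schauder_basis X /\ isomorphic E (dual X)) \/
    injective_space E \/
    ((exists I : Type, inhabited I /\ isometrically_isomorphic E (c0 R I)) \/
     hilbert_space E \/
     (exists (I : Type) (H : completeNormedModType R[i]),
        [/\ inhabited I, hilbert_space H & isomorphic E (c0 R I * H)%type])) \/
    few_operators E \/
    (exists K : topologicalType,
        [/\ compact [set: K], hausdorff_space K, isolated [set: K] = set0,
            isometrically_isomorphic E (cts R K) &
            forall T : operator (cts R K) (cts R K), weak_multiplication T]))
  (L : set (operator E E)) :
  maximal_left_ideal L -> finitely_generated L -> fixed_left_ideal L.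
Proof.
move=> Lmax Lfg; have [//|Lrank1] := maximal_fixed_or_rank_one Lmax.
exfalso; apply: (maximal_no_id Lmax).
have [F [Psi [n [pi [iota [Fsum LE]]]]]] := finitely_generated_factor Lfg.
have [C C0 PsiC] := nonfixed_bounded_below Lmax LE Lrank1.
have Llin : left_ideal L by have [] := Lmax.
have left_inverse (S : operator F E) : (forall x, S (Psi x) = x) -> L (id_op E).
  by move=> SP; apply/LE; exists S; apply: op_ext => x; rewrite op_compE SP.
pose T l := op_comp (pi l) Psi.
have LT l : L (T l) by apply/LE; exists (pi l).
have TC x : nrm x <= (C * \sum_(l < n) nrm (iota l)) * \sum_(l < n) nrm (T l x).
  apply: (le_trans (PsiC x)); rewrite -mulrA ler_wpM2l //.
  rewrite {1}(Fsum (Psi x)) (le_trans (nrm_sum _ _ _)) // mulr_sumr.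
  apply: ler_sum => l _; rewrite (le_trans (nrm_op _ _)) // ler_wpM2r ?nrm_ge0 //.
  by rewrite (bigD1 l) //= lerDl; apply: sumr_ge0 => i _; exact: nrm_ge0.
case: hE => [[hB hC]|[[X [hB hX]]|[hI|[hH|[hF|[K [Kc Kh Ki hK hW]]]]]]].
- exact: (basis_bidual_identity Lmax LE Lrank1 hB hC).
- exact: (dual_of_basis_identity Lmax LE Lrank1 hB hX).
- by have [S] := injective_left_inverse PsiC hI; exact: left_inverse.
- have [I [H [hH' EH]]] := c0_or_hilbert_sum hH.
  by have [S] := c0_hilbert_identity hH' EH C0 PsiC Fsum; exact: left_inverse.
- exact: (few_operators_identity Llin Lrank1 hF (fun j _ => LT j) TC).
- exact: (weak_multiplication_identity Kc Kh Ki hW Llin Lrank1 hK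
    (fun j _ => LT j) TC).
Qed.
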